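(* Let $g>0$, $\beta>0$, $\bar h>0$, let $(h_0-\bar h,u_0)\in H^2(\mathbb{R})$ satisfy $\inf_{x\in\mathbb{R}}h_0(x)>0$, let $(h-\bar h,u)$ be the corresponding solution of the mSGN system with maximal existence time $T_{max}$, and let $t\in[0,T_{max})$. Then there exist constants $A>0$ and $B>0$, depending only on $\beta$, $\bar h$ (and the fixed constant $g$), $\|(h,u,h^{-1})\|_{L^\infty([0,t]\times\mathbb{R})}$ and $\int_{\mathbb{R}}\mathscr{E}\,\mathrm{d}x$, such that for any $x_2\in\mathbb{R}$, and for $x_1\in(-\infty,x_2)$ the solution of $X_{x_1}(t)=Y_{x_2}(t)$, we have $$\int_0^tQ(\tau,X_{x_1}(\tau))^2\,\mathrm{d}\tau+\int_0^tP(\tau,Y_{x_2}(\tau))^2\,\mathrm{d}\tau\ \leqslant\ A\,t+B.$$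
   Context: Set $\alpha=1+\tfrac32\beta$. For a function $h$ with $\inf h>0$, let $\mathcal{L}_h f=hf-\tfrac{\alpha}{3}\partial_x(h^3\partial_x f)$, which is an isomorphism from $H^2(\mathbb{R})$ to $L^2(\mathbb{R})$ when $h\in W^{1,\infty}$, $h>0$, $h^{-1}\in L^\infty$. The mSGN system, for $(t,x)$ with $x\in\mathbb{R}$, is $$h_t+[hu]_x=0,$$ $$u_t+u\,u_x+\tfrac{\alpha-1}{\alpha}g\,h_x=-\mathcal{L}_h^{-1}\partial_x\Big\{\tfrac23\alpha h^3u_x^2-\tfrac14\beta g h^2h_x^2+\tfrac{g}{2\alpha}h^2\Big\},$$ with initial condition $(h,u)|_{t=0}=(h_0,u_0)$. Local well-posedness (known): for $s\geqslant2$ and $(h_0-\bar h,u_0)\in H^s(\mathbb{R})$ with $\inf h_0>0$ there are $T>0$ and a unique solution $(h-\bar h,u)\in C^0([0,T],H^s(\mathbb{R}))\cap C^1([0,T],H^{s-1}(\mathbb{R}))$ with $\inf_{[0,T]\times\mathbb{R}}h>0$; $T_{max}$ is the supremum of such $T$. The energy $\int_{\mathbb{R}}\mathscr{E}\,\mathrm{d}x$, where $$\mathscr{E}=\tfrac12hu^2+\tfrac16\alpha h^3u_x^2+\tfrac12g(h-\bar h)^2+\tfrac14\beta g h^2h_x^2,$$ is constant in time along such a solution (known). Characteristic speeds: $\lambda=u+\sqrt{\tfrac{\alpha-1}{\alpha}gh}$ and $\mu=u-\sqrt{\tfrac{\alpha-1}{\alpha}gh}$. For $a\in\mathbb{R}$,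 $X_a$ and $Y_a$ solve $$\tfrac{\mathrm{d}}{\mathrm{d}t}X_a(t)=\lambda(t,X_a(t)),\ X_a(0)=a,\qquad \tfrac{\mathrm{d}}{\mathrm{d}t}Y_a(t)=\mu(t,Y_a(t)),\ Y_a(0)=a.$$ Also $$P=u_x+\sqrt{\tfrac{\alpha-1}{\alpha}g}\,h^{-1/2}h_x,\qquad Q=u_x-\sqrt{\tfrac{\alpha-1}{\alpha}g}\,h^{-1/2}h_x.$$ *)

(* Defs.v *)
From HB Require Import structures.
From mathcomp Require Import all_boot all_order all_algebra.
From mathcomp Require Import all_classical all_reals all_analysis.

Set Implicit Arguments.
Unset Strict Implicit.
Unset Printing Implicit Defensive.

Import Order.TTheory GRing.Theory Num.Theory.
Import numFieldNormedType.Exports.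

Local Open Scope classical_set_scope.
Local Open Scope ring_scope.

Section Sobolev.
Variable R : realType.
Local Notation mu := (@lebesgue_measure R).
Implicit Types (f g phi : R -> R) (F G : R -> R -> R) (J : set R).

(* Tests of class C^1 with compact support; for locally integrable functions
   they determine the same weak derivatives as smooth ones. *)
Definition test_function phi : Prop :=
  [/\ forall x, derivable phi x 1, continuous (derive1 phi) &
      exists M : R, forall x, M < `|x| -> phi x = 0].

Definition weak_derivative f g : Prop :=
  [/\ locally_integrable setT f, locally_integrable setT g &
      forall phi, test_function phi ->
        \int[mu]_x (f x * derive1 phi x) = - \int[mu]_x (g x * phi x)].

(* The weak derivative is unique up to a null set; [wderiv f] is some
   representative of it, and is only meant to be used almost everywhere or
   under an integral. *)
Definition wderiv f : R -> R := xget (cst 0) [set g | weak_derivative f g].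

Fixpoint sobolev (k : nat) f : Prop :=
  f \in Lfun mu 2%:E /\
  if k is k'.+1 then exists2 g, weak_derivative f g & sobolev k' g else True.

Definition sobolev_norm (k : nat) f : \bar R :=
  ((\sum_(i < k.+1) 'N[mu]_2%:E [EFin \o iter i wderiv f] `^ 2) `^ (2^-1)%R)%E.

(* Curves are written [F t x]. *)
Definition C0_sobolev J (k : nat) F : Prop :=
  forall t, J t -> sobolev k (F t) /\
    sobolev_norm k (fun x => F s x - F t x) @[s --> within J (nbhs t)] --> 0%E.

(* One-sided time derivatives are meant at the endpoints of J. *)
Definition C1_sobolev J (k : nat) F G : Prop :=
  C0_sobolev J k G /\
  forall t, J t ->
    sobolev_norm k (fun x => (F s x - F t x) / (s - t) - G t x)
      @[s --> within J t^'] --> 0%E.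

Definition ess_norm J (F : R * R -> R) : \bar R :=
  'N[(mu \x mu)%E]_+oo [(EFin \o F) \_ (J `*` setT)].

End Sobolev.

Section MSGN.
Variable R : realType.
Local Notation mu := (@lebesgue_measure R).
Implicit Types (g beta hbar a T t : R) (h u : R -> R -> R).

Definition msgn_alpha beta : R := 1 + 3 / 2 * beta.

Definition Lop beta (h0 v : R -> R) : R -> R := fun x =>
  h0 x * v x
  - msgn_alpha beta / 3 * wderiv (fun y => h0 y ^+ 3 * wderiv v y) x.

(* v = L_h^{-1} psi, as elements of L^2: the inverse of L_h : H^2 -> L^2 is
   given by its graph. *)
Definition is_Linv beta (h0 psi v : R -> R) : Prop :=
  sobolev 2 v /\ {ae mu, forall x, Lop beta h0 v x = psi x}.

Definition msgn_source g beta (h0 u0 : R -> R) : R -> R := fun x =>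
  2 / 3 * msgn_alpha beta * h0 x ^+ 3 * wderiv u0 x ^+ 2
  - 1 / 4 * beta * g * h0 x ^+ 2 * wderiv h0 x ^+ 2
  + g / (2 * msgn_alpha beta) * h0 x ^+ 2.

(* At every time, elements of H^2 are represented by their continuous (hence
   C^1) representative, so that h, u, h_x and u_x have values at points. *)
Definition msgn_solution g beta hbar (h0 u0 : R -> R) T h u : Prop :=
  let al := msgn_alpha beta in
  let J := `[0, T]%classic in
  [/\ (forall t, J t -> continuous (h t) /\ continuous (u t)),
      C0_sobolev J 2 (fun t x => h t x - hbar) /\ C0_sobolev J 2 u,
      (0 < ereal_inf [set (h z.1 z.2)%:E | z in J `*` setT])%E,
      h 0 =1 h0 /\ u 0 =1 u0 &
      exists ht ut : R -> R -> R,
        [/\ C1_sobolev J 1 (fun t x => h t x - hbar) ht,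
            C1_sobolev J 1 u ut &
            forall t, J t ->
              {ae mu, forall x, ht t x + wderiv (fun y => h t y * u t y) x = 0}
              /\ exists2 v, is_Linv beta (h t)
                              (wderiv (msgn_source g beta (h t) (u t))) v &
                   {ae mu, forall x,
                     ut t x + u t x * wderiv (u t) x
                     + (al - 1) / al * g * wderiv (h t) x = - v x}]].

Definition is_Tmax g beta hbar (h0 u0 : R -> R) (Tmax : \bar R) : Prop :=
  Tmax = ereal_sup [set T%:E | T in
    [set T : R | 0 < T /\ exists h u, msgn_solution g beta hbar h0 u0 T h u]].

Definition energy g beta hbar (h0 u0 : R -> R) : \bar R :=
  (\int[mu]_x
    (1 / 2 * h0 x * u0 x ^+ 2
     + 1 / 6 * msgn_alpha beta * h0 x ^+ 3 * wderiv u0 x ^+ 2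
     + 1 / 2 * g * (h0 x - hbar) ^+ 2
     + 1 / 4 * beta * g * h0 x ^+ 2 * wderiv h0 x ^+ 2)%:E)%E.

Definition Linfty_norm t h u : \bar R :=
  ess_norm `[0, t]%classic (fun z =>
    Num.max (Num.max `|h z.1 z.2| `|u z.1 z.2|) `|(h z.1 z.2)^-1|).

Definition lambda_speed g beta h u : R -> R -> R := fun t x =>
  u t x
  + Num.sqrt ((msgn_alpha beta - 1) / msgn_alpha beta * g * h t x).

Definition mu_speed g beta h u : R -> R -> R := fun t x =>
  u t x
  - Num.sqrt ((msgn_alpha beta - 1) / msgn_alpha beta * g * h t x).

(* The derivative is one-sided at an endpoint of J. *)
Definition characteristic (J : set R) (c : R -> R -> R) a (X : R -> R) : Prop :=
  X 0 = a /\
  forall t, J t ->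
    (X s - X t) / (s - t) @[s --> within J t^'] --> c t (X t).

(* Here the space derivatives are classical: P and Q are evaluated along
   curves. *)
Definition riemannP g beta h u : R -> R -> R := fun t x =>
  derive1 (u t) x
  + Num.sqrt ((msgn_alpha beta - 1) / msgn_alpha beta * g)
    * (Num.sqrt (h t x))^-1 * derive1 (h t) x.

Definition riemannQ g beta h u : R -> R -> R := fun t x =>
  derive1 (u t) x
  - Num.sqrt ((msgn_alpha beta - 1) / msgn_alpha beta * g)
    * (Num.sqrt (h t x))^-1 * derive1 (h t) x.

End MSGN.

(* Main.v *)
(* The energy density e satisfies e_t + D_x = 0.  Let F(s) be the energy at time
   s between X(s) and Y(s): it is at most the total energy at s = 0, vanishes at
   s = t, and
     F' = - (D - mu e)(Y) - (lambda e - D)(X).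
   Along X, lambda e - D equals alpha/6 h^3 c Q^2, with c the square root of
   (alpha - 1)/alpha g h, plus a nonnegative term, minus
   u (w + (alpha - 1)/(2 alpha) g (h^2 - hbar^2)); along Y, D - mu e is the
   analogous expression in P.  The nonlocal pressure w, with
   w' = h L_h^{-1} d_x{...}, is bounded in H^1, hence uniformly, by the energy,
   so F' <= A - c0 (Q^2 + P^2), which is integrated over [0, t].

   Since h_x and u_x are not differentiable in time at points, F is
   differentiated through integrals: the difference quotients of the energy of
   a fixed half-line converge by L^2 convergence of its factors, and moving its
   end point along a characteristic adds the end value of e times the speed,
   by uniform convergence.  Weakly differentiable functions are handled
   throughout as primitives of their derivatives, by du Bois-Reymond's lemma. *)
Require Import Defs.
From HB Require Import structures.
From mathcomp Require Import all_boot all_order all_algebra.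
From mathcomp Require Import all_classical all_reals all_analysis.
From mathcomp Require Import measurable_realfun ess_sup_inf.
From mathcomp Require Import ring lra.
Import Order.TTheory GRing.Theory Num.Theory.
Import numFieldNormedType.Exports.
Local Open Scope classical_set_scope.
Local Open Scope ring_scope.

Set Implicit Arguments.
Unset Strict Implicit.
Unset Printing Implicit Defensive.

(** * Integrals and absolutely continuous functions *)

Section Toolkit.
Variable R : realType.
Local Notation mu := (@lebesgue_measure R).
Local Notation mR := (measurableTypeR R).
Local Notation mble f := (@measurable_fun _ _ mR mR setT f).
Local Notation mbleon A f := (@measurable_fun _ _ mR mR A f).
Local Notation intg A f := (mu.-integrable A (EFin \o f)).
Implicit Types (f g : R -> R) (A : set mR).

(** The constants may see the solution only through [N] and [Etot]. One number [N] bounds [h], [1/h]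
    and [u], hence [N^-1 <= h <= N] and [1 <= N]; but it is an essential norm, and joint continuity
    is what turns it into pointwise bounds. The pressure at time [s] is controlled by the energy at
    that same time, so conservation is needed to replace it by [Etot]; it is derived at H^2
    regularity, from the same difference quotients taken over the whole line.

    The nonlocal term [v] is obtained separately at each time, with no information on how it varies,
    so [F'] exists everywhere but is not known to be continuous or even integrable. The inequality
    for [F'] is therefore not integrated by the fundamental theorem: a supremum argument compares
    [F] directly with the integral of the right-hand side, which is continuous. The same argument
    gives the product rule for primitives. *)

Lemma local_to_global_le0 (H : R -> R -> R) (a b : R) :
  (forall x y z, a <= x -> x <= y -> y <= z -> z <= b ->
     H x z <= H x y + H y z) ->
  a <= b ->
  (forall x, a <= x <= b -> exists2 d, 0 < d &
     forall p q, a <= p -> p <= x -> x <= q -> q <= b -> q - p < d ->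
       H p q <= 0) ->
  H a b <= 0.
Proof.
move=> Hadd ab Hloc.
(* Points reached from [a] with a nonpositive value. Locality at the supremum shows that it is
   itself reached, and passes beyond it unless it equals [b]. *)
pose S := [set s | a <= s <= b /\ H a s <= 0].
have Sa : S a.
  split; first by rewrite lexx.
  have [|d d0] := Hloc a; first by rewrite lexx.
  by apply => //; rewrite subrr.
have Sub : ubound S b by move=> s [/andP[]].
have hS : has_sup S by split; [exists a | exists b].
set x := sup S.
have ax : a <= x by apply: ub_le_sup => //; case: hS.
have xb : x <= b by apply: ge_sup => //; exists a.
have [|d d0 Hd] := Hloc x; first by rewrite ax.
have d20 : 0 < d / 2 by rewrite divr_gt0.
have [s Ss xs] := sup_adherent d20 hS.
have sx : s <= x by apply: ub_le_sup => //; case: hS.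
case: (Ss) => /andP[as_ sb] Has; rewrite -/x in xs.
have key q : x <= q -> q <= b -> q < x + d / 2 -> H a q <= 0.
  move=> xq qb qd; apply: (le_trans (Hadd _ s _ (lexx a) as_ (le_trans sx xq) qb)).
  have : H s q <= 0 by apply: Hd => //; lra.
  lra.
have [bx|xb'] := leP b x.
  have -> : b = x by apply/eqP; rewrite eq_le bx xb.
  by apply: key => //; lra.
pose q := Num.min b (x + d / 4).
have xq : x < q by rewrite lt_min xb'/=; lra.
have qb : q <= b by rewrite ge_min lexx.
have qd : q < x + d / 2.
  by apply: (@le_lt_trans _ _ (x + d / 4)); [rewrite ge_min lexx orbT|lra].
have : q <= x.
  apply: ub_le_sup; first by case: hS.
  split; last by apply: key => //; exact: ltW.
  by rewrite qb (le_trans ax (ltW xq)).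
by rewrite leNgt xq.
Qed.

Lemma ae_forall (P : R -> Prop) : (forall x, P x) -> {ae mu, forall x, P x}.
Proof. by move=> ?; apply: aeW. Qed.

Lemma ae_impl (P Q : R -> Prop) : (forall x, P x -> Q x) ->
  {ae mu, forall x, P x} -> {ae mu, forall x, Q x}.
Proof.
by move=> PQ; apply: filterS PQ; exact: (ae_filter_ringOfSetsType mu).
Qed.

Lemma ae_conj (P Q : R -> Prop) : {ae mu, forall x, P x} ->
  {ae mu, forall x, Q x} -> {ae mu, forall x, P x /\ Q x}.
Proof.
by move=> aP aQ; apply: filterI => //; exact: (ae_filter_ringOfSetsType mu).
Qed.

Lemma intg_add A f g : measurable A -> intg A f -> intg A g ->
  intg A (fun x => f x + g x).
Proof. by move=> mA fi gi; exact: (integrableD mA fi gi). Qed.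

Lemma intg_opp A f : measurable A -> intg A f -> intg A (fun x => - f x).
Proof. by move=> mA fi; exact: (integrableN fi). Qed.

Lemma intg_sub A f g : measurable A -> intg A f -> intg A g ->
  intg A (fun x => f x - g x).
Proof. by move=> mA fi gi; exact: (integrableB mA fi gi). Qed.

Lemma intg_scale A f (k : R) : measurable A -> intg A f ->
  intg A (fun x => k * f x).
Proof. by move=> mA fi; exact: (integrableZl mA _ fi). Qed.

Lemma intg_norm A f : intg A f -> intg A (fun x => `|f x|).
Proof. by move=> fi; exact: integrable_norm. Qed.

Lemma intg_dom A f g : measurable A -> mbleon A f ->
  (forall x, A x -> `|f x| <= g x) -> intg A g -> intg A f.
Proof.
move=> mA mf fg gi; apply: (le_integrable mA _ _ gi) => //.
  exact/measurable_EFinP.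
move=> x Ax /=; rewrite lee_fin (le_trans (fg _ Ax))//.
exact: ler_norm.
Qed.

Lemma intg_cst (a b k : R) : intg `[a, b] (cst k).
Proof.
apply: continuous_compact_integrable; first exact: segment_compact.
by apply: continuous_subspaceT => x; exact: cvg_cst.
Qed.

Lemma intg_cont f (a b : R) : continuous f -> intg `[a, b] f.
Proof.
move=> cf; apply: continuous_compact_integrable; first exact: segment_compact.
exact: continuous_subspaceT.
Qed.

Lemma meas_cont f : continuous f -> mble f.
Proof. exact: continuous_measurable_fun. Qed.

Lemma Rint_split f (a b c : R) : a <= b -> b <= c -> intg `[a, c] f ->
  \int[mu]_(x in `[a, c]) f x =
  \int[mu]_(x in `[a, b]) f x + \int[mu]_(x in `[b, c]) f x.
Proof.
move=> ab bc fi.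
have := @Rintegral_itvB R f (BLeft a) (BRight c) b fi.
rewrite !bnd_simp => /(_ ab bc).
rewrite Rintegral_itv_obnd_cbnd; last first.
  apply: integrableS fi => //; apply: subset_itvr; rewrite bnd_simp//.
by move=> <-; rewrite addrC subrK.
Qed.

Lemma Rint_cst (a b k : R) : a <= b ->
  \int[mu]_(x in `[a, b]) k = k * (b - a).
Proof.
move=> ab; rewrite Rintegral_cst//= lebesgue_measure_itv/= lte_fin.
by case: ltgtP ab => //= -> _; rewrite subrr.
Qed.

Lemma Rint_ae_eq A f g : measurable A -> mbleon A f ->
  mbleon A g -> {ae mu, forall x, A x -> f x = g x} ->
  \int[mu]_(x in A) f x = \int[mu]_(x in A) g x.
Proof.
move=> mA mf mg fg; congr fine; apply: ae_eq_integral => //.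
- exact/measurable_EFinP.
- exact/measurable_EFinP.
- by apply: ae_impl fg => x + Ax => /(_ Ax) ->.
Qed.

Lemma intg_ae_eq A f g : measurable A -> mbleon A g ->
  {ae mu, forall x, A x -> f x = g x} -> intg A f -> intg A g.
Proof.
move=> mA mg fg /integrableP[mf fi]; apply/integrableP; split.
  exact/measurable_EFinP.
have -> : (\int[mu]_(x in A) `|(EFin \o g) x| = \int[mu]_(x in A) `|(EFin \o f) x|)%E; last by [].
apply: ae_eq_integral => //.
- by apply: measurableT_comp => //; exact/measurable_EFinP.
- by apply: measurableT_comp => //; exact: measurableT_comp.
- by apply: ae_impl fg => x + Ax => /= /(_ Ax) ->.
Qed.

Definition locint f := mble f /\ forall a b, intg `[a, b] f.

Lemma measT A f : mble f -> mbleon A f.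
Proof. by move=> mf; apply: measurable_funS mf. Qed.

Lemma locint_locally f : locally_integrable setT f <-> locint f.
Proof.
split.
  move=> [mf _ fK]; split => // a b; apply/integrableP; split.
    by apply/measurable_EFinP; exact: measT.
  by apply: fK => //; exact: segment_compact.
move=> [mf fi]; split => //; first exact: openT.
move=> K _ cK.
have [M [_ KM]] := compact_bounded cK.
have KS : K `<=` `[- (M + 1), M + 1].
  move=> x Kx; have := KM (M + 1) ltac:(lra) x Kx.
  by rewrite /= in_itv/= ler_norml.
suff /integrableP[] : intg K f by [].
have mK : measurable (K : set mR) by exact: (@compact_measurable R K cK).
apply: (@integrableS _ _ _ mu (`[- (M + 1), M + 1]%classic : set mR) (K : set mR)) => //.
Qed.

Lemma locint_cont f : continuous f -> locint f.
Proof.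
by move=> cf; split; [exact: meas_cont|move=> a b; exact: intg_cont].
Qed.

Lemma locintD f g : locint f -> locint g -> locint (fun x => f x + g x).
Proof.
move=> [mf fi] [mg gi]; split; first exact: measurable_funD.
by move=> a b; apply: intg_add.
Qed.

Lemma locintZ f (k : R) : locint f -> locint (fun x => k * f x).
Proof.
move=> [mf fi]; split; first exact: measurable_funM.
by move=> a b; apply: intg_scale.
Qed.

Lemma cont_bounded f (a b : R) : continuous f ->
  exists2 M, 0 <= M & forall x, `[a, b]%classic x -> `|f x| <= M.
Proof.
move=> cf.
have cfA : {within `[a, b], continuous f} by exact: continuous_subspaceT.
have := continuous_compact cfA (@segment_compact _ a b).
move=> /compact_bounded[M [_ mrt]].
exists (`|M| + 1); first by rewrite addr_ge0.
move=> x abx; apply: mrt; last by exists x.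
by rewrite (le_lt_trans (ler_norm M))// ltrDl.
Qed.

Lemma locintM f g : continuous f -> locint g -> locint (fun x => f x * g x).
Proof.
move=> cf [mg gi]; have mf := meas_cont cf.
have mfg : mble (fun x => f x * g x) by exact: measurable_funM.
split => // a b.
have [M M0 fM] := cont_bounded a b cf.
apply: (@intg_dom _ _ (fun x => M * `|g x|)) => //.
- exact: measT.
- by move=> x abx; rewrite normrM ler_wpM2r// fM.
- by apply: intg_scale => //; apply: intg_norm.
Qed.

Lemma locint_ae f g : mble g -> {ae mu, forall x, f x = g x} ->
  locint f -> locint g.
Proof.
move=> mg fg [mf fi]; split => // a b; apply: (@intg_ae_eq _ f) => //.
  exact: measT.
by apply: ae_impl fg => x -> _.
Qed.

(* Absolute continuity; [weak_prim] and [prim_weak] translate it into weak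
   differentiability. *)
Definition prim f g := locint g /\
  forall a b, a <= b -> f b - f a = \int[mu]_(x in `[a, b]) g x.

Lemma prim_cont f g : prim f g -> continuous f.
Proof.
move=> [[mg gi] fg] x.
have H := @parameterized_integral_continuous R (x - 1) (x + 1) g ltac:(lra) (gi _ _).
have H1 : {for x, continuous (fun y => parameterized_integral mu (x - 1) y g)}.
  apply: (within_continuous_continuous _ H); first by lra.
  by rewrite in_itv/=; apply/andP; split; lra.
have H2 : f (x - 1) + parameterized_integral mu (x - 1) y g @[y --> x] -->
    f (x - 1) + parameterized_integral mu (x - 1) x g.
  by apply: cvgD; [exact: cvg_cst|exact: H1].
have fE y : x - 1 <= y -> f y = f (x - 1) + parameterized_integral mu (x - 1) y g.
  by move=> xy; rewrite /parameterized_integral -fg//; ring.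
rewrite /continuous_at fE; last by lra.
apply: cvg_trans H2; apply: near_eq_cvg; near=> y.
apply/esym/fE; apply/ltW; near: y.
by apply: lt_nbhsr; lra.
Unshelve. all: by end_near. Qed.

(** Closes arguments whose error is [e] times a fixed quantity, without asking for the sign of that
    quantity. *)
Lemma le0_eps (x M : R) : (forall e, 0 < e -> x <= e * M) -> x <= 0.
Proof.
move=> H; rewrite leNgt; apply/negP => x0.
have M1 : 0 < `|M| + 1 by rewrite ltr_wpDl.
have := H (x / 2 / (`|M| + 1)) ltac:(by rewrite !divr_gt0).
apply/negP; rewrite -ltNge.
apply: (@le_lt_trans _ _ (x / 2 / (`|M| + 1) * (`|M| + 1))).
  apply: ler_wpM2l; first by rewrite !divr_ge0// ltW.
  by rewrite (le_trans (ler_norm M))// lerDl.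
by rewrite divfK ?gt_eqF//; lra.
Qed.

Lemma primD f f' g g' : prim f f' -> prim g g' ->
  prim (fun x => f x + g x) (fun x => f' x + g' x).
Proof.
move=> [lf Hf] [lg Hg]; split; first exact: locintD.
move=> a b ab; rewrite RintegralD//; [|exact: lf.2|exact: lg.2].
by rewrite -Hf// -Hg//; ring.
Qed.

Lemma primZ f f' (k : R) : prim f f' ->
  prim (fun x => k * f x) (fun x => k * f' x).
Proof.
move=> [lf Hf]; split; first exact: locintZ.
by move=> a b ab; rewrite RintegralZl//; [rewrite -Hf//; ring|exact: lf.2].
Qed.

Lemma prim_cst (k : R) : prim (cst k) (cst 0).
Proof.
split; first by apply: locint_cont => x; exact: cvg_cst.
by move=> a b ab; rewrite Rint_cst// subrr mul0r.
Qed.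

Lemma prim_eq f f' g : prim f g -> (forall x, f x = f' x) -> prim f' g.
Proof. by move=> [? H] ff; split => // a b ab; rewrite -!ff H. Qed.

Lemma prim_ae f g g' : prim f g -> mble g' -> {ae mu, forall x, g x = g' x} ->
  prim f g'.
Proof.
move=> [lg H] mg' gg; split; first exact: locint_ae lg.
move=> a b ab; rewrite H//; apply: Rint_ae_eq => //.
- by apply: measT; case: lg.
- exact: measT.
- by apply: ae_impl gg.
Qed.

Lemma primM f f' g g' : prim f f' -> prim g g' ->
  prim (fun x => f x * g x) (fun x => f' x * g x + f x * g' x).
Proof.
move=> pf pg; have cf := prim_cont pf; have cg := prim_cont pg.
case: (pf) => lf Hf; case: (pg) => lg Hg.
have lG : locint (fun x => f' x * g x + f x * g' x).
  apply: locintD; last exact: locintM.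
  by under eq_fun do rewrite mulrC; exact: locintM.
split => // a b ab.
pose m x := `|f' x| + `|g' x|.
have im c d : intg `[c, d] m.
  by apply: intg_add => //; apply: intg_norm; [exact: lf.2|exact: lg.2].
(* The defect [T] is additive over adjacent intervals, and small intervals
   contribute at most [e] times the integral of [m]. *)
pose T p q := f q * g q - f p * g p -
  \int[mu]_(x in `[p, q]) (f' x * g x + f x * g' x).
have loc e x : 0 < e -> exists2 d, 0 < d & forall p q, p <= x -> x <= q ->
    q - p < d -> `|T p q| <= e * \int[mu]_(x in `[p, q]) m x.
  move=> e0; have e20 : 0 < e / 2 by rewrite divr_gt0.
  have /cvgrPdist_lt/(_ _ e20)[d1 /= d10 fd] := cf x.
  have /cvgrPdist_lt/(_ _ e20)[d2 /= d20 gd] := cg x.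
  exists (Num.min d1 d2); first by rewrite lt_min d10 d20.
  move=> p q px xq; rewrite lt_min => /andP[pq1 pq2].
  have pq := le_trans px xq.
  have fy y z : p <= y <= q -> p <= z <= q -> `|f y - f z| <= e.
    move=> /andP[? ?] /andP[? ?].
    have Y : `|f x - f y| < e / 2.
      by apply: fd; rewrite /= ltr_norml; apply/andP; split; lra.
    have Z : `|f x - f z| < e / 2.
      by apply: fd; rewrite /= ltr_norml; apply/andP; split; lra.
    by move: Y Z; rewrite !ltr_norml ler_norml => /andP[? ?] /andP[? ?];
      apply/andP; split; lra.
  have gy y z : p <= y <= q -> p <= z <= q -> `|g y - g z| <= e.
    move=> /andP[? ?] /andP[? ?].
    have Y : `|g x - g y| < e / 2.
      by apply: gd; rewrite /= ltr_norml; apply/andP; split; lra.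
    have Z : `|g x - g z| < e / 2.
      by apply: gd; rewrite /= ltr_norml; apply/andP; split; lra.
    by move: Y Z; rewrite !ltr_norml ler_norml => /andP[? ?] /andP[? ?];
      apply/andP; split; lra.
  have i1 : intg `[p, q] (fun y => g q * f' y) by apply: intg_scale => //; exact: lf.2.
  have i2 : intg `[p, q] (fun y => f p * g' y) by apply: intg_scale => //; exact: lg.2.
  have i3 : intg `[p, q] (fun y => g q * f' y + f p * g' y) by exact: intg_add.
  (* From [f q * g q - f p * g p = g q * (f q - f p) + f p * (g q - g p)]. The integrand is then
     [f'] and [g'] times oscillations of [g] and [f], which are at most [e] on a short interval. *)
  have TE : T p q = \int[mu]_(y in `[p, q])
      ((g q * f' y + f p * g' y) - (f' y * g y + f y * g' y)).
    rewrite RintegralB//; last exact: lG.2.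
    rewrite RintegralD// RintegralZl//; last exact: lf.2.
    rewrite RintegralZl//; last exact: lg.2.
    by rewrite -Hf// -Hg// /T; ring.
  have i4 : intg `[p, q] (fun y =>
      (g q * f' y + f p * g' y) - (f' y * g y + f y * g' y)).
    by apply: intg_sub => //; exact: lG.2.
  rewrite TE -RintegralZl//.
  apply: (le_trans (le_normr_Rintegral _ i4)) => //.
  apply: le_Rintegral => //.
  - exact: intg_norm.
  - exact: intg_scale.
  move=> y; rewrite /= in_itv/= => ypq.
  have -> : g q * f' y + f p * g' y - (f' y * g y + f y * g' y) =
    f' y * (g q - g y) + g' y * (f p - f y) by ring.
  rewrite (le_trans (ler_normD _ _))// !normrM /m mulrDr [leRHS]addrC addrC.
  apply: lerD; rewrite mulrC ler_wpM2r//; [apply: gy|apply: fy] => //.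
    by rewrite lexx andbT.
  by rewrite lexx.
have Tadd p q r : p <= q -> q <= r -> T p r = T p q + T q r.
  by move=> pq qr; rewrite /T (Rint_split pq qr (lG.2 _ _)); ring.
(* [local_to_global_le0] bounds from above only; taking [s] to be [1] and then [-1] makes the defect
   vanish. *)
have bound e (s : R) : 0 < e -> `|s| <= 1 ->
    s * T a b <= e * \int[mu]_(x in `[a, b]) m x.
  move=> e0 s1; rewrite -subr_le0.
  apply: (@local_to_global_le0 (fun p q =>
    s * T p q - e * \int[mu]_(x in `[p, q]) m x)) => //.
    move=> p q r _ pq qr _; rewrite (Tadd _ _ _ pq qr) (Rint_split pq qr (im _ _)).
    by rewrite le_eqVlt; apply/orP; left; apply/eqP; ring.
  move=> x _; have [d d0 Hd] := loc e x e0; exists d => // p q _ px xq _ pqd.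
  rewrite subr_le0; apply: le_trans (Hd p q px xq pqd).
  rewrite (le_trans (ler_norm _))// normrM ler_piMl//.
have T1 : 1 * T a b <= 0.
  by apply: le0_eps => e e0; apply: bound => //; rewrite normr1.
have T2 : -1 * T a b <= 0.
  by apply: le0_eps => e e0; apply: bound => //; rewrite normrN1.
by move: T1 T2; rewrite /T; lra.
Qed.

Lemma primB f f' g g' : prim f f' -> prim g g' ->
  prim (fun x => f x - g x) (fun x => f' x - g' x).
Proof.
move=> pf pg; have := primD pf (primZ (-1) pg).
by under eq_fun do rewrite mulN1r; under [X in prim _ X]eq_fun do rewrite mulN1r.
Qed.

End Toolkit.

(** * Weak derivatives *)

Section WeakDerivatives.
Variable R : realType.
Local Notation mu := (@lebesgue_measure R).
Local Notation mR := (measurableTypeR R).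
Local Notation mble f := (@measurable_fun _ _ mR mR setT f).
Local Notation mbleon A f := (@measurable_fun _ _ mR mR A f).
Local Notation intg A f := (mu.-integrable A (EFin \o f)).
Implicit Types (f g : R -> R) (A : set mR).

Lemma derivable_cont f : (forall x, derivable f x 1) -> continuous f.
Proof. by move=> df x; apply: differentiable_continuous; apply/derivable1_diffP. Qed.

Lemma prim_C1 f : (forall x, derivable f x 1) -> continuous (derive1 f) ->
  prim f (derive1 f).
Proof.
move=> df cf'; split; first exact: locint_cont.
have cf := derivable_cont df.
move=> a b; rewrite le_eqVlt => /predU1P[->|ab].
  by rewrite subrr set_itv1 Rintegral_set1.
have cf'ab : {within `[a, b], continuous (derive1 f)} by exact: continuous_subspaceT.
have dfab : derivable_oo_LRcontinuous f a b.
  split; first by move=> x _; exact: df.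
  - by apply: cvg_at_right_filter; exact: cf.
  - by apply: cvg_at_left_filter; exact: cf.
by rewrite /Rintegral (continuous_FTC2 ab cf'ab dfab (fun x _ => erefl)).
Qed.

(** With a quadratic remainder, differentiating a function defined by cases reduces to polynomial
    inequalities. *)
Lemma is_derive_quadratic f (x D C : R) :
  (forall h, `|f (h + x) - f x - h * D| <= C * h ^+ 2) ->
  derivable f x 1 /\ derive1 f x = D.
Proof.
move=> H.
suff cv : h^-1 *: (f (h *: 1 + x) - f x) @[h --> 0^'] --> D.
  split; first by apply/cvg_ex; exists D.
  rewrite derive1E; apply/cvg_lim => //.
have C0 : 0 <= C.
  by have := H 1; rewrite expr1n mulr1; apply: le_trans; exact: normr_ge0.
apply/cvgrPdist_lt => e e0; near=> h.
have h0 : h != 0 by near: h; exact: nbhs_dnbhs_neq.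
rewrite [h *: 1]mulr1.
have -> : D - h^-1 *: (f (h + x) - f x) = - (h^-1 * (f (h + x) - f x - h * D)).
  by rewrite /GRing.scale/=; field.
rewrite normrN normrM.
apply: (@le_lt_trans _ _ (`|h^-1| * (C * h ^+ 2))); first by rewrite ler_wpM2l.
have -> : `|h^-1| * (C * h ^+ 2) = C * `|h|.
  have -> : h ^+ 2 = `|h| ^+ 2 by rewrite real_normK ?num_real.
  by rewrite normfV; field; rewrite normr_eq0.
apply: (@le_lt_trans _ _ ((C + 1) * `|h|)).
  by rewrite ler_wpM2r// lerDl.
rewrite mulrC -ltr_pdivlMr; last by lra.
near: h; apply: dnbhs0_lt; rewrite divr_gt0//; lra.
Unshelve. all: by end_near. Qed.

Definition pospart (y : R) := Num.max y 0.

Lemma cont_pospart : continuous pospart.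
Proof. by move=> x; apply: (@continuous_max R R idfun (cst 0)); [exact: cvg_id|exact: cvg_cst]. Qed.

Lemma pospart_sqr_deriv (c x : R) :
  derivable (fun y => pospart (y - c) ^+ 2) x 1 /\
  derive1 (fun y => pospart (y - c) ^+ 2) x = 2 * pospart (x - c).
Proof.
apply: (@is_derive_quadratic _ _ _ 1) => h; rewrite /pospart mul1r.
rewrite ler_norml; have [H1|H1] := lerP (h + x - c) 0;
  have [H2|H2] := lerP (x - c) 0; apply/andP; split; nra.
Qed.

(* A C^1 step from 0 to 1 on [c, c + 2 d]; its derivative [hat d c] is the
   piecewise affine bump of mass 1 supported there. *)
Definition step (d c : R) : R -> R := fun x =>
  (2 * d ^+ 2)^-1 * (pospart (x - c) ^+ 2 +
     ((-2) * pospart (x - (c + d)) ^+ 2 + pospart (x - (c + 2 * d)) ^+ 2)).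

Definition hat (d c : R) : R -> R := fun x =>
  (d ^+ 2)^-1 * (pospart (x - c) +
     ((-2) * pospart (x - (c + d)) + pospart (x - (c + 2 * d)))).

Lemma step_deriv d c x : 0 < d -> derivable (step d c) x 1 /\
  derive1 (step d c) x = hat d c x.
Proof.
move=> d0.
have [D1 E1] := pospart_sqr_deriv c x.
have [D2 E2] := pospart_sqr_deriv (c + d) x.
have [D3 E3] := pospart_sqr_deriv (c + 2 * d) x.
rewrite !derive1E in E1 E2 E3.
pose I1 := DeriveDef D1 E1; pose I2 := DeriveDef D2 E2; pose I3 := DeriveDef D3 E3.
have I : is_derive x 1 (step d c) ((2 * d ^+ 2)^-1 *: (2 * pospart (x - c) +
  ((-2) *: (2 * pospart (x - (c + d))) + (2 * pospart (x - (c + 2 * d)))))).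
  exact: (is_deriveZ (2 * d ^+ 2)^-1 (is_deriveD I1 (is_deriveD (is_deriveZ (-2) I2) I3))).
split; first exact: ex_derive.
rewrite derive1E derive_val /hat /GRing.scale/=; field; lra.
Qed.

Lemma cont_hat d c : continuous (hat d c).
Proof.
have H k : continuous (fun x => pospart (x - k)).
  move=> x; apply: (@continuous_comp _ _ _ (fun x => x - k) pospart).
    by apply: cvgB; [exact: cvg_id|exact: cvg_cst].
  exact: cont_pospart.
move=> x; apply: cvgM; first exact: cvg_cst.
apply: cvgD; first exact: H.
apply: cvgD; last exact: H.
apply: cvgM; [exact: cvg_cst|exact: H].
Qed.

Lemma hat_bounds d c x : 0 < d -> 0 <= hat d c x <= d^-1.
Proof.
move=> d0; have d20 : 0 < d ^+ 2 by rewrite exprn_gt0.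
have di : 0 <= (d ^+ 2)^-1 by rewrite invr_ge0 ltW.
rewrite /hat mulr_ge0//=; last first.
  rewrite /pospart; have [H1|H1] := lerP (x - c) 0;
  have [H2|H2] := lerP (x - (c + d)) 0; have [H3|H3] := lerP (x - (c + 2 * d)) 0; lra.
rewrite mulrC ler_pdivrMr//.
have -> : d^-1 * d ^+ 2 = d by field; lra.
rewrite /pospart; have [H1|H1] := lerP (x - c) 0;
  have [H2|H2] := lerP (x - (c + d)) 0; have [H3|H3] := lerP (x - (c + 2 * d)) 0; lra.
Qed.

Lemma hat_supp d c x : 0 < d -> ~ (c <= x <= c + 2 * d) -> hat d c x = 0.
Proof.
move=> d0 /negP; rewrite negb_and -!ltNge => H.
rewrite /hat; apply/eqP; rewrite mulf_eq0; apply/orP; right; apply/eqP.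
move: H; rewrite /pospart; have [H1|H1] := lerP (x - c) 0;
  have [H2|H2] := lerP (x - (c + d)) 0; have [H3|H3] := lerP (x - (c + 2 * d)) 0;
  move=> /orP[]; lra.
Qed.

Lemma step_left d c x : 0 < d -> x <= c -> step d c x = 0.
Proof.
move=> d0 xc; rewrite /step /pospart.
have [H1|H1] := lerP (x - c) 0; have [H2|H2] := lerP (x - (c + d)) 0;
have [H3|H3] := lerP (x - (c + 2 * d)) 0; lra.
Qed.

Lemma step_right d c x : 0 < d -> c + 2 * d <= x -> step d c x = 1.
Proof.
move=> d0 xc; rewrite /step /pospart.
have [H1|H1] := lerP (x - c) 0; have [H2|H2] := lerP (x - (c + d)) 0;
have [H3|H3] := lerP (x - (c + 2 * d)) 0; try lra.
- have -> : x = c + 2 * d by lra.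
  by field; lra.
- by field; lra.
Qed.

Lemma prim_step d c : 0 < d -> prim (step d c) (hat d c).
Proof.
move=> d0; have E : derive1 (step d c) = hat d c.
  by apply/funext => x; case: (step_deriv c x d0).
rewrite -E; apply: prim_C1; first by move=> x; case: (step_deriv c x d0).
by rewrite E; exact: cont_hat.
Qed.

(** The derivative [hat] is nonnegative, so [step] is monotone between its end values. *)
Lemma step_bounds d c x : 0 < d -> 0 <= step d c x <= 1.
Proof.
move=> d0; have [_ H] := prim_step c d0.
have up y z : y <= z -> step d c y <= step d c z.
  by move=> yz; rewrite -subr_ge0 H//; apply: Rintegral_ge0 => t _; case/andP: (hat_bounds c t d0).
have [xc|cx] := lerP x c; first by rewrite (step_left d0 xc) lexx ler01.
have [xc'|cx'] := lerP (c + 2 * d) x; first by rewrite (step_right d0 xc') lexx ler01.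
have := up _ _ (ltW cx); have := up _ _ (ltW cx').
by rewrite (step_left d0 (lexx c)) (step_right d0 (lexx (c + 2 * d))) => -> ->.
Qed.

Lemma Rint_supp f (a b : R) : (forall x, ~ (a <= x <= b) -> f x = 0) ->
  \int[mu]_x f x = \int[mu]_(x in `[a, b]) f x.
Proof.
move=> H; rewrite [RHS]Rintegral_mkcond; apply: eq_Rintegral => x _.
rewrite patchE; case: ifPn => // /negP xab; apply: H => xab'; apply: xab.
by rewrite inE/= in_itv.
Qed.

Lemma prim_exists g : locint g -> exists G, prim G g.
Proof.
move=> lg; exists (fun x => if 0 <= x then \int[mu]_(t in `[0, x]) g t
                    else - \int[mu]_(t in `[x, 0]) g t).
split => // a b ab; case: (lerP 0 a) => a0; case: (lerP 0 b) => b0.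
- by rewrite (Rint_split a0 ab (lg.2 _ _)); ring.
- lra.
- by rewrite (Rint_split (ltW a0) b0 (lg.2 _ _)); ring.
- by rewrite (Rint_split ab (ltW b0) (lg.2 a 0)); ring.
Qed.

Lemma Rint_small g a : locint g -> forall e, 0 < e ->
  exists2 d, 0 < d & forall r, 0 < r -> r < d -> \int[mu]_(x in `[a, a + r]) `|g x| < e.
Proof.
move=> [mg ig] e e0.
have lg : locint (fun x => `|g x|).
  by split; [exact: measurableT_comp|move=> *; exact: intg_norm].
have [G pG] := prim_exists lg; have cG := prim_cont pG; case: pG => _ HG.
have /cvgrPdist_lt/(_ _ e0)[d /= d0 H] := cG a.
exists d => // r r0 rd; rewrite -HG; last by lra.
rewrite (le_lt_trans (ler_norm _))// distrC; apply: H => /=.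
by rewrite opprD addrA subrr add0r normrN gtr0_norm.
Qed.

Lemma locint_norm f : locint f -> locint (fun x => `|f x|).
Proof. by move=> [mf fi]; split; [exact: measurableT_comp|move=> *; exact: intg_norm]. Qed.

Lemma locintB f g : locint f -> locint g -> locint (fun x => f x - g x).
Proof.
move=> lf lg; have := locintD lf (locintZ (-1) lg).
by under eq_fun do rewrite mulN1r.
Qed.

Lemma locint_cst (k : R) : locint (fun=> k).
Proof. by apply: locint_cont => x; exact: cvg_cst. Qed.

(* The hat at [a] averages over one side of a ball, so it is dominated by
   [davg f a (3 d)] and tends to [f a] at every Lebesgue point. *)
Lemma hat_lebesgue_pt f a : locint f -> lebesgue_pt f a ->
  forall e, 0 < e -> exists2 d0, 0 < d0 & forall d, 0 < d -> d < d0 ->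
  `|\int[mu]_x (f x * hat d a x) - f a| < e.
Proof.
move=> lf /fine_cvgP[fin /cvgrPdist_lt cv] e e0.
(* The hat is at most [1 / d] and the ball of radius [3 d] has measure [6 d], so the error is at
   most 6 times the average deviation, that is less than [e / 2]. *)
have e10 : 0 < e / 12 by lra.
have {cv} := cv _ e10.
rewrite /at_right/= !near_withinE in fin * => cv.
have [r1 /= r10 H1] : nbhs (0:R) [set x | 0 < x -> davg f a x \is a fin_num] by exact: fin.
have [r2 /= r20 H2] := cv.
exists (Num.min r1 r2 / 3); first by rewrite divr_gt0// lt_min r10.
move=> d d0; rewrite ltr_pdivlMr// lt_min => /andP[dr1 dr2].
have d3 : 0 < 3 * d by lra.
have b1 : `|0 - 3 * d| < r1 by rewrite sub0r normrN gtr0_norm// mulrC.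
have b2 : `|0 - 3 * d| < r2 by rewrite sub0r normrN gtr0_norm// mulrC.
have {H1} F1 := H1 _ b1 d3; have {H2} := H2 _ b2 d3.
rewrite /= sub0r normrN => D.
have lc : locint (fun x => f x - f a) by apply: locintB => //; exact: locint_cst.
have lh : locint (fun x => (f x - f a) * hat d a x).
  by under eq_fun do rewrite mulrC; apply: locintM => //; exact: cont_hat.
have lfh : locint (fun x => f x * hat d a x).
  by under eq_fun do rewrite mulrC; apply: locintM => //; exact: cont_hat.
have ad : a <= a + 2 * d by lra.
have sub : `[a, a + 2 * d]%classic `<=` ball a (3 * d).
  move=> x; rewrite /= in_itv/= => /andP[ax xa]; rewrite /ball/= ltr_norml.
  by apply/andP; split; lra.
have mb : measurable (ball a (3 * d) : set mR) by exact: measurable_ball.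
have ib : intg (ball a (3 * d) : set mR) (fun x => `|f x - f a|).
  apply: (@integrableS _ _ _ mu (`[a - 3 * d, a + 3 * d]%classic : set mR)) => //.
    by rewrite ball_itv; apply: subset_itv; rewrite bnd_simp.
  by apply: intg_norm; exact: lc.2.
have davgE : fine (davg f a (3 * d)) =
   (6 * d)^-1 * \int[mu]_(x in ball a (3 * d)) `|f x - f a|.
  rewrite /davg /iavg lebesgue_measure_ball; last exact: ltW.
  rewrite inver mulrn_eq0/= gt_eqF// fineM//; last by apply: integrable_fin_num.
  rewrite /= /Rintegral; congr (_^-1 * fine _); first by rewrite -mulr_natl; ring.
have I1 : \int[mu]_x (f x * hat d a x) = \int[mu]_(x in `[a, a + 2 * d]) (f x * hat d a x).
  by apply: Rint_supp => x xn; rewrite (hat_supp d0 xn) mulr0.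
have I2 : f a = \int[mu]_(x in `[a, a + 2 * d]) (f a * hat d a x).
  rewrite RintegralZl//; last by apply: intg_cont; exact: cont_hat.
  by rewrite -(prim_step a d0).2// step_right// step_left// subr0 mulr1.
rewrite I1 [X in `|_ - X|]I2 -RintegralB//; last 2 first.
- exact: lfh.2.
- by apply: intg_scale => //; apply: intg_cont; exact: cont_hat.
under eq_Rintegral do rewrite -mulrBl.
apply: (le_lt_trans (le_normr_Rintegral _ (lh.2 _ _))) => //.
apply: (@le_lt_trans _ _ (\int[mu]_(x in `[a, a + 2 * d]) (d^-1 * `|f x - f a|))).
  apply: le_Rintegral => //.
  - by apply: intg_norm; exact: lh.2.
  - by apply: intg_scale => //; apply: intg_norm; exact: lc.2.
  move=> x _; rewrite normrM mulrC ler_wpM2r//.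
  by have /andP[h0 h1] := hat_bounds a x d0; rewrite ger0_norm.
rewrite RintegralZl//; last by apply: intg_norm; exact: lc.2.
apply: (@le_lt_trans _ _ (d^-1 * \int[mu]_(x in ball a (3 * d)) `|f x - f a|)).
  rewrite ler_wpM2l// ?invr_ge0 ?(ltW d0)//.
  rewrite -lee_fin; apply: fine_le.
  - by apply: integrable_fin_num => //; apply: intg_norm; exact: lc.2.
  - by apply: integrable_fin_num.
  apply: ge0_subset_integral => //; apply/measurable_EFinP; apply: measT.
  by case: (locint_norm lc).
have -> : d^-1 * \int[mu]_(x in ball a (3 * d)) `|f x - f a| = 6 * fine (davg f a (3 * d)).
  by rewrite davgE; field; lra.
have := D; rewrite ltr_norml => /andP[_]; lra.
Qed.

(** The test [step d a - step d b] approximates the indicator of [[a, b]], and its derivative is a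
    bump at [a] minus a bump at [b]. The weak identity thus compares averages of [f] near the two
    ends, which converge at Lebesgue points, with an integral of [g]. *)
Lemma dubois_reymond f g a b : weak_derivative f g -> lebesgue_pt f a ->
  lebesgue_pt f b -> a < b -> f b - f a = \int[mu]_(x in `[a, b]) g x.
Proof.
move=> [/locint_locally lf /locint_locally lg W] La Lb ab.
have lng := locint_norm lg.
apply/eqP; rewrite -subr_eq0 -normr_le0; apply/ler_addgt0Pr => e e0; rewrite add0r.
have e4 : 0 < e / 4 by lra.
have [d1 d10 H1] := hat_lebesgue_pt lf La e4.
have [d2 d20 H2] := hat_lebesgue_pt lf Lb e4.
have [d3 d30 H3] := Rint_small a lg e4.
have [d4 d40 H4] := Rint_small b lg e4.
(* The division by 4 gives [a + 2 d <= b], so the two transition zones do not overlap, and makes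
   each of the four errors less than [e / 4]. *)
pose d := Num.min (Num.min d1 d2) (Num.min (Num.min d3 d4) (b - a)) / 4.
have m0 : 0 < Num.min (Num.min d1 d2) (Num.min (Num.min d3 d4) (b - a)).
  by rewrite !lt_min d10 d20 d30 d40 subr_gt0.
have d0 : 0 < d by rewrite divr_gt0.
have : 4 * d <= Num.min (Num.min d1 d2) (Num.min (Num.min d3 d4) (b - a)).
  by rewrite /d mulrC divfK.
rewrite !le_min => /andP[/andP[L1 L2] /andP[/andP[L3 L4] L5]].
clearbody d; clear m0.
have [dd1 dd2 dd3 dd4] : [/\ d < d1, d < d2, 2 * d < d3 & 2 * d < d4].
  by clear -d0 L1 L2 L3 L4; split; lra.
have [ad a2b abd bd] : [/\ a <= a + 2 * d, a + 2 * d <= b, a <= b + 2 * d & b <= b + 2 * d].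
  by clear -d0 L5; split; lra.
have d20' : 0 < 2 * d by rewrite mulr_gt0.
have {}H1 := H1 d d0 dd1; have {}H2 := H2 d d0 dd2.
have {}H3 := H3 (2 * d) d20' dd3; have {}H4 := H4 (2 * d) d20' dd4.
have ab' := ltW ab.
pose phi x := step d a x - step d b x.
have phiD x : derivable phi x 1 /\ derive1 phi x = hat d a x - hat d b x.
  have [D1 E1] := step_deriv a x d0; have [D2 E2] := step_deriv b x d0.
  split; first exact: derivableB.
  by rewrite derive1E (deriveB D1 D2) -!derive1E E1 E2.
have phi' : derive1 phi = (fun x => hat d a x - hat d b x).
  by apply/funext => x; case: (phiD x).
have cphi : continuous phi by apply: derivable_cont => x; case: (phiD x).
have supp x : ~ (a <= x <= b + 2 * d) -> phi x = 0.
  move=> /negP; rewrite negb_and -!ltNge => /orP[] H.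
    by rewrite /phi !step_left ?subrr// ltW// (lt_trans H).
  rewrite /phi !step_right ?subrr ?(ltW H)//.
  by apply: le_trans (ltW H); rewrite lerD2r.
have T : test_function phi.
  split; first by move=> x; case: (phiD x).
    rewrite phi' => x; apply: cvgB; exact: cont_hat.
  exists (`|a| + `|b| + 2 * d) => x xM; apply: supp => /andP[ax xb].
  have : `|x| <= `|a| + `|b| + 2 * d.
    have n1 := ler_norm b; have := ler_norm (- a); rewrite normrN => n2.
    have n3 := normr_ge0 a; have n4 := normr_ge0 b; clear -d0 ax xb n1 n2 n3 n4.
    by rewrite ler_norml; apply/andP; split; lra.
  by rewrite leNgt xM.
have := W _ T; rewrite phi'.
have lfh c : locint (fun x => f x * hat d c x).
  by under eq_fun do rewrite mulrC; apply: locintM => //; exact: cont_hat.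
have sh c x : a <= c <= b -> ~ (a <= x <= b + 2 * d) -> hat d c x = 0.
  move=> /andP[ac cb] H; apply: hat_supp => // /andP[cx xc]; apply: H.
  by rewrite (le_trans ac cx) (le_trans xc)// lerD2r.
have EL : \int[mu]_x (f x * (hat d a x - hat d b x)) =
   \int[mu]_x (f x * hat d a x) - \int[mu]_x (f x * hat d b x).
  rewrite !(@Rint_supp _ a (b + 2 * d)).
  - rewrite -RintegralB//; [|exact: (lfh a).2|exact: (lfh b).2].
    by apply: eq_Rintegral => x _; rewrite mulrBr.
  - by move=> x /sh ->; rewrite ?mulr0 ?ab' ?lexx.
  - by move=> x /sh ->; rewrite ?mulr0 ?ab' ?lexx.
  - by move=> x H; rewrite !sh ?subrr ?mulr0 ?ab' ?lexx.
have lgp : locint (fun x => g x * phi x).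
  by under eq_fun do rewrite mulrC; apply: locintM.
have lgp1 : locint (fun x => g x * phi x - g x) by exact: locintB.
rewrite EL (@Rint_supp (fun x => g x * phi x) a (b + 2 * d)); last by move=> x /supp ->; rewrite mulr0.
have spl k : locint k -> \int[mu]_(x in `[a, b + 2 * d]) k x =
  \int[mu]_(x in `[a, a + 2 * d]) k x + \int[mu]_(x in `[a + 2 * d, b]) k x +
  \int[mu]_(x in `[b, b + 2 * d]) k x.
  move=> lk; rewrite (@Rint_split _ k a b (b + 2 * d)); [|by []|by []|exact: lk.2].
  by rewrite (@Rint_split _ k a (a + 2 * d) b); [|by []|by []|exact: lk.2].
have Z : \int[mu]_(x in `[a, b]) g x = \int[mu]_(x in `[a, a + 2 * d]) g x +
  \int[mu]_(x in `[a + 2 * d, b]) g x.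
  by rewrite -Rint_split//; exact: lg.2.
rewrite spl// => E.
have M : \int[mu]_(x in `[a + 2 * d, b]) (g x * phi x) = \int[mu]_(x in `[a + 2 * d, b]) g x.
  apply: eq_Rintegral => x; rewrite inE/= in_itv/= => /andP[ax xb].
  by rewrite /phi step_right// step_left// subr0 mulr1.
have pb x : 0 <= phi x <= 1.
  rewrite /phi; have [xb|bx] := lerP x b.
    by rewrite (step_left d0 xb) subr0; exact: step_bounds.
  rewrite (@step_right d a x)//; last by clear -L5 bx d0; lra.
  have /andP[s0 s1] := step_bounds b x d0; clear -s0 s1.
  by apply/andP; split; lra.
have B c e' : c <= e' -> `|\int[mu]_(x in `[c, e']) (g x * phi x - g x)| <=
     \int[mu]_(x in `[c, e']) `|g x|.
  move=> ce; apply: (le_trans (le_normr_Rintegral _ (lgp1.2 _ _))) => //.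
  apply: le_Rintegral => //; [by apply: intg_norm; exact: lgp1.2|exact: lng.2|].
  move=> x _; rewrite -{2}[g x]mulr1 -mulrBr normrM ler_piMr//.
  by have /andP[s0 s1] := pb x; clear -s0 s1; rewrite ler_norml; apply/andP; split; lra.
have B2 c e' : c <= e' -> `|\int[mu]_(x in `[c, e']) (g x * phi x)| <=
     \int[mu]_(x in `[c, e']) `|g x|.
  move=> ce; apply: (le_trans (le_normr_Rintegral _ (lgp.2 _ _))) => //.
  apply: le_Rintegral => //; [by apply: intg_norm; exact: lgp.2|exact: lng.2|].
  move=> x _; rewrite normrM ler_piMr//.
  by have /andP[s0 s1] := pb x; clear -s0 s1; rewrite ler_norml; apply/andP; split; lra.
have := B _ _ ad; have := B2 _ _ bd.
rewrite RintegralB//; [|exact: lgp.2|exact: lg.2].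
move: E H1 H2 H3 H4; rewrite M Z !ltr_norml !ler_norml.
move: (\int[mu]_x (f x * hat d a x)) (\int[mu]_x (f x * hat d b x)).
move: (\int[mu]_(x in `[a, a + 2 * d]) (g x * phi x)) (\int[mu]_(x in `[b, b + 2 * d]) (g x * phi x)).
move: (\int[mu]_(x in `[a, a + 2 * d]) g x) (\int[mu]_(x in `[a + 2 * d, b]) g x).
move: (\int[mu]_(x in `[a, a + 2 * d]) `|g x|) (\int[mu]_(x in `[b, b + 2 * d]) `|g x|).
move: (f a) (f b); clear -d0 => fa fb I1 I2 I3 I4 I5 I6 I7 I8.
by move=> ? /andP[? ?] /andP[? ?] ? ? /andP[? ?] /andP[? ?]; apply/andP; split; lra.
Qed.

Lemma lebesgue_pt_cont f x : continuous f -> lebesgue_pt f x.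
Proof.
move=> cf; apply: (@continuous_lebesgue_pt _ _ _ setT) => //.
- by split => //; exact: openT.
- exact: meas_cont.
- exact: cf.
Qed.

Lemma ae_exists (P : R -> Prop) : {ae mu, forall x, P x} -> exists x, P x.
Proof.
move=> [N [mN N0 PN]]; apply: contrapT => H.
have NT : N = setT.
  by apply/seteqP; split => // x _; apply: PN => /= Px; apply: H; exists x.
by have := @lebesgue_measure_itv R `]-oo, +oo[; rewrite set_itvNyy/= -NT N0.
Qed.

(** Anchored at one Lebesgue point of [f], the primitive of [g] agrees with [f] at all the others,
    and almost every point is one. *)
Lemma weak_prim f g : weak_derivative f g ->
  exists F, prim F g /\ {ae mu, forall x, f x = F x}.
Proof.
move=> W; case: (W) => lf /locint_locally lg _.
have Leb := lebesgue_differentiation lf.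
have [x0 L0] := ae_exists Leb.
have [G pG] := prim_exists lg.
exists (fun x => f x0 + (G x - G x0)); split.
  split => // a b ab; rewrite -pG.2//; ring.
apply: ae_impl Leb => x Lx.
have [xx0|xx0|->] := ltgtP x x0.
- have := dubois_reymond W Lx L0 xx0; rewrite -pG.2//; last exact: ltW.
  by move=> E; apply: (@addrI _ (- f x + G x0 - G x)); move: E; lra.
- by have := dubois_reymond W L0 Lx xx0; rewrite -pG.2//; [lra|exact: ltW].
- by rewrite subrr addr0.
Qed.

Lemma Rint0_ae0 g : locint g ->
  (forall a b, a <= b -> \int[mu]_(x in `[a, b]) g x = 0) ->
  {ae mu, forall x, g x = 0}.
Proof.
move=> lg H; have /locint_locally/lebesgue_differentiation := lg.
apply: ae_impl => x Lx.
have := @FTC1_lebesgue_pt R g (BLeft (x - 1)) x (x + 1) ltac:(lra) (lg.2 _ _).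
move=> /(_ _ Lx) /= [|_ <-]; first by rewrite lte_fin; lra.
suff -> : (fun y => \int[mu]_(t in `[(x - 1), y]) g t) = cst 0 by rewrite derive1_cst.
apply/funext => y; have [h|h] := lerP (x - 1) y; first exact: H.
by rewrite set_itv_ge ?Rintegral_set0// bnd_simp -ltNge.
Qed.

Lemma cont_ae_eq f g : continuous f -> continuous g ->
  {ae mu, forall x, f x = g x} -> forall x, f x = g x.
Proof.
move=> cf cg fg.
suff : forall x, f x - g x = 0 by move=> H x; apply/eqP; rewrite -subr_eq0 H.
have lfg := locintB (locint_cont cf) (locint_cont cg).
have I a b : \int[mu]_(x in `[a, b]) (f x - g x) = 0.
  rewrite (@Rint_ae_eq _ _ _ (cst 0))//.
  - by rewrite /Rintegral/= integral0.
  - by apply: measT; case: lfg.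
  - by apply: ae_impl fg => x -> _; rewrite subrr.
move=> x.
have := @FTC1_lebesgue_pt R (fun x => f x - g x) (BLeft (x - 1)) x (x + 1) ltac:(lra) (lfg.2 _ _).
move=> /(_ _) /= [| |_ <-]; first by rewrite lte_fin; lra.
  by apply: lebesgue_pt_cont => y; apply: cvgB; [exact: cf|exact: cg].
suff -> : (fun y => \int[mu]_(t in `[(x - 1), y]) (f t - g t)) = cst 0 by rewrite derive1_cst.
by apply/funext => y.
Qed.

Lemma prim_uniq f g g' : prim f g -> prim f g' -> {ae mu, forall x, g x = g' x}.
Proof.
move=> [lg H] [lg' H'].
have := @Rint0_ae0 (fun x => g x - g' x) (locintB lg lg').
move=> A; have := A _; move=> {A} A.
have : {ae mu, forall x, g x - g' x = 0}.
  apply: A => a b ab; rewrite RintegralB//; [|exact: lg.2|exact: lg'.2].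
  by rewrite -H// -H'// subrr.
by apply: ae_impl => x /eqP; rewrite subr_eq0 => /eqP.
Qed.

(** Integration by parts: the product rule applies to [f * phi], which vanishes at both ends of
    [[- M, M]]. *)
Lemma prim_weak f g : prim f g -> weak_derivative f g.
Proof.
move=> pf; have cf := prim_cont pf.
split; [by apply/locint_locally/locint_cont|by apply/locint_locally; case: pf|].
move=> phi [dphi cphi' [M0 HM0]].
(* Beyond a margin of 1, the ends [M] and [- M] lie where [phi] already vanishes. *)
pose M := `|M0| + 1.
have M1 : M0 < M by rewrite /M (le_lt_trans (ler_norm _))// ltrDl.
have M00 : 0 < M by rewrite ltr_wpDl.
have HM x : ~ (- M <= x <= M) -> phi x = 0.
  move=> H; apply: HM0; rewrite (lt_le_trans M1)// leNgt; apply/negP.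
  by move=> /ltW; rewrite ler_norml.
have HM' x : ~ (- M <= x <= M) -> derive1 phi x = 0.
  move=> H; have xM : M < `|x|.
    by rewrite ltNge; apply/negP; rewrite ler_norml.
  rewrite derive1E (near_eq_derive (g := cst 0)) ?derive_cst//.
  have : 0 < `|x| - M by rewrite subr_gt0.
  move=> e0; apply/nbhs_ballP; exists (`|x| - M) => //= y; rewrite /ball/= => xy.
  apply: HM => /andP[? ?].
  have : `|y| <= M by rewrite ler_norml; apply/andP.
  have : `|x| <= `|x - y| + `|y| by rewrite -{1}(subrK y x) ler_normD.
  by move: xy; lra.
have pphi := prim_C1 dphi cphi'.
have cphi := derivable_cont dphi.
have pp := primM pf pphi.
have l1 : locint (fun x => f x * derive1 phi x) by apply: locintM => //; exact: locint_cont.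
have l2 : locint (fun x => g x * phi x).
  by under eq_fun do rewrite mulrC; apply: locintM => //; case: pf.
rewrite (@Rint_supp _ (- M) M); last by move=> x /HM' ->; rewrite mulr0.
rewrite (@Rint_supp _ (- M) M); last by move=> x /HM ->; rewrite mulr0.
apply/eqP; rewrite -addr_eq0 addrC -RintegralD//; [|exact: l2.2|exact: l1.2].
rewrite -pp.2; last by lra.
have z x : M <= `|x| -> phi x = 0 by move=> ?; apply: HM0; lra.
by rewrite !z ?mulr0 ?subrr// ?normrN gtr0_norm.
Qed.

Lemma weak_ae f f' g g' : weak_derivative f g -> mble f' -> mble g' ->
  {ae mu, forall x, f x = f' x} -> {ae mu, forall x, g x = g' x} ->
  weak_derivative f' g'.
Proof.
move=> [/locint_locally lf /locint_locally lg W] mf' mg' ff gg.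
have lf' := locint_ae mf' ff lf; have lg' := locint_ae mg' gg lg.
split; [exact/locint_locally|exact/locint_locally|].
move=> phi Tphi; have := W phi Tphi; case: Tphi => dphi cphi _.
have mphi : mble phi by apply: meas_cont; exact: derivable_cont.
have mphi' : mble (derive1 phi) by exact: meas_cont.
have mm (k l : R -> R) : mble k -> mble l -> mble (fun x => k x * l x).
  by move=> ? ?; exact: measurable_funM.
rewrite (@Rint_ae_eq _ setT (fun x => f x * derive1 phi x) (fun x => f' x * derive1 phi x))//; last 3 first.
- by apply: mm => //; case: lf.
- exact: mm.
- by apply: ae_impl ff => x ->.
rewrite (@Rint_ae_eq _ setT (fun x => g x * phi x) (fun x => g' x * phi x))//.
- by apply: mm => //; case: lg.
- exact: mm.
- by apply: ae_impl gg => x ->.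
Qed.

Lemma weak_uniq f f' g g' : weak_derivative f g -> weak_derivative f' g' ->
  {ae mu, forall x, f x = f' x} -> {ae mu, forall x, g x = g' x}.
Proof.
move=> /weak_prim[F [pF fF]] /weak_prim[F' [pF' fF']] ff.
apply: (prim_uniq pF); apply: prim_eq (pF') _ => x; apply/esym; move: x.
apply: cont_ae_eq; [exact: prim_cont pF|exact: prim_cont pF'|].
by apply: ae_impl (ae_conj ff (ae_conj fF fF')) => x [E1 [<- <-]].
Qed.

Lemma wderivP f g : weak_derivative f g -> weak_derivative f (wderiv f).
Proof. by move=> W; apply: xgetPex; exists g. Qed.

(** [wderiv] picks an unspecified weak derivative. Uniqueness identifies it almost everywhere; its
    measurability comes from the local integrability built into [weak_derivative]. *)
Lemma wderiv_ae f F g : mble f -> {ae mu, forall x, f x = F x} -> prim F g ->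
  {ae mu, forall x, wderiv f x = g x} /\ mble (wderiv f).
Proof.
move=> mf fF pF; have W := prim_weak pF.
have mg : mble g by case: (pF) => -[].
have W' : weak_derivative f g.
  by apply: (weak_ae W) => //; [apply: ae_impl fF => x ->|exact: ae_forall].
split; first by apply: (weak_uniq (wderivP W') W).
by case: (wderivP W') => _ /locint_locally[].
Qed.
End WeakDerivatives.

(** * Square integrable functions *)

Section SquareIntegrable.
Variable R : realType.
Local Notation mu := (@lebesgue_measure R).
Local Notation mR := (measurableTypeR R).
Local Notation mble f := (@measurable_fun _ _ mR mR setT f).
Local Notation mbleon A f := (@measurable_fun _ _ mR mR A f).
Local Notation intg A f := (mu.-integrable A (EFin \o f)).
Implicit Types (f g : R -> R) (A : set mR).

Lemma mbleD f g : mble f -> mble g -> mble (fun x => f x + g x).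
Proof. by move=> mf mg; exact: measurable_funD. Qed.
Lemma mbleB f g : mble f -> mble g -> mble (fun x => f x - g x).
Proof. by move=> mf mg; exact: measurable_funB. Qed.
Lemma mbleM f g : mble f -> mble g -> mble (fun x => f x * g x).
Proof. by move=> mf mg; exact: measurable_funM. Qed.
Lemma mbleX f n : mble f -> mble (fun x => f x ^+ n).
Proof. by move=> mf; exact: measurable_funX. Qed.
Lemma mbleZ f (k : R) : mble f -> mble (fun x => k * f x).
Proof. by move=> mf; exact: measurable_funM. Qed.
Lemma mbleN f : mble f -> mble (fun x => `|f x|).
Proof. by move=> mf; exact: measurableT_comp. Qed.

Lemma sqrD_le (a b : R) : (a + b) ^+ 2 <= 2 * a ^+ 2 + 2 * b ^+ 2.
Proof.
rewrite -subr_ge0; have -> : 2 * a ^+ 2 + 2 * b ^+ 2 - (a + b) ^+ 2 = (a - b) ^+ 2 by ring.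
exact: sqr_ge0.
Qed.

Lemma norm_mul2_le (a b : R) : `|a * b + b * a| <= a ^+ 2 + b ^+ 2.
Proof.
have := sqr_ge0 (a - b); have := sqr_ge0 (a + b); rewrite ler_norml => ? ?.
by apply/andP; split; lra.
Qed.

Lemma measurable_tail (r : R) : measurable ([set x : R | r < `|x|] : set mR).
Proof.
have -> : ([set x : R | r < `|x|] : set mR) = (fun x : R => `|x|) @^-1` `]r, +oo[%classic.
  by apply/seteqP; split => x /=; rewrite in_itv/= andbT.
rewrite -[X in measurable X]setTI.
by apply: (@normr_measurable R setT) => //.
Qed.

Definition L2 f := mble f /\ intg setT (fun x => f x ^+ 2).
Definition n2 f := \int[mu]_x (f x ^+ 2).

Lemma n2_ge0 f : 0 <= n2 f.
Proof. by apply: Rintegral_ge0 => x _; exact: sqr_ge0. Qed.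

Lemma intgT A f : measurable A -> intg setT f -> intg A f.
Proof. by move=> mA; exact: integrableS. Qed.

Lemma L2_dom f g (K : R) : mble f -> (forall x, f x ^+ 2 <= K * g x ^+ 2) ->
  L2 g -> L2 f /\ n2 f <= K * n2 g.
Proof.
move=> mf fg [mg ig].
have iK : intg setT (fun x => K * g x ^+ 2) by exact: intg_scale.
have i2 : intg setT (fun x => f x ^+ 2).
  apply: (intg_dom _ _ _ iK) => //; first exact: mbleX.
  by move=> x _; rewrite ger0_norm ?sqr_ge0.
by split => //; rewrite /n2 -RintegralZl//; apply: le_Rintegral.
Qed.

Lemma L2D f g : L2 f -> L2 g -> L2 (fun x => f x + g x).
Proof.
move=> [mf i_f] [mg ig]; have mfg := mbleD mf mg; split => //.
apply: (@intg_dom _ _ _ (fun x => 2 * f x ^+ 2 + 2 * g x ^+ 2)) => //.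
- exact: mbleX.
- by move=> x _; rewrite ger0_norm ?sqr_ge0//; exact: sqrD_le.
- by apply: intg_add => //; apply: intg_scale.
Qed.

Lemma n2D f g : L2 f -> L2 g -> n2 (fun x => f x + g x) <= 2 * n2 f + 2 * n2 g.
Proof.
move=> Lf Lg; have [_ i_s] := L2D Lf Lg; case: Lf Lg => mf i_f [mg ig].
rewrite /n2 -!RintegralZl// -RintegralD//; try exact: intg_scale.
apply: le_Rintegral => //; first by apply: intg_add => //; apply: intg_scale.
by move=> x _; exact: sqrD_le.
Qed.

Lemma L2Z f (k : R) : L2 f -> L2 (fun x => k * f x).
Proof.
move=> Lf; case: (Lf) => mf _.
have [] // := @L2_dom (fun x => k * f x) f (k ^+ 2) (mbleZ k mf) _ Lf.
by move=> x; rewrite exprMn.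
Qed.

Lemma L2N f : L2 f -> L2 (fun x => - f x).
Proof. by move=> /(L2Z (-1)); under eq_fun do rewrite mulN1r. Qed.

Lemma L2B f g : L2 f -> L2 g -> L2 (fun x => f x - g x).
Proof. by move=> Lf /L2N; exact: L2D. Qed.

Lemma L2_bounded f g (M : R) : mble f -> (forall x, `|f x| <= M) -> L2 g ->
  L2 (fun x => f x * g x) /\ n2 (fun x => f x * g x) <= M ^+ 2 * n2 g.
Proof.
move=> mf fM Lg; have [mg _] := Lg.
apply: L2_dom => //; first exact: mbleM.
move=> x; rewrite exprMn ler_wpM2r ?sqr_ge0// -[f x ^+ 2]real_normK ?num_real//.
by rewrite lerXn2r ?nnegrE// (le_trans (normr_ge0 _) (fM x)).
Qed.

Lemma L2_mul f g : L2 f -> L2 g -> intg setT (fun x => f x * g x).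
Proof.
move=> [mf i_f] [mg ig].
apply: (@intg_dom _ _ _ (fun x => f x ^+ 2 + g x ^+ 2)) => //.
- exact: mbleM.
- by move=> x _; rewrite ler_norml; apply/andP; split; nra.
- exact: intg_add.
Qed.

Lemma intg_bounded f g (M : R) : mble f -> (forall x, `|f x| <= M) ->
  mble g -> intg setT g -> intg setT (fun x => f x * g x).
Proof.
move=> mf fM mg ig; apply: (@intg_dom _ _ _ (fun x => M * `|g x|)) => //.
- exact: mbleM.
- by move=> x _; rewrite normrM ler_wpM2r.
- by apply: intg_scale => //; exact: intg_norm.
Qed.

Lemma L2_ae f g : L2 f -> mble g -> {ae mu, forall x, f x = g x} ->
  L2 g /\ n2 f = n2 g.
Proof.
move=> [mf i_f] mg fg.
have fg2 : {ae mu, forall x, setT x -> f x ^+ 2 = g x ^+ 2}.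
  by apply: ae_impl fg => x ->.
split; last by apply: Rint_ae_eq => //; exact: mbleX.
by split => //; apply: intg_ae_eq i_f => //; exact: mbleX.
Qed.

(** Young's inequality gives [2 X <= e a + b / e] for every [e > 0], where [a] and [b] are the two
    squared norms. The choice [e = X / a] yields the bound; when [a = 0], [e = b / X] or [e = 1]
    forces [X = 0]. *)
Lemma cauchy_schwarz f g : L2 f -> L2 g ->
  \int[mu]_x `|f x * g x| <= Num.sqrt (n2 f) * Num.sqrt (n2 g).
Proof.
move=> Lf Lg; have ifg := intg_norm (L2_mul Lf Lg).
case: Lf Lg => mf i_f [mg ig].
set X := \int[mu]_x _.
have X0 : 0 <= X by apply: Rintegral_ge0.
have key e : 0 < e -> 2 * X <= e * n2 f + e^-1 * n2 g.
  move=> e0; rewrite /n2 /X -!RintegralZl// -RintegralD//; try exact: intg_scale.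
  apply: le_Rintegral => //; first exact: intg_scale.
    by apply: intg_add => //; apply: intg_scale.
  move=> x _; rewrite normrM.
  rewrite -[f x ^+ 2]real_normK ?num_real// -[g x ^+ 2]real_normK ?num_real//.
  have -> : e * `|f x| ^+ 2 + e^-1 * `|g x| ^+ 2 =
    2 * (`|f x| * `|g x|) + e^-1 * (e * `|f x| - `|g x|) ^+ 2 by field; lra.
  by rewrite lerDl mulr_ge0 ?sqr_ge0// invr_ge0 ltW.
have a0 := n2_ge0 f; have b0 := n2_ge0 g.
move: (n2 f) (n2 g) a0 b0 key => a b a0 b0 key {ifg}.
rewrite -sqrtrM// -[X](@ger0_norm R)// -sqrtr_sqr; apply: ler_wsqrtr.
have [X00|Xp] := leP X 0.
  have -> : X = 0 by apply/eqP; rewrite eq_le X00.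
  by rewrite expr0n/= mulr_ge0.
have [ap|a00] := ltP 0 a.
  have := key (X / a) ltac:(by rewrite divr_gt0).
  rewrite divfK ?gt_eqF// invf_div => H.
  have : X * X <= X * (a / X * b) by rewrite ler_wpM2l//; lra.
  by have -> : X * (a / X * b) = a * b by field; lra.
have a_0 : a = 0 by apply/eqP; rewrite eq_le a00.
have [bp|b00] := ltP 0 b.
  have := key (b / X) ltac:(by rewrite divr_gt0).
  by rewrite a_0 mulr0 add0r invf_div divfK ?gt_eqF//; lra.
have b_0 : b = 0 by apply/eqP; rewrite eq_le b00.
by have := key 1 ltac:(lra); rewrite a_0 b_0 !mulr0; lra.
Qed.

(** Sobolev embedding of H^1: the variation of [f ^+ 2] is at most the integral of [2 |f g|], hence
    [n2 f + n2 g], and [f ^+ 2] is averaged over [[x, x + 1]]. *)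
Lemma prim_sup f g x : prim f g -> L2 f -> L2 g ->
  f x ^+ 2 <= 2 * (n2 f + n2 g).
Proof.
move=> pf Lf Lg; have cf := prim_cont pf.
have pff := primM pf pf.
have ifg := intg_norm (L2_mul Lf Lg).
case: (Lf) (Lg) => mf i_f [mg ig].
have xx1 : x <= x + 1 by lra.
have I1 : intg `[x, x + 1] (fun y => f y ^+ 2) by apply: intgT.
have step y : x <= y -> f x ^+ 2 <= f y ^+ 2 + (n2 f + n2 g).
  move=> xy; have := pff.2 x y xy => E.
  have : `|f y * f y - f x * f x| <= n2 f + n2 g.
    rewrite E; apply: (le_trans (le_normr_Rintegral _ _)) => //; first exact: pff.1.2.
    rewrite /n2 -RintegralD//.
    apply: (@le_trans _ _ (\int[mu]_(t in `[x, y]) (f t ^+ 2 + g t ^+ 2))).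
      apply: le_Rintegral => //.
      - by apply: intg_norm; exact: pff.1.2.
      - by apply: intgT => //; exact: intg_add.
      by move=> t _; rewrite [leRHS]addrC; exact: norm_mul2_le.
    rewrite /Rintegral; apply: fine_le.
    - by apply: integrable_fin_num => //; apply: (@intgT _ (fun t => f t ^+ 2 + g t ^+ 2)) => //; exact: intg_add.
    - by apply: integrable_fin_num => //; apply: (@intg_add _ _ (fun t => f t ^+ 2)).
    apply: ge0_subset_integral => //.
    - by apply/measurable_EFinP; apply: mbleD; exact: mbleX.
    - by move=> t _; rewrite lee_fin addr_ge0 ?sqr_ge0.
  by rewrite ler_norml => /andP[? ?]; lra.
have J1 : \int[mu]_(y in `[x, x + 1]) (f x ^+ 2) <=
   \int[mu]_(y in `[x, x + 1]) (f y ^+ 2 + (n2 f + n2 g)).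
  apply: le_Rintegral => //; first exact: intg_cst.
    by apply: intg_add => //; exact: intg_cst.
  by move=> y; rewrite /= in_itv/= => /andP[xy _]; exact: step.
have J2 : \int[mu]_(y in `[x, x + 1]) (f y ^+ 2) <= n2 f.
  rewrite /n2 /Rintegral; apply: fine_le.
  - exact: integrable_fin_num.
  - exact: integrable_fin_num.
  apply: ge0_subset_integral => //.
  - by apply/measurable_EFinP; exact: mbleX.
  - by move=> t _; rewrite lee_fin sqr_ge0.
move: J1; rewrite RintegralD//; last exact: intg_cst.
rewrite !Rint_cst//.
have -> : x + 1 - x = 1 by lra.
have := n2_ge0 g; move: (n2 f) (n2 g) J2 => ? ? ? ?; lra.
Qed.

Lemma tail_small g : mble g -> intg setT g -> forall e, 0 < e -> exists N : nat,
  \int[mu]_(x in [set x | N%:R < `|x|]) `|g x| < e.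
Proof.
move=> mg ig e e0.
pose A n := [set x : R | n%:R < `|x|].
have mA n : measurable (A n : set mR) by exact: measurable_tail.
have mgn : mble (fun x => `|g x|) by exact: mbleN.
pose fn n := (fun x => `|g x|%:E) \_ (A n : set mR).
have m1 n : measurable_fun (setT : set mR) (fn n).
  apply/(measurable_restrictT _ (mA n)); apply: measurable_funTS.
  exact/measurable_EFinP.
have cv : {ae mu, forall x, setT x -> fn ^~ x @ \oo --> (cst 0%E : R -> \bar R) x}.
  apply: ae_forall => x _; apply: cvg_near_cst.
  have [N Nx] : exists N : nat, `|x| <= N%:R.
    by exists (Num.bound `|x|); exact: ltW (archi_boundP (normr_ge0 x)).
  exists N => // n /= Nn; apply/eqP; rewrite /fn patchE memNset// /A/= => xn.
  move: Nx; rewrite leNgt => /negP; apply; apply: le_lt_trans xn.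
  by rewrite ler_nat.
have dom : {ae mu, forall x n, setT x -> (`|fn n x| <= (`|g x|)%:E)%E}.
  apply: ae_forall => x n _; rewrite /fn patchE.
  by case: ifPn => _; rewrite /= ?normr0 ?lee_fin ?normr_id.
have m0 : measurable_fun (setT : set mR) (cst 0%E : R -> \bar R).
  exact: measurable_cst.
have [_ _] := @dominated_convergence _ mR R mu setT measurableT fn _ _ m1 m0 cv (intg_norm ig) dom.
rewrite integral0 => /fine_cvgP[_ /cvgr0Pnorm_lt/(_ e e0)[N _ H]].
exists N; have := H N (leqnn N); rewrite /= => /(le_lt_trans (ler_norm _)).
by rewrite /Rintegral /fn -integral_mkcond.
Qed.

Lemma intg_small_pt f (M : R) : mble f -> intg setT f -> forall e, 0 < e ->
  (exists2 x, x < M & `|f x| < e) /\ (exists2 x, M < x & `|f x| < e).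
Proof.
move=> mf i_f e e0.
pose I := \int[mu]_x `|f x|.
have big (a b : R) : a <= b -> (forall x, a <= x <= b -> e <= `|f x|) -> e * (b - a) <= I.
  move=> ab H; rewrite -Rint_cst//.
  apply: (@le_trans _ _ (\int[mu]_(x in `[a, b]) `|f x|)).
    apply: le_Rintegral => //; first exact: intg_cst.
    - by apply: intgT => //; exact: intg_norm.
  rewrite /I /Rintegral; apply: fine_le.
  - by apply: integrable_fin_num => //; apply: (@intgT _ (fun x => `|f x|)) => //; exact: intg_norm.
  - by apply: integrable_fin_num => //; exact: (@intg_norm _ _ f).
  by apply: ge0_subset_integral => //; apply/measurable_EFinP; exact: mbleN.
have I0 : 0 <= I by apply: Rintegral_ge0.
(* An interval of length [L] on which [|f|] is at least [e] would carry mass [I + 1], more than the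
   total [I]. *)
pose L := (I + 1) / e; have L0 : 0 < L by rewrite divr_gt0//; lra.
have eL : e * L = I + 1 by rewrite /L mulrC divfK// gt_eqF.
split; apply: contrapT => H.
- have := big (M - 1 - L) (M - 1) ltac:(lra).
  have -> : M - 1 - (M - 1 - L) = L by ring.
  rewrite eL => H'; suff : I + 1 <= I by lra.
  apply: H' => x /andP[x1 x2]; rewrite leNgt; apply/negP => fx; apply: H.
  by exists x => //; lra.
- have := big (M + 1) (M + 1 + L) ltac:(lra).
  have -> : M + 1 + L - (M + 1) = L by ring.
  rewrite eL => H'; suff : I + 1 <= I by lra.
  apply: H' => x /andP[x1 x2]; rewrite leNgt; apply/negP => fx; apply: H.
  by exists x => //; lra.
Qed.

Lemma Rint_le_tail g A (N : nat) : mble g -> intg setT g -> measurable A ->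
  A `<=` [set x | N%:R < `|x|] ->
  `|\int[mu]_(x in A) g x| <= \int[mu]_(x in [set x | N%:R < `|x|]) `|g x|.
Proof.
move=> mg ig mA AN.
have mB := measurable_tail N%:R.
apply: (le_trans (le_normr_Rintegral _ (intgT mA ig))) => //.
rewrite /Rintegral; apply: fine_le.
- by apply: integrable_fin_num => //; apply: (@intgT _ (fun x => `|g x|)) => //; exact: intg_norm.
- by apply: integrable_fin_num => //; apply: (@intgT _ (fun x => `|g x|)) => //; exact: intg_norm.
apply: ge0_subset_integral => //; apply/measurable_EFinP; apply: measT; exact: mbleN.
Qed.

(** No limit of [f] at minus infinity has to be established: integrability provides points
    arbitrarily far out where [f] is small, and there the tail of [g] is small too. *)
Lemma prim_Nyc f g y : mble f -> prim f g -> intg setT f -> intg setT g ->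
  \int[mu]_(x in `]-oo, y]) g x = f y.
Proof.
move=> mf pf i_f ig; have mg : mble g by case: pf => -[].
apply/eqP; rewrite -subr_eq0 -normr_le0; apply/ler_addgt0Pr => e e0; rewrite add0r.
have e2 : 0 < e / 2 by lra.
have [N HN] := tail_small mg ig e2.
have [[x xM fx] _] := intg_small_pt (Num.min y (- N%:R)) mf i_f e2.
move: xM; rewrite lt_min => /andP[xy xN].
have := @Rintegral_itvB R g -oo%O (BRight y) x.
rewrite !bnd_simp => /(_ (intgT _ ig)) H.
have {H} := H ltac:(by []) ltac:(by []) ltac:(exact: ltW).
rewrite Rintegral_itv_obnd_cbnd; last exact: intgT.
rewrite -pf.2; last exact: ltW.
have T : `|\int[mu]_(t in `]-oo, x]) g t| < e / 2.
  apply: le_lt_trans HN; apply: Rint_le_tail => // t /=; rewrite in_itv/= => tx.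
  have t0 : t < 0 by apply: le_lt_trans tx (lt_le_trans xN _); rewrite oppr_le0.
  by rewrite ltr0_norm//; lra.
move: fx T; rewrite !ltr_norml ler_norml => /andP[? ?] /andP[? ?] ?.
by apply/andP; split; lra.
Qed.

Lemma prim_intT f g : mble f -> prim f g -> intg setT f -> intg setT g ->
  \int[mu]_x g x = 0.
Proof.
move=> mf pf i_f ig; have mg : mble g by case: pf => -[].
apply/eqP; rewrite -normr_le0; apply/ler_addgt0Pr => e e0; rewrite add0r.
have e2 : 0 < e / 2 by lra.
have [N HN] := tail_small mg ig e2.
have [_ [y yN fy]] := intg_small_pt N%:R mf i_f e2.
have := @Rintegral_itvB R g -oo%O +oo%O y.
rewrite set_itvNyy => /(_ ig) H; have {H} := H ltac:(by []) ltac:(by []).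
rewrite (prim_Nyc y mf pf i_f ig).
have T : `|\int[mu]_(t in `]y, +oo[) g t| < e / 2.
  apply: le_lt_trans HN; apply: Rint_le_tail => // t /=; rewrite in_itv/= andbT => yt.
  have t0 : 0 < t by apply: lt_trans yt; apply: le_lt_trans yN.
  by rewrite gtr0_norm//; lra.
move: fy T; rewrite !ltr_norml ler_norml => /andP[? ?] /andP[? ?] ?.
by apply/andP; split; lra.
Qed.

End SquareIntegrable.

(** * Uniform and L^2 convergence *)

Section Convergence.
Variable R : realType.
Local Notation mu := (@lebesgue_measure R).
Local Notation mR := (measurableTypeR R).
Local Notation mble f := (@measurable_fun _ _ mR mR setT f).
Local Notation intg A f := (mu.-integrable A (EFin \o f)).
Implicit Types (f g : R -> R) (A : set mR).
Variables (F : set_system R) (FF : Filter F).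

Lemma cvg0_lt (h : R -> R) (e : R) : h s @[s --> F] --> (0 : R) -> 0 < e ->
  \forall s \near F, `|h s| < e.
Proof. by move=> /cvgr0Pnorm_lt H e0; exact: H. Qed.

(** Boundedness of the limit is part of the notion so that it is stable under products.
    Measurability is asked only near the filter, because a solution is controlled only on its time
    interval. *)
Definition cvgU (fs : R -> R -> R) f :=
  [/\ \forall s \near F, mble (fs s), mble f, exists M, forall x, `|f x| <= M &
      forall e : R, 0 < e -> \forall s \near F, forall x, `|fs s x - f x| <= e].

Definition cvgL2 (fs : R -> R -> R) f :=
  [/\ \forall s \near F, L2 (fs s), L2 f &
      n2 (fun x => fs s x - f x) @[s --> F] --> (0 : R)].

Lemma cvgU_cst f : mble f -> (exists M, forall x, `|f x| <= M) -> cvgU (fun=> f) f.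
Proof.
move=> mf bf; split => //; first exact: nearW.
by move=> e e0; apply: nearW => s x; rewrite subrr normr0 ltW.
Qed.

Lemma cvgU_near_bound fs f : cvgU fs f ->
  exists2 M, 0 <= M & (forall x, `|f x| <= M) /\
    \forall s \near F, forall x, `|fs s x| <= M.
Proof.
move=> [_ _ [M fM] H]; exists (`|M| + 1); first by rewrite addr_ge0.
split.
  by move=> x; rewrite (le_trans (fM x))// (le_trans (ler_norm M))// lerDl.
near=> s => x.
have : `|fs s x - f x| <= 1 by move: x; near: s; exact: H.
move=> d; rewrite -(subrK (f x) (fs s x)) (le_trans (ler_normD _ _))// addrC.
by rewrite lerD// (le_trans (fM x))// ler_norm.
Unshelve. all: by end_near. Qed.

Lemma cvgUD fs f gs g : cvgU fs f -> cvgU gs g ->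
  cvgU (fun s x => fs s x + gs s x) (fun x => f x + g x).
Proof.
move=> [mfs mf [M fM] Hf] [mgs mg [M' gM] Hg]; split.
- by near=> s; apply: mbleD; near: s.
- exact: mbleD.
- by exists (M + M') => x; rewrite (le_trans (ler_normD _ _))// lerD.
move=> e e0; have e2 : 0 < e / 2 by lra.
near=> s.
have H1 : forall x, `|fs s x - f x| <= e / 2 by near: s; exact: Hf.
have H2 : forall x, `|gs s x - g x| <= e / 2 by near: s; exact: Hg.
move=> x; have {}H1 := H1 x; have {}H2 := H2 x.
have -> : fs s x + gs s x - (f x + g x) = (fs s x - f x) + (gs s x - g x) by ring.
by rewrite (le_trans (ler_normD _ _))//; lra.
Unshelve. all: by end_near. Qed.

Lemma cvgUM fs f gs g : cvgU fs f -> cvgU gs g ->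
  cvgU (fun s x => fs s x * gs s x) (fun x => f x * g x).
Proof.
move=> Uf Ug; have [M M0 [fM fsM]] := cvgU_near_bound Uf.
have [M' M'0 [gM gsM]] := cvgU_near_bound Ug.
move: Uf Ug => [mfs mf _ Hf] [mgs mg _ Hg]; split.
- by near=> s; apply: mbleM; near: s.
- exact: mbleM.
- by exists (M * M') => x; rewrite normrM ler_pM.
move=> e e0; pose K := M + M' + 1; have K0 : 0 < K by rewrite /K; lra.
have eK : 0 < e / K by rewrite divr_gt0.
near=> s.
have H1 : forall x, `|fs s x - f x| <= e / K by near: s; exact: Hf.
have H2 : forall x, `|gs s x - g x| <= e / K by near: s; exact: Hg.
have H3 : forall x, `|gs s x| <= M' by near: s.
move=> x; have {}H1 := H1 x; have {}H2 := H2 x; have {}H3 := H3 x.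
have -> : fs s x * gs s x - f x * g x =
  (fs s x - f x) * gs s x + f x * (gs s x - g x) by ring.
rewrite (le_trans (ler_normD _ _))// !normrM.
apply: (@le_trans _ _ (e / K * M' + M * (e / K))); first by rewrite lerD// ler_pM.
have -> : e / K * M' + M * (e / K) = e / K * (M + M') by ring.
have {2}-> : e = e / K * K by rewrite divfK// gt_eqF.
by rewrite ler_wpM2l// ?(ltW eK)// /K lerDl.
Unshelve. all: by end_near. Qed.

Lemma cvgL2_cst f : L2 f -> cvgL2 (fun=> f) f.
Proof.
move=> Lf; split => //; first exact: nearW.
suff -> : (fun s : R => n2 (fun x => f x - f x)) = cst 0 by exact: cvg_cst.
apply/funext => s; rewrite /n2.
under eq_Rintegral do rewrite subrr expr0n/=.
by rewrite /Rintegral/= integral0.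
Qed.

Lemma cvgL2D fs f gs g : cvgL2 fs f -> cvgL2 gs g ->
  cvgL2 (fun s x => fs s x + gs s x) (fun x => f x + g x).
Proof.
move=> [Lfs Lf Hf] [Lgs Lg Hg]; split.
- by near=> s; apply: L2D; near: s.
- exact: L2D.
have cz : 2 * n2 (fun x => fs s x - f x) + 2 * n2 (fun x => gs s x - g x) @[s --> F] --> (0 : R).
  rewrite -[X in _ --> X](addr0 (0:R)) -(mulr0 (2:R)).
  by apply: cvgD; apply: cvgM => //; exact: cvg_cst.
apply: (squeeze_cvgr _ (cvg_cst (0 : R)) cz).
- near=> s; rewrite n2_ge0/=.
  have -> : (fun x => fs s x + gs s x - (f x + g x)) =
     (fun x => (fs s x - f x) + (gs s x - g x)) by apply/funext => x; ring.
  by apply: n2D; apply: L2B => //; near: s.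
Unshelve. all: by end_near. Qed.

Lemma cvgL2_n2_bounded fs f : cvgL2 fs f ->
  \forall s \near F, n2 (fs s) <= 2 * n2 f + 1.
Proof.
move=> [Lfs Lf Hf].
have h : 0 < (1 / 2 : R) by lra.
have := cvg0_lt Hf h => nr.
near=> s.
have Ls : L2 (fs s) by near: s.
have -> : fs s = (fun x => f x + (fs s x - f x)) by apply/funext => x; ring.
apply: (le_trans (n2D Lf (L2B Ls Lf))); rewrite lerD2l.
have : `|n2 (fun x => fs s x - f x)| < 1 / 2 by near: s.
by rewrite ger0_norm ?n2_ge0//; lra.
Unshelve. all: by end_near. Qed.

Lemma cvgL2_mulU fs f gs g : cvgU fs f -> cvgL2 gs g ->
  cvgL2 (fun s x => fs s x * gs s x) (fun x => f x * g x).
Proof.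
move=> Uf Lg; have [M M0 [fM fsM]] := cvgU_near_bound Uf.
have nb := cvgL2_n2_bounded Lg.
move: Uf Lg => [mfs mf _ Hf] [Lgs Lg Hg].
have nL : \forall s \near F, L2 (fun x => fs s x * gs s x).
  near=> s; apply: (proj1 (@L2_bounded _ _ _ M _ _ _)); near: s => //.
split => //; first by apply: (proj1 (@L2_bounded _ _ _ M _ _ _)).
apply/cvgr0Pnorm_le => e e0.
pose B := 2 * n2 g + 1; have B0 : 0 < B by rewrite /B; have := n2_ge0 g; lra.
(* The product is split as [(fs - f) * gs + f * (gs - g)]. Since [d <= 1], [d ^+ 2] may be replaced
   by [d]; after the factor 2 of [n2D], each term contributes at most [e / 2]. *)
pose d := Num.min 1 (e / (4 * B)).
have d0 : 0 < d by rewrite lt_min ltr01 divr_gt0//; lra.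
have d1 : d <= 1 by rewrite ge_min lexx.
have dB : d * (4 * B) <= e.
  by rewrite -ler_pdivlMr; [rewrite /d ge_min lexx orbT|lra].
pose d' := e / (4 * (M ^+ 2 + 1)).
have M1 : 0 < M ^+ 2 + 1 by have := sqr_ge0 M; lra.
have d'0 : 0 < d' by rewrite divr_gt0//; lra.
have dM : M ^+ 2 * d' <= e / 4.
  have -> : e / 4 = (M ^+ 2 + 1) * d' by rewrite /d'; field; lra.
  by rewrite ler_wpM2r// ?(ltW d'0)// lerDl.
have nr := cvg0_lt Hg d'0.
near=> s.
have Ls : L2 (gs s) by near: s.
have ms : mble (fs s) by near: s.
have H1 : forall x, `|fs s x - f x| <= d by near: s; exact: Hf.
have H2 : n2 (gs s) <= B by near: s.
have H3 : n2 (fun x => gs s x - g x) <= d'.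
  have : `|n2 (fun x => gs s x - g x)| < d' by near: s.
  by rewrite ger0_norm ?n2_ge0//; lra.
rewrite ger0_norm ?n2_ge0//.
have -> : (fun x => fs s x * gs s x - f x * g x) =
  (fun x => (fs s x - f x) * gs s x + f x * (gs s x - g x)).
  by apply/funext => x; ring.
have [L1 N1] := @L2_bounded _ (fun x => fs s x - f x) (gs s) d (mbleB ms mf) H1 Ls.
have [L2' N2] := @L2_bounded _ f (fun x => gs s x - g x) M mf fM (L2B Ls Lg).
apply: (le_trans (n2D L1 L2')).
have X1 : d ^+ 2 * n2 (gs s) <= d * B.
  rewrite expr2 ler_pM ?mulr_ge0 ?n2_ge0// ?(ltW d0)//.
  by rewrite ler_piMl// ltW.
have X2 : M ^+ 2 * n2 (fun x => gs s x - g x) <= M ^+ 2 * d'.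
  by rewrite ler_wpM2l ?sqr_ge0.
lra.
Unshelve. all: by end_near. Qed.

Lemma cvgL2_integral A fs f gs g : measurable A -> cvgL2 fs f -> cvgL2 gs g ->
  \int[mu]_(x in A) (fs s x * gs s x) @[s --> F] --> \int[mu]_(x in A) (f x * g x).
Proof.
move=> mA Cf Cg; have nb := cvgL2_n2_bounded Cg.
move: Cf Cg => [Lfs Lf Hf] [Lgs Lg Hg].
have sq (h : R -> R) : h s @[s --> F] --> (0 : R) -> Num.sqrt (h s) @[s --> F] --> (0 : R).
  move=> hc; rewrite -[X in _ --> X](@sqrtr0 R).
  by apply: (cvg_comp _ _ hc); exact: sqrt_continuous.
apply/cvgrPdist_le => e e0.
pose B := Num.sqrt (2 * n2 g + 1) + Num.sqrt (n2 f) + 1.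
have B0 : 0 < B by rewrite /B ltr_wpDl// addr_ge0 ?sqrtr_ge0.
pose d := e / (2 * B); have d0 : 0 < d by rewrite divr_gt0//; lra.
have nf := cvg0_lt (sq _ Hf) d0.
have ng := cvg0_lt (sq _ Hg) d0.
near=> s.
have Ls : L2 (fs s) by near: s.
have Lgs' : L2 (gs s) by near: s.
have H1 : Num.sqrt (n2 (fun x => fs s x - f x)) <= d.
  by apply/ltW/(le_lt_trans (ler_norm _)); near: s.
have H2 : Num.sqrt (n2 (fun x => gs s x - g x)) <= d.
  by apply/ltW/(le_lt_trans (ler_norm _)); near: s.
have H3 : Num.sqrt (n2 (gs s)) <= Num.sqrt (2 * n2 g + 1).
  by apply: ler_wsqrtr; near: s.
have i1 := L2_mul (L2B Ls Lf) Lgs'; have i2 := L2_mul Lf (L2B Lgs' Lg).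
rewrite -RintegralB//; [|exact: intgT (L2_mul Lf Lg)|exact: intgT (L2_mul Ls Lgs')].
apply: (@le_trans _ _ (\int[mu]_x (`|(fs s x - f x) * gs s x| + `|f x * (gs s x - g x)|))).
  apply: (le_trans (le_normr_Rintegral _ _)) => //.
    by apply: intg_sub => //; apply: intgT => //; exact: L2_mul.
  rewrite /Rintegral; apply: fine_le.
  - apply: integrable_fin_num => //.
    apply: (@intg_norm _ _ (fun x => f x * g x - fs s x * gs s x)).
    by apply: intg_sub => //; apply: intgT => //; exact: L2_mul.
  - apply: integrable_fin_num => //.
    apply: (@intg_add _ _ (fun x => `|(fs s x - f x) * gs s x|)) => //.
      exact: (intg_norm i1).
    exact: (intg_norm i2).
  have [mf mg ms mgs] := And4 (proj1 Lf) (proj1 Lg) (proj1 Ls) (proj1 Lgs').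
  have mm := mbleN (mbleB (mbleM mf mg) (mbleM ms mgs)).
  have mm2 := mbleD (mbleN (mbleM (mbleB ms mf) mgs)) (mbleN (mbleM mf (mbleB mgs mg))).
  apply: (@le_trans _ _ (\int[mu]_(x in setT) (`|f x * g x - fs s x * gs s x|)%:E)%E).
    by apply: ge0_subset_integral => //; exact/measurable_EFinP.
  apply: ge0_le_integral => //.
  - exact/measurable_EFinP.
  - exact/measurable_EFinP.
  move=> x _; rewrite lee_fin distrC.
  have -> : fs s x * gs s x - f x * g x =
    (fs s x - f x) * gs s x + f x * (gs s x - g x) by ring.
  exact: ler_normD.
rewrite RintegralD//; [|exact: (intg_norm i1)|exact: (intg_norm i2)].
have C1 := cauchy_schwarz (L2B Ls Lf) Lgs'.
have C2 := cauchy_schwarz Lf (L2B Lgs' Lg).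
apply: (le_trans (lerD C1 C2)).
apply: (@le_trans _ _ (d * Num.sqrt (2 * n2 g + 1) + Num.sqrt (n2 f) * d)).
  by rewrite lerD// ler_pM// sqrtr_ge0.
have -> : d * Num.sqrt (2 * n2 g + 1) + Num.sqrt (n2 f) * d = d * (B - 1) by rewrite /B; ring.
apply: (@le_trans _ _ (d * B)); first by rewrite ler_wpM2l ?(ltW d0)//; lra.
have -> : d * B = e / 2 by rewrite /d; field; lra.
lra.
Unshelve. all: by end_near. Qed.

Lemma prim_cvgU fs f fs' f' : (\forall s \near F, prim (fs s) (fs' s)) ->
  prim f f' -> cvgL2 fs f -> cvgL2 fs' f' -> cvgU fs f.
Proof.
move=> np pf [Ls Lf Hf] [Ls' Lf' Hf'].
split; [by apply: filterS Ls => s []|by case: Lf| |].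
  exists (2 * (n2 f + n2 f') + 1) => x; have := prim_sup x pf Lf Lf'.
  move=> H; have := sqr_ge0 (`|f x| - 1).
  have : `|f x| ^+ 2 = f x ^+ 2 by rewrite real_normK ?num_real.
  by have := normr_ge0 (f x); lra.
move=> e e0.
(* [prim_sup] turns two squared norms of at most [e ^+ 2 / 4] into
   [2 * (e ^+ 2 / 4 + e ^+ 2 / 4) = e ^+ 2]. *)
have d0 : 0 < e ^+ 2 / 4 by rewrite divr_gt0// exprn_gt0.
have nf := cvg0_lt Hf d0.
have nf' := cvg0_lt Hf' d0.
near=> s => x.
have H1 : n2 (fun x => fs s x - f x) <= e ^+ 2 / 4.
  by apply/ltW/(le_lt_trans (ler_norm _)); near: s.
have H2 : n2 (fun x => fs' s x - f' x) <= e ^+ 2 / 4.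
  by apply/ltW/(le_lt_trans (ler_norm _)); near: s.
have ps : prim (fs s) (fs' s) by near: s.
have L1 : L2 (fs s) by near: s.
have L1' : L2 (fs' s) by near: s.
have := prim_sup x (primB ps pf) (L2B L1 Lf) (L2B L1' Lf').
move=> H; rewrite -(@ler_pXn2r _ 2)// ?nnegrE ?(ltW e0)// real_normK ?num_real//.
lra.
Unshelve. all: by end_near. Qed.

Lemma n2_Lnorm f : L2 f -> ('N[mu]_2%:E[EFin \o f] `^ 2)%E = (n2 f)%:E.
Proof.
move=> [mf i_f]; rewrite poweR_Lnorm// /n2 /Rintegral fineK; last first.
  exact: integrable_fin_num.
apply: eq_integral => x _ /=; congr EFin.
by rewrite powR_mulrn// real_normK ?num_real.
Qed.

Lemma sobolev_norm_iter k (f : R -> R) i e : (i <= k)%N -> 0 <= e ->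
  (sobolev_norm k f <= e%:E)%E ->
  ('N[mu]_2%:E[EFin \o iter i (@wderiv R) f] `^ 2 <= (e ^+ 2)%:E)%E.
Proof.
move=> ik e0; rewrite /sobolev_norm => H.
set S := (\sum_(j < k.+1) _)%E in H.
have S0 : (0 <= S)%E by apply: sume_ge0 => j _; exact: poweR_ge0.
apply: (@le_trans _ _ S).
  have ik' : (i < k.+1)%N by [].
  rewrite /S (bigD1 (Ordinal ik'))//= leeDl//.
  by apply: sume_ge0 => j _; exact: poweR_ge0.
have -> : S = ((S `^ 2^-1) `^ 2)%E by rewrite -poweRrM mulVf// poweRe1.
have -> : (e ^+ 2)%:E = (e%:E `^ 2)%E by rewrite /= powR_mulrn.
by apply: gt0_ler_poweR => //; rewrite in_itv/= leey andbT ?poweR_ge0 ?lee_fin.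
Qed.

(** [sobolev_norm] is built on iterated [wderiv], known only almost everywhere; [G] is the explicit
    derivative for which the convergence is wanted. *)
Lemma sobolev_cvg k i (Phi G : R -> R -> R) : (i <= k)%N ->
  sobolev_norm k (Phi s) @[s --> F] --> 0%E ->
  (\forall s \near F, L2 (G s) /\
     ({ae mu, forall x, iter i (@wderiv R) (Phi s) x = G s x} /\
      mble (iter i (@wderiv R) (Phi s)))) ->
  n2 (G s) @[s --> F] --> (0 : R).
Proof.
move=> ik /fine_cvgP[fin cv] nG.
apply/cvgr0Pnorm_le => e e0.
(* [n2] is the square of a norm, and [d <= 1] gives [d ^+ 2 <= e]. *)
pose d := Num.min 1 e; have d0 : 0 < d by rewrite lt_min ltr01.
have de : d ^+ 2 <= e.
  have d1 : d <= 1 by rewrite ge_min lexx.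
  apply: (@le_trans _ _ d); last by rewrite ge_min lexx orbT.
  by rewrite expr2 ler_piMl// ltW.
have nr := cvg0_lt cv d0.
near=> s.
have [LG [ae mm]] : L2 (G s) /\
     ({ae mu, forall x, iter i (@wderiv R) (Phi s) x = G s x} /\
      mble (iter i (@wderiv R) (Phi s))) by near: s.
have F1 : sobolev_norm k (Phi s) \is a fin_num by near: s.
have F2 : `|fine (sobolev_norm k (Phi s))| < d by near: s.
have F3 : (sobolev_norm k (Phi s) <= d%:E)%E.
  by rewrite -(fineK F1) lee_fin ltW// (le_lt_trans (ler_norm _)).
have := sobolev_norm_iter ik (ltW d0) F3.
have [Li <-] : L2 (iter i (@wderiv R) (Phi s)) /\ n2 (iter i (@wderiv R) (Phi s)) = n2 (G s).
  have [L <-] := L2_ae LG mm (ae_impl (fun x E => esym E) ae); by split.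
rewrite n2_Lnorm// lee_fin => H.
by rewrite ger0_norm ?n2_ge0// (le_trans H).
Unshelve. all: by end_near. Qed.

End Convergence.

(** * Absolutely continuous representatives of Sobolev functions *)

Section Representatives.
Variable R : realType.
Local Notation mu := (@lebesgue_measure R).
Local Notation mR := (measurableTypeR R).
Local Notation mble f := (@measurable_fun _ _ mR mR setT f).
Local Notation intg A f := (mu.-integrable A (EFin \o f)).
Implicit Types (f g : R -> R) (A : set mR).

Lemma Lfun_L2 f : f \in Lfun mu 2%:E -> L2 f.
Proof.
move=> Lf; split; last exact: Lfun2_integrable_sqr.
by move: Lf; rewrite inE => /andP[+ _]; rewrite inE.
Qed.

Lemma sobolev1_rep f : sobolev 1 f -> exists G G1,
  [/\ prim G G1, L2 G, L2 G1 & {ae mu, forall x, f x = G x}].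
Proof.
move=> [/Lfun_L2 Lf [g W [/Lfun_L2 Lg _]]].
have [G [pG fG]] := weak_prim W.
exists G, g; split => //.
by apply: (proj1 (L2_ae Lf _ fG)); exact: meas_cont (prim_cont pG).
Qed.

Lemma sobolev2_rep f : sobolev 2 f -> exists G G1 G2,
  [/\ prim G G1, prim G1 G2, L2 G, L2 G1 & L2 G2 /\ {ae mu, forall x, f x = G x}].
Proof.
move=> [/Lfun_L2 Lf [g W Sg]].
have [G1 [G2 [pG1 LG1 LG2 gG1]]] := sobolev1_rep Sg.
have [G [pG fG]] := weak_prim W.
exists G, G1, G2; split => //.
  by apply: prim_ae pG _ gG1; exact: meas_cont (prim_cont pG1).
by apply: (proj1 (L2_ae Lf _ fG)); exact: meas_cont (prim_cont pG).
Qed.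

(** A continuous function equal almost everywhere to a primitive equals it everywhere, so no change
    of representative is needed and values along curves keep their meaning. *)
Lemma sobolev2_cont_rep f : continuous f -> sobolev 2 f -> exists G1 G2,
  [/\ prim f G1, prim G1 G2, L2 f, L2 G1 & L2 G2].
Proof.
move=> cf /sobolev2_rep[G [G1 [G2 [pG pG1 LG LG1 [LG2 fG]]]]].
have E := cont_ae_eq cf (prim_cont pG) fG.
have -> : f = G by apply/funext.
by exists G1, G2.
Qed.

Lemma prim_derive1 f g : prim f g -> continuous g ->
  forall x, derivable f x 1 /\ derive1 f x = g x.
Proof.
move=> pf cg x; have [[mg ig] H] := pf.
pose G y := \int[mu]_(t in `[x - 1, y]) g t.
have [dG eG] : derivable G x 1 /\ derive1 G x = g x.
  by apply: (@continuous_FTC1_closed R g (x - 1) x (x + 1)); [lra|exact: ig|lra|exact: cg].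
have nE : \forall y \near x, f y = f (x - 1) + G y.
  near=> y; rewrite /G -H; first by ring.
  by apply/ltW; near: y; apply: lt_nbhsr; lra.
have dF : derivable (fun y => f (x - 1) + G y) x 1.
  exact: (derivableD (derivable_cst (f (x - 1)) x 1) dG).
split.
  apply: (near_eq_derivable _ dF) => //.
  by apply: filterS nE => y ->.
rewrite derive1E.
have -> : 'D_1 f x = 'D_1 (fun y => f (x - 1) + G y) x by exact: near_eq_derive.
by rewrite (deriveD (derivable_cst (f (x - 1)) x 1) dG) derive_cst add0r -derive1E.
Unshelve. all: by end_near. Qed.

End Representatives.

(** * Energy law at a fixed time *)

Ltac nonneg := repeat first [ assumption | exact: sqr_ge0 | exact: ltW
  | apply: addr_ge0 | apply: exprn_ge0 | apply: mulr_ge0 | apply: divr_ge0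
  | rewrite invr_ge0 | by [] ].

(** * Bounded coefficients and powers of primitives *)

Section Bounded.
Variable R : realType.
Local Notation mu := (@lebesgue_measure R).
Local Notation mR := (measurableTypeR R).
Local Notation mble f := (@measurable_fun _ _ mR mR setT f).
Local Notation intg A f := (mu.-integrable A (EFin \o f)).
Implicit Types (f g : R -> R).

Definition bnd f := mble f /\ exists M, forall x, `|f x| <= M.

Lemma bndD f g : bnd f -> bnd g -> bnd (fun x => f x + g x).
Proof.
move=> [mf [M fM]] [mg [M' gM]]; split; first exact: mbleD.
by exists (M + M') => x; rewrite (le_trans (ler_normD _ _))// lerD.
Qed.

Lemma bndM f g : bnd f -> bnd g -> bnd (fun x => f x * g x).
Proof.
move=> [mf [M fM]] [mg [M' gM]]; split; first exact: mbleM.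
by exists (M * M') => x; rewrite normrM ler_pM.
Qed.

Lemma bnd_cst (k : R) : bnd (fun=> k).
Proof. by split; [exact: measurable_cst|exists `|k|]. Qed.

Lemma bndZ f (k : R) : bnd f -> bnd (fun x => k * f x).
Proof. by move=> bf; apply: bndM => //; exact: bnd_cst. Qed.

Lemma bndX f n : bnd f -> bnd (fun x => f x ^+ n).
Proof.
move=> bf; elim: n => [|n IH]; first exact: bnd_cst.
by under eq_fun do rewrite exprS; exact: bndM.
Qed.

Lemma bnd_H1 f g : prim f g -> L2 f -> L2 g -> bnd f.
Proof.
move=> pf Lf Lg; split; first by case: Lf.
exists (2 * (n2 f + n2 g) + 1) => x; have := prim_sup x pf Lf Lg.
move=> H; have := sqr_ge0 (`|f x| - 1).
have : `|f x| ^+ 2 = f x ^+ 2 by rewrite real_normK ?num_real.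
by have := normr_ge0 (f x); lra.
Qed.

Lemma L2_bnd f g : bnd f -> L2 g -> L2 (fun x => f x * g x).
Proof.
by move=> [mf [M fM]] Lg; apply: (proj1 (@L2_bounded _ _ _ M _ _ _)).
Qed.

Lemma intg_bnd f g : bnd f -> mble g -> intg setT g ->
  intg setT (fun x => f x * g x).
Proof. by move=> [mf [M fM]] mg ig; apply: (@intg_bounded _ _ _ M). Qed.

Lemma prim_ext f g f' g' : prim f g -> (forall x, f x = f' x) ->
  (forall x, g x = g' x) -> prim f' g'.
Proof. by move=> P /funext <- /funext <-. Qed.

Lemma primX f g n : prim f g ->
  prim (fun x => f x ^+ n.+1) (fun x => n.+1%:R * f x ^+ n * g x).
Proof.
move=> pf; elim: n => [|n IH].
  by apply: (prim_ext pf) => x; rewrite ?expr1// expr0 !mul1r.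
apply: (prim_ext (primM pf IH)) => x; rewrite ?exprS//.
by rewrite -(natr1 n.+1); ring.
Qed.

End Bounded.

Section FixedTime.
Variable R : realType.
Local Notation mu := (@lebesgue_measure R).
Local Notation mR := (measurableTypeR R).
Local Notation mble f := (@measurable_fun _ _ mR mR setT f).
Local Notation intg A f := (mu.-integrable A (EFin \o f)).
Variables (g be al hbar : R) (h u hx ux hxx uxx v vx vxx : R -> R).
Hypotheses (g0 : 0 < g) (be0 : 0 < be) (alE : al = 1 + 3 / 2 * be).
Hypotheses (ph : prim h hx) (phx : prim hx hxx) (pu : prim u ux)
  (pux : prim ux uxx) (pv : prim v vx) (pvx : prim vx vxx).
Hypotheses (LH : L2 (fun x => h x - hbar)) (Lhx : L2 hx) (Lhxx : L2 hxx)
  (Lu : L2 u) (Lux : L2 ux) (Luxx : L2 uxx)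
  (Lv : L2 v) (Lvx : L2 vx) (Lvxx : L2 vxx).

(* [ht_] and [ut_] are the time derivatives prescribed by the system, [v] being
   the nonlocal term; [htx_], [utx_], [nrjt], ... are formal derivatives of the
   quantities they are named after, [ellip] is [L_h v], and [press] is the
   pressure [w] with [w' = h v], normalized to vanish at infinity. *)
Definition kappa := (al - 1) / al * g.
Definition ht_ x := - (h x * ux x + u x * hx x).
Definition htx_ x := - (2 * hx x * ux x + h x * uxx x + u x * hxx x).
Definition ut_ x := - (u x * ux x + kappa * hx x + v x).
Definition utx_ x := - (ux x ^+ 2 + u x * uxx x + kappa * hxx x + vx x).

Definition source_ x := 2 / 3 * al * h x ^+ 3 * ux x ^+ 2
  - 1 / 4 * be * g * h x ^+ 2 * hx x ^+ 2 + g / (2 * al) * h x ^+ 2.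
Definition sourcex_ x :=
  2 / 3 * al * (3 * h x ^+ 2 * hx x * ux x ^+ 2 + 2 * h x ^+ 3 * ux x * uxx x)
  - 1 / 4 * be * g * (2 * h x * hx x ^+ 3 + 2 * h x ^+ 2 * hx x * hxx x)
  + g / al * h x * hx x.
Definition ellip x := h x * v x - al / 3 * (3 * h x ^+ 2 * hx x * vx x + h x ^+ 3 * vxx x).

Definition nrj x := 1 / 2 * h x * u x ^+ 2 + 1 / 6 * al * h x ^+ 3 * ux x ^+ 2
  + 1 / 2 * g * (h x - hbar) ^+ 2 + 1 / 4 * be * g * h x ^+ 2 * hx x ^+ 2.
Definition nrjt x := (h x * u x) * ut_ x + (1 / 3 * al * h x ^+ 3 * ux x) * utx_ x
  + (1 / 2 * be * g * h x ^+ 2 * hx x) * htx_ x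
  + (1 / 2 * u x ^+ 2 + 1 / 2 * al * h x ^+ 2 * ux x ^+ 2 + g * (h x - hbar)
     + 1 / 2 * be * g * h x * hx x ^+ 2) * ht_ x.

Definition press x := source_ x - g / (2 * al) * hbar ^+ 2 + al / 3 * h x ^+ 3 * vx x.

(** Equal to [u * (nrj + press + kappa / 2 * (h ^+ 2 - hbar ^+ 2))] plus the cross term
    [1 / 2 * be * g * h ^+ 3 * ux * hx], which later completes the squares of the Riemann
    derivatives. *)
Definition flux x := 1 / 2 * h x * u x ^+ 3 + g * h x * (h x - hbar) * u x
  + 5 / 6 * al * h x ^+ 3 * u x * ux x ^+ 2
  + 1 / 2 * be * g * h x ^+ 3 * ux x * hx x + al / 3 * h x ^+ 3 * u x * vx x.

Let al0 : 0 < al. Proof. by rewrite alE addr_gt0// mulr_gt0// divr_gt0. Qed.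
Let aln0 : al != 0. Proof. by rewrite gt_eqF// al0. Qed.

Let bH : bnd (fun x => h x - hbar).
Proof.
apply: (bnd_H1 _ LH Lhx); apply: (prim_ext (primB ph (prim_cst hbar))) => x //=.
by rewrite subr0.
Qed.
Let bh : bnd h.
Proof.
have := bndD bH (bnd_cst hbar); congr bnd; apply/funext => x; ring.
Qed.
Let bu : bnd u. Proof. exact: bnd_H1 pu Lu Lux. Qed.
Let bhx : bnd hx. Proof. exact: bnd_H1 phx Lhx Lhxx. Qed.
Let bux : bnd ux. Proof. exact: bnd_H1 pux Lux Luxx. Qed.
Let bvx : bnd vx. Proof. exact: bnd_H1 pvx Lvx Lvxx. Qed.

Lemma prim_ht : prim ht_ htx_.
Proof.
apply: (prim_ext (primZ (-1) (primD (primM ph pux) (primM pu phx)))) => x;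
  rewrite /ht_ /htx_; ring.
Qed.

Lemma prim_ut : prim ut_ utx_.
Proof.
apply: (prim_ext (primZ (-1) (primD (primD (primM pu pux) (primZ kappa phx)) pv))) => x;
  rewrite /ut_ /utx_; ring.
Qed.

Lemma L2_ext f f' : L2 f -> (forall x : R, f x = f' x) -> L2 f'.
Proof. by move=> L /funext <-. Qed.

Lemma L2_ht : L2 ht_.
Proof.
by apply: (L2_ext (L2N (L2D (L2_bnd bh Lux) (L2_bnd bu Lhx)))) => x; rewrite /ht_.
Qed.

Lemma L2_htx : L2 htx_.
Proof.
apply: (L2_ext (L2N (L2D (L2D (L2_bnd (bndZ 2 bhx) Lux) (L2_bnd bh Luxx)) (L2_bnd bu Lhxx)))).
by move=> x; rewrite /htx_.
Qed.

Lemma L2_ut : L2 ut_.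
Proof.
apply: (L2_ext (L2N (L2D (L2D (L2_bnd bu Lux) (L2Z kappa Lhx)) Lv))) => x.
by rewrite /ut_.
Qed.

Lemma L2_utx : L2 utx_.
Proof.
apply: (L2_ext (L2N (L2D (L2D (L2D (L2_bnd bux Lux) (L2_bnd bu Luxx)) (L2Z kappa Lhxx)) Lvx))) => x.
by rewrite /utx_ expr2.
Qed.

Lemma prim_source : prim source_ sourcex_.
Proof.
have P1 := primM (primX 2 ph) (primX 1 pux).
have P2 := primM (primX 1 ph) (primX 1 phx).
have P3 := primX 1 ph.
apply: (prim_ext (primD (primD (primZ (2 / 3 * al) P1) (primZ (- (1 / 4 * be * g)) P2))
  (primZ (g / (2 * al)) P3))) => x; rewrite /source_ /sourcex_; field; rewrite ?aln0//.
Qed.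

Hypothesis ellipE : {ae mu, forall x, ellip x = sourcex_ x}.

(** The elliptic equation cancels every second-order term of the naive derivative and leaves [h v],
    so the pressure can be estimated in H^1 without second derivatives of the solution. *)
Lemma prim_press : prim press (fun x => h x * v x).
Proof.
have P : prim press (fun x => sourcex_ x +
    al / 3 * (3 * h x ^+ 2 * hx x * vx x + h x ^+ 3 * vxx x)).
  apply: (prim_ext (primD (primB prim_source (prim_cst (g / (2 * al) * hbar ^+ 2)))
    (primZ (al / 3) (primM (primX 2 ph) pvx)))) => x; rewrite /press /=; ring.
apply: (prim_ae P); first by apply: mbleM; [case: bh|case: Lv].
by apply: ae_impl ellipE => x <-; rewrite /ellip; ring.
Qed.

Definition fluxx x := 1 / 2 * hx x * u x ^+ 3 + 3 / 2 * h x * u x ^+ 2 * ux x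
  + g * (hx x * (h x - hbar) * u x + h x * hx x * u x + h x * (h x - hbar) * ux x)
  + 5 / 6 * al * (3 * h x ^+ 2 * hx x * u x * ux x ^+ 2 + h x ^+ 3 * ux x ^+ 3
    + 2 * h x ^+ 3 * u x * ux x * uxx x)
  + 1 / 2 * be * g * (3 * h x ^+ 2 * hx x ^+ 2 * ux x + h x ^+ 3 * uxx x * hx x
    + h x ^+ 3 * ux x * hxx x)
  + al / 3 * (3 * h x ^+ 2 * hx x * u x * vx x + h x ^+ 3 * ux x * vx x
    + h x ^+ 3 * u x * vxx x).

Lemma prim_flux : prim flux fluxx.
Proof.
have pH := primB ph (prim_cst hbar).
have P1 := primZ (1 / 2) (primM ph (primX 2 pu)).
have P2 := primZ g (primM (primM ph pH) pu).
have P3 := primZ (5 / 6 * al) (primM (primM (primX 2 ph) pu) (primX 1 pux)).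
have P4 := primZ (1 / 2 * be * g) (primM (primM (primX 2 ph) pux) phx).
have P5 := primZ (al / 3) (primM (primM (primX 2 ph) pu) pvx).
apply: (prim_ext (primD (primD (primD (primD P1 P2) P3) P4) P5)) => x;
  rewrite /flux /fluxx /=; field => //.
Qed.

(* [nrjt + fluxx] is [u] times the residual of the elliptic equation. *)
Lemma energy_law : {ae mu, forall x, nrjt x = - fluxx x}.
Proof.
apply: ae_impl ellipE => x E.
have K : nrjt x + fluxx x = u x * (sourcex_ x - ellip x).
  rewrite /nrjt /fluxx /sourcex_ /ellip /ut_ /utx_ /ht_ /htx_ /kappa.
  have -> : be = 2 / 3 * (al - 1) by rewrite alE; field.
  by field; rewrite ?aln0.
by apply/eqP; rewrite -addr_eq0 K E subrr mulr0.
Qed.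

Lemma intg_ext f f' : intg setT f -> (forall x : R, f x = f' x) -> intg setT f'.
Proof. by move=> L /funext <-. Qed.

Lemma mble_ext f f' : mble f -> (forall x : R, f x = f' x) -> mble f'.
Proof. by move=> L /funext <-. Qed.

Let intg_sqr f k : bnd f -> L2 k -> intg setT (fun x => f x * (k x * k x)).
Proof.
move=> bf Lk; apply: intg_bnd => //; last exact: L2_mul.
by case: Lk => mk _; exact: mbleM.
Qed.

Lemma intg_nrj : intg setT nrj.
Proof.
have I1 := intg_sqr (bndZ (1 / 2) bh) Lu.
have I2 := intg_sqr (bndZ (1 / 6 * al) (bndX 3 bh)) Lux.
have I3 := intg_sqr (bnd_cst (1 / 2 * g)) LH.
have I4 := intg_sqr (bndZ (1 / 4 * be * g) (bndX 2 bh)) Lhx.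
have mT := @measurableT _ mR.
by apply: (intg_ext (intg_add mT (intg_add mT (intg_add mT I1 I2) I3) I4)) => x;
  rewrite /nrj; ring.
Qed.

Lemma nrj_coef_L2 : [/\ L2 (fun x => h x * u x), L2 (fun x => 1 / 3 * al * h x ^+ 3 * ux x),
  L2 (fun x => 1 / 2 * be * g * h x ^+ 2 * hx x) &
  L2 (fun x => 1 / 2 * u x ^+ 2 + 1 / 2 * al * h x ^+ 2 * ux x ^+ 2 + g * (h x - hbar)
     + 1 / 2 * be * g * h x * hx x ^+ 2)].
Proof.
split.
- exact: L2_bnd.
- exact: (L2_bnd (bndZ (1 / 3 * al) (bndX 3 bh)) Lux).
- exact: (L2_bnd (bndZ (1 / 2 * be * g) (bndX 2 bh)) Lhx).
have L1 := L2_bnd (bndZ (1 / 2) bu) Lu.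
have L2' := L2_bnd (bndM (bndZ (1 / 2 * al) (bndX 2 bh)) bux) Lux.
have L4 := L2_bnd (bndM (bndZ (1 / 2 * be * g) bh) bhx) Lhx.
by apply: (L2_ext (L2D (L2D (L2D L1 L2') (L2Z g LH)) L4)) => x; ring.
Qed.

Lemma intg_nrjt : intg setT nrjt.
Proof.
have [L1 L2' L3 L4] := nrj_coef_L2; have mT := @measurableT _ mR.
exact: (intg_add mT (intg_add mT (intg_add mT (L2_mul L1 L2_ut) (L2_mul L2' L2_utx))
  (L2_mul L3 L2_htx)) (L2_mul L4 L2_ht)).
Qed.

Lemma bnd_flux : bnd flux.
Proof.
have B1 := bndM (bndZ (1 / 2) bh) (bndX 3 bu).
have B2 := bndM (bndM (bndZ g bh) bH) bu.
have B3 := bndM (bndM (bndZ (5 / 6 * al) (bndX 3 bh)) bu) (bndX 2 bux).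
have B4 := bndM (bndM (bndZ (1 / 2 * be * g) (bndX 3 bh)) bux) bhx.
have B5 := bndM (bndM (bndZ (al / 3) (bndX 3 bh)) bu) bvx.
exact: (bndD (bndD (bndD (bndD B1 B2) B3) B4) B5).
Qed.

Lemma intg_flux : intg setT flux.
Proof.
have mT := @measurableT _ mR.
have P k f f' : bnd k -> L2 f -> L2 f' -> intg setT (fun x => k x * (f x * f' x)).
  move=> bk Lf Lf'; apply: intg_bnd => //; last exact: L2_mul.
  by apply: mbleM; [case: Lf|case: Lf'].
have I1 := P _ _ _ (bndM (bndZ (1 / 2) bh) bu) Lu Lu.
have I2 := P _ _ _ (bndZ g bh) LH Lu.
have I3 := P _ _ _ (bndM (bndZ (5 / 6 * al) (bndX 3 bh)) bu) Lux Lux.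
have I4 := P _ _ _ (bndZ (1 / 2 * be * g) (bndX 3 bh)) Lux Lhx.
have I5 := P _ _ _ (bndZ (al / 3) (bndX 3 bh)) Lu Lvx.
apply: (intg_ext (intg_add mT (intg_add mT (intg_add mT (intg_add mT I1 I2) I3) I4) I5)) => x.
by rewrite /flux; ring.
Qed.

Let mble_fluxx : mble fluxx. Proof. by case: prim_flux => -[]. Qed.

(** Read off from [nrjt], whose four terms are products of two square integrable factors. *)
Lemma intg_fluxx : intg setT fluxx.
Proof.
have : intg setT (fun x => - fluxx x).
  apply: (intg_ae_eq (f := nrjt)) => //; last exact: intg_nrjt.
    by apply: (mble_ext (mbleZ (-1) mble_fluxx)) => x; rewrite mulN1r.
  by apply: ae_impl energy_law => x ->.
move=> /(intg_opp (@measurableT _ mR)) I; apply: (intg_ext I) => x.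
by rewrite opprK.
Qed.

Let Rint_nrjt A : measurable (A : set mR) ->
  \int[mu]_(x in A) nrjt x = - \int[mu]_(x in A) fluxx x.
Proof.
move=> mA; have -> : - (\int[mu]_(x in A) fluxx x) = \int[mu]_(x in A) (-1 * fluxx x).
  by rewrite RintegralZl// ?mulN1r//; apply: intgT => //; exact: intg_fluxx.
apply: Rint_ae_eq => //.
- by apply: measT; case/integrableP: intg_nrjt => /measurable_EFinP.
- by apply: measT; exact: mbleZ.
- by apply: ae_impl energy_law => x -> _; rewrite mulN1r.
Qed.

Lemma Rint_nrjt_Nyc y : \int[mu]_(x in `]-oo, y]) nrjt x = - flux y.
Proof.
rewrite Rint_nrjt//; congr (- _); apply: prim_Nyc; last exact: intg_fluxx.
- by case: bnd_flux.
- exact: prim_flux.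
- exact: intg_flux.
Qed.

Lemma Rint_nrjt_T : \int[mu]_x nrjt x = 0.
Proof.
rewrite Rint_nrjt// (prim_intT _ prim_flux) ?oppr0//.
- by case: bnd_flux.
- exact: intg_flux.
- exact: intg_fluxx.
Qed.

Lemma L2_press : L2 press.
Proof.
have L1 := L2_bnd (bndM (bndZ (2 / 3 * al) (bndX 3 bh)) bux) Lux.
have L2' := L2_bnd (bndM (bndZ (1 / 4 * be * g) (bndX 2 bh)) bhx) Lhx.
have L3 := L2_bnd (bndZ (g / (2 * al)) (bndD bh (bnd_cst hbar))) LH.
have L4 := L2_bnd (bndZ (al / 3) (bndX 3 bh)) Lvx.
apply: (L2_ext (L2D (L2D (L2B L1 L2') L3) L4)) => x.
by rewrite /press /source_; ring.
Qed.

Variable N : R.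
Hypotheses (N1 : 1 <= N) (hN : forall x, N^-1 <= h x <= N)
  (hbar0 : 0 < hbar).

Let h0 x : 0 < h x.
Proof.
have /andP[+ _] := hN x; apply: lt_le_trans; rewrite invr_gt0.
exact: lt_le_trans ltr01 N1.
Qed.

Lemma nrj_ge0 x : 0 <= nrj x.
Proof.
have h' := ltW (h0 x); have g' := ltW g0; have b' := ltW be0; have a' := ltW al0.
by rewrite /nrj; nonneg.
Qed.

(** A common lower bound of [3 / (al h^3)], the factor of the pressure in [vx], and of [1 / h],
    which compares [h v^2] with [(h v)^2]. *)
Definition coercivity := Num.min (3 / (al * N ^+ 3)) N^-1.
(** The value [a + b + 1] that [sqr_bound] extracts from [W^2 <= a W + b]. Here [3 * N ^+ 3 / al]
    bounds [3 / (al h^3)] from above, and [g / (2 * al) * (N + hbar)] is the coefficient of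
    [|h - hbar|] in [source_bound]. *)
Definition press_bound (e : R) :=
  16 * (3 * N ^+ 3 / al) * e / coercivity
  + 4 * ((g / (2 * al) * (N + hbar)) ^+ 2 * (3 * N ^+ 3 / al) ^+ 2 * e
         / (coercivity * g)) / coercivity + 1.

Lemma sqr_bound (W a b : R) : 0 <= W -> 0 <= a -> 0 <= b ->
  W ^+ 2 <= a * W + b -> W <= a + b + 1.
Proof.
move=> W0 a0 b0 H; have [W1|W1] := leP W 1; first by lra.
rewrite leNgt; apply/negP => W2.
have : (a + b + 1) * W < W * W by rewrite ltr_pM2r//; lra.
have : b <= b * W by rewrite ler_peMr// ltW.
by move: H; rewrite expr2; nra.
Qed.

(** The factor 4 compares [2 / 3] with the [1 / 6] of the density. The part linear in [h - hbar] is
    kept apart: the density controls only its square, which is enough once it is multiplied by the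
    pressure. *)
Lemma source_bound x : `|source_ x - g / (2 * al) * hbar ^+ 2| <=
  4 * nrj x + g / (2 * al) * (N + hbar) * `|h x - hbar|.
Proof.
have h' := ltW (h0 x); have g' := ltW g0; have b' := ltW be0; have a' := ltW al0.
have n1 : 0 <= al * h x ^+ 3 * ux x ^+ 2 by nonneg.
have n2 : 0 <= be * g * h x ^+ 2 * hx x ^+ 2 by nonneg.
have n3 : 0 <= h x * u x ^+ 2 by nonneg.
have n4 : 0 <= g * (h x - hbar) ^+ 2 by nonneg.
have -> : source_ x - g / (2 * al) * hbar ^+ 2 =
  (2 / 3 * (al * h x ^+ 3 * ux x ^+ 2) - 1 / 4 * (be * g * h x ^+ 2 * hx x ^+ 2)) +
  g / (2 * al) * ((h x + hbar) * (h x - hbar)) by rewrite /source_; ring.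
apply: (le_trans (ler_normD _ _)); apply: lerD.
  have -> : nrj x = 1 / 2 * (h x * u x ^+ 2) + 1 / 6 * (al * h x ^+ 3 * ux x ^+ 2)
    + 1 / 2 * (g * (h x - hbar) ^+ 2) + 1 / 4 * (be * g * h x ^+ 2 * hx x ^+ 2).
    by rewrite /nrj; ring.
  by rewrite ler_norml; apply/andP; split; lra.
have k0 : 0 <= g / (2 * al) by rewrite divr_ge0// mulr_ge0.
rewrite normrM (ger0_norm k0) -mulrA ler_wpM2l// normrM ler_wpM2r//.
have /andP[_ ?] := hN x.
by rewrite ger0_norm ?addr_ge0 ?(ltW hbar0)// lerD2r.
Qed.

Let N0 : 0 < N. Proof. exact: lt_le_trans ltr01 N1. Qed.
Let m0 : 0 < coercivity.
Proof. by rewrite lt_min divr_gt0 ?mulr_gt0 ?exprn_gt0 ?invr_gt0 ?N0. Qed.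
Let K0 : 0 < 3 * N ^+ 3 / al.
Proof. by rewrite divr_gt0// mulr_gt0// exprn_gt0. Qed.

(* The integral of [(v w)' = v' w + h v^2] vanishes; writing [v'] as a positive
   multiple of [w - S] makes it coercive in [w] and [h v = w'], while [S] is
   dominated by the energy density and by [|h - hbar|]. *)
Lemma press_le x : `|press x| <= press_bound (\int[mu]_y nrj y).
Proof.
set e := \int[mu]_y nrj y.
have e0 : 0 <= e by apply: Rintegral_ge0 => y _; exact: nrj_ge0.
have Lp := L2_press; have Lhv := L2_bnd bh Lv.
pose I := n2 press + n2 (fun x => h x * v x).
have I0 : 0 <= I by rewrite addr_ge0 ?n2_ge0.
(* The Sobolev bound of the pressure. It also appears on the right of the estimate below, linearly
   against [W ^+ 2] on the left, so the estimate closes on itself. *)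
pose W := Num.sqrt (2 * I).
have W0 : 0 <= W by exact: sqrtr_ge0.
have W2 : W ^+ 2 = 2 * I by rewrite sqr_sqrtr// mulr_ge0.
have pW y : `|press y| <= W.
  by rewrite -sqrtr_sqr; apply: ler_wsqrtr; exact: prim_sup prim_press Lp Lhv.
apply: (le_trans (pW x)).
pose m := coercivity; pose K := 3 * N ^+ 3 / al; pose C := g / (2 * al) * (N + hbar).
have C0 : 0 <= C.
  apply: mulr_ge0; last by rewrite addr_ge0 ?(ltW hbar0) ?(ltW N0).
  by rewrite divr_ge0 ?(ltW g0)// mulr_ge0// ltW// al0.
have m0' : 0 < m := m0; have K0' : 0 < K := K0.
have mT := @measurableT _ mR.
have i1 : intg setT (fun y => vx y * press y + v y * (h y * v y)).
  by apply: intg_add => //; exact: L2_mul.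
have z1 : \int[mu]_y (vx y * press y + v y * (h y * v y)) = 0.
  apply: (prim_intT _ (primM pv prim_press) _ i1); last exact: L2_mul.
  by apply: mbleM; [case: Lv|case: Lp].
have i2 : intg setT (fun y => press y ^+ 2 + (h y * v y) ^+ 2).
  by apply: intg_add => //; [case: Lp|case: Lhv].
have i3 : intg setT (fun y => K * (4 * W + C ^+ 2 * K / (m * g)) * nrj y + m / 2 * press y ^+ 2).
  by apply: intg_add => //; apply: intg_scale => //; [exact: intg_nrj|case: Lp].
(* The subtracted expression integrates to zero by [z1], so the left-hand side is [m * I]; half of
   the square of the pressure on the right is absorbed afterwards. *)
have key : \int[mu]_y (m * (press y ^+ 2 + (h y * v y) ^+ 2) -
    (vx y * press y + v y * (h y * v y))) <=
  \int[mu]_y (K * (4 * W + C ^+ 2 * K / (m * g)) * nrj y + m / 2 * press y ^+ 2).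
  apply: le_Rintegral => //.
    by apply: intg_sub => //; exact: intg_scale.
  move=> y _.
  have hy := h0 y; have hi0 : 0 < (h y)^-1 by rewrite invr_gt0.
  pose S := source_ y - g / (2 * al) * hbar ^+ 2.
  pose a := 3 / (al * h y ^+ 3).
  have vxE : vx y = a * (press y - S).
    by rewrite /a /press /S; field; rewrite aln0 gt_eqF.
  have a0 : 0 < a by rewrite divr_gt0// mulr_gt0// ?al0// exprn_gt0.
  have am : m <= a.
    apply: (@le_trans _ _ (3 / (al * N ^+ 3))); first by rewrite ge_min lexx.
    rewrite ler_wpM2l// lef_pV2 ?posrE ?mulr_gt0 ?exprn_gt0 ?al0//.
    rewrite ler_wpM2l ?(ltW al0)// lerXn2r ?nnegrE ?(ltW hy) ?(ltW N0)//.
    by have /andP[_ ?] := hN y.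
  have mh : m * h y ^+ 2 <= h y.
    have : m <= (h y)^-1.
      apply: (@le_trans _ _ N^-1); first by rewrite ge_min lexx orbT.
      by rewrite lef_pV2 ?posrE//; have /andP[_ ?] := hN y.
    by move=> H; rewrite expr2 mulrA -{3}[h y]mul1r ler_wpM2r ?(ltW hy)// -ler_pdivlMr// mul1r.
  have aK : a <= K.
    have -> : a = 3 / al * (h y)^-1 ^+ 3 by rewrite /a; field; rewrite aln0 gt_eqF.
    have -> : K = 3 / al * N ^+ 3 by rewrite /K; field; rewrite aln0.
    rewrite ler_wpM2l ?divr_ge0 ?(ltW al0)//.
    rewrite lerXn2r ?nnegrE ?(ltW hi0) ?(ltW N0)// -[leRHS]invrK lef_pV2 ?posrE ?invr_gt0//.
    by have /andP[] := hN y.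
  have S1 : a * `|S * press y| <= K * (4 * W * nrj y) + K * (C * `|h y - hbar| * `|press y|).
    rewrite -mulrDr; apply: ler_pM => //; first exact: ltW.
    rewrite normrM; apply: (@le_trans _ _ ((4 * nrj y + C * `|h y - hbar|) * `|press y|)).
      by rewrite ler_wpM2r//; exact: source_bound.
    rewrite mulrDl lerD2r.
    have -> : 4 * W * nrj y = 4 * nrj y * W by ring.
    by rewrite ler_wpM2l// mulr_ge0// nrj_ge0.
  have H2 : g * (h y - hbar) ^+ 2 <= 2 * nrj y.
    have h' := ltW hy; have g' := ltW g0; have b' := ltW be0; have a' := ltW al0.
    have n1 : 0 <= al * h y ^+ 3 * ux y ^+ 2 by nonneg.
    have n2' : 0 <= be * g * h y ^+ 2 * hx y ^+ 2 by nonneg.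
    have n3 : 0 <= h y * u y ^+ 2 by nonneg.
    have -> : nrj y = 1 / 2 * (h y * u y ^+ 2) + 1 / 6 * (al * h y ^+ 3 * ux y ^+ 2)
      + 1 / 2 * (g * (h y - hbar) ^+ 2) + 1 / 4 * (be * g * h y ^+ 2 * hx y ^+ 2).
      by rewrite /nrj; ring.
    lra.
  have S2 : K * (C * `|h y - hbar| * `|press y|) <=
      m / 2 * press y ^+ 2 + K * (C ^+ 2 * K / (m * g)) * nrj y.
    (* AM-GM: [K C |H| |w| <= m/2 w^2 + K^2 C^2 / (2 m) H^2] *)
    have q : 0 <= (m * `|press y| - K * C * `|h y - hbar|) ^+ 2 by exact: sqr_ge0.
    have r : K * (C * `|h y - hbar| * `|press y|) <=
      m / 2 * press y ^+ 2 + K ^+ 2 * C ^+ 2 / (2 * m) * (h y - hbar) ^+ 2.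
      rewrite -[press y ^+ 2]real_normK ?num_real// -[(h y - hbar) ^+ 2]real_normK ?num_real//.
      rewrite -subr_ge0.
      have -> : m / 2 * `|press y| ^+ 2 + K ^+ 2 * C ^+ 2 / (2 * m) * `|h y - hbar| ^+ 2
        - K * (C * `|h y - hbar| * `|press y|) =
        (m * `|press y| - K * C * `|h y - hbar|) ^+ 2 / (2 * m).
        by field; rewrite gt_eqF.
      by rewrite divr_ge0// mulr_ge0// ltW.
    apply: (le_trans r); rewrite lerD2l.
    have -> : K ^+ 2 * C ^+ 2 / (2 * m) * (h y - hbar) ^+ 2 =
      K ^+ 2 * C ^+ 2 / (2 * m * g) * (g * (h y - hbar) ^+ 2).
      by field; rewrite !gt_eqF.
    have -> : K * (C ^+ 2 * K / (m * g)) * nrj y = K ^+ 2 * C ^+ 2 / (2 * m * g) * (2 * nrj y).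
      by field; rewrite !gt_eqF.
    by rewrite ler_wpM2l//; nonneg.
  have S3 : a * (S * press y) <= a * `|S * press y| by rewrite ler_wpM2l ?(ltW a0)// ler_norm.
  have S4 : m * press y ^+ 2 <= a * press y ^+ 2 by rewrite ler_wpM2r ?sqr_ge0.
  have S5 : m * (h y * v y) ^+ 2 <= h y * v y ^+ 2.
    by rewrite exprMn mulrA ler_wpM2r ?sqr_ge0.
  rewrite vxE.
  have -> : m * (press y ^+ 2 + (h y * v y) ^+ 2) -
    (a * (press y - S) * press y + v y * (h y * v y)) =
    (m * press y ^+ 2 - a * press y ^+ 2) + (m * (h y * v y) ^+ 2 - h y * v y ^+ 2) +
    a * (S * press y) by ring.
  have -> : K * (4 * W + C ^+ 2 * K / (m * g)) * nrj y =
    K * (4 * W * nrj y) + K * (C ^+ 2 * K / (m * g)) * nrj y by ring.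
  lra.
have : m * I <= K * (4 * W + C ^+ 2 * K / (m * g)) * e + m / 2 * n2 press.
  move: key; rewrite RintegralB//; last exact: intg_scale.
  rewrite z1 subr0 RintegralZl// RintegralD//; [|by case: Lp|by case: Lhv].
  rewrite -/(n2 press) -/(n2 (fun x => h x * v x)) -/I => /le_trans; apply.
  rewrite RintegralD//; last 2 first.
  - by apply: intg_scale => //; exact: intg_nrj.
  - by apply: intg_scale => //; case: Lp.
  by rewrite !RintegralZl//; [case: Lp|exact: intg_nrj].
have pI : n2 press <= I by rewrite lerDl n2_ge0.
have pI' : m / 2 * n2 press <= m / 2 * I by rewrite ler_wpM2l// divr_ge0// ltW.
move=> fin.
rewrite /press_bound -/m -/K -/C.
apply: sqr_bound => //.
- by nonneg.
- by nonneg.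
rewrite W2 -(ler_pM2l m0) -/m.
have -> : m * (16 * K * e / m * W + 4 * (C ^+ 2 * K ^+ 2 * e / (m * g)) / m) =
  4 * (K * (4 * W + C ^+ 2 * K / (m * g)) * e).
  by field; rewrite !gt_eqF.
lra.
Qed.
End FixedTime.

(** * Energy flux through a characteristic *)

Section CharacteristicFlux.
Variable R : realType.

(* [lambda E - D] is [al/6 h^3 c Q^2] plus the nonnegative part [Y] of [c E],
   minus [u Z]; the cross terms cancel because [be = 2/3 (al - 1)]. *)
Lemma flux_along (g be al hbar N W h u hx ux vx w : R) :
  0 < g -> 0 < be -> al = 1 + 3 / 2 * be -> 1 <= N -> N^-1 <= h <= N -> `|u| <= N ->
  `|w| <= W ->
  let kap := (al - 1) / al * g in
  let E := 1 / 2 * h * u ^+ 2 + 1 / 6 * al * h ^+ 3 * ux ^+ 2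
    + 1 / 2 * g * (h - hbar) ^+ 2 + 1 / 4 * be * g * h ^+ 2 * hx ^+ 2 in
  let D := 1 / 2 * h * u ^+ 3 + g * h * (h - hbar) * u
    + 5 / 6 * al * h ^+ 3 * u * ux ^+ 2
    + 1 / 2 * be * g * h ^+ 3 * ux * hx + al / 3 * h ^+ 3 * u * vx in
  w = (2 / 3 * al * h ^+ 3 * ux ^+ 2 - 1 / 4 * be * g * h ^+ 2 * hx ^+ 2
       + g / (2 * al) * h ^+ 2) - g / (2 * al) * hbar ^+ 2 + al / 3 * h ^+ 3 * vx ->
  let c0 := al / 6 * N^-1 ^+ 3 * Num.sqrt (kap * N^-1) in
  let A1 := N * (W + kap / 2 * (N ^+ 2 + hbar ^+ 2)) in
  c0 * (ux - Num.sqrt kap * (Num.sqrt h)^-1 * hx) ^+ 2 - A1 <= (u + Num.sqrt (kap * h)) * E - D /\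
  c0 * (ux + Num.sqrt kap * (Num.sqrt h)^-1 * hx) ^+ 2 - A1 <= D - (u - Num.sqrt (kap * h)) * E.
Proof.
move=> g0 be0 alE N1 /andP[hN1 hN2] uN wW kap E D wE c0 A1.
have N0 : 0 < N by lra.
have Ni : 0 < N^-1 by rewrite invr_gt0.
have h0 : 0 < h by lra.
have al1 : 0 < al - 1 by rewrite alE addrAC subrr add0r mulr_gt0// divr_gt0.
have al0 : 0 < al by lra.
have kap0 : 0 < kap by rewrite mulr_gt0// divr_gt0.
(* With [kap = k ^+ 2] and [h = r ^+ 2], and [g], [be] expressed through [al] and [k], the
   identities [E1] and [E2] become rational. *)
pose k := Num.sqrt kap; pose r := Num.sqrt h.
have k2 : kap = k ^+ 2 by rewrite sqr_sqrtr// ltW.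
have r2 : h = r ^+ 2 by rewrite sqr_sqrtr// ltW.
have k0 : 0 < k by rewrite sqrtr_gt0.
have r0 : 0 < r by rewrite sqrtr_gt0.
have cE : Num.sqrt (kap * h) = k * r by rewrite sqrtrM// ltW.
have gE : g = al * k ^+ 2 / (al - 1).
  by rewrite -k2 /kap; field; rewrite !gt_eqF.
have beE : be = 2 / 3 * (al - 1) by rewrite alE; field.
have c0le : c0 <= al / 6 * h ^+ 3 * (k * r).
  rewrite /c0 -cE; apply: ler_pM.
  - by nonneg.
  - exact: sqrtr_ge0.
  - rewrite ler_wpM2l ?divr_ge0 ?(ltW al0)// lerXn2r ?nnegrE ?(ltW h0) ?(ltW Ni)//.
  - by apply: ler_wsqrtr; rewrite ler_wpM2l// ltW.
pose Z := w + kap / 2 * (h ^+ 2 - hbar ^+ 2).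
pose Y := k * r * (1 / 2 * h * u ^+ 2 + 1 / 2 * g * (h - hbar) ^+ 2).
have Y0 : 0 <= Y.
  by rewrite /Y; nonneg.
have ZA : `|u * Z| <= A1.
  rewrite normrM; apply: ler_pM => //.
  apply: (le_trans (ler_normD _ _)); apply: lerD => //.
  have kk : 0 <= kap / 2 by rewrite divr_ge0// ltW.
  rewrite normrM (ger0_norm kk) ler_wpM2l//.
  have : h ^+ 2 <= N ^+ 2 by rewrite lerXn2r ?nnegrE ?(ltW h0) ?(ltW N0).
  have := sqr_ge0 h; have := sqr_ge0 hbar; rewrite ler_norml => ? ? ?.
  by apply/andP; split; lra.
have E1 : (u + Num.sqrt (kap * h)) * E - D =
  al / 6 * h ^+ 3 * (k * r) * (ux - k * r^-1 * hx) ^+ 2 + Y - u * Z.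
  rewrite cE /E /D /Y /Z wE k2 beE gE r2; field.
  by rewrite !gt_eqF.
have E2 : D - (u - Num.sqrt (kap * h)) * E =
  al / 6 * h ^+ 3 * (k * r) * (ux + k * r^-1 * hx) ^+ 2 + Y + u * Z.
  rewrite cE /E /D /Y /Z wE k2 beE gE r2; field.
  by rewrite !gt_eqF.
have X1 := ler_wpM2r (sqr_ge0 (ux - k * r^-1 * hx)) c0le.
have X2 := ler_wpM2r (sqr_ge0 (ux + k * r^-1 * hx)) c0le.
rewrite E1 E2 -/k -/r; move: ZA; rewrite ler_norml => /andP[? ?]; split; lra.
Qed.
End CharacteristicFlux.

(** * Paths in Sobolev spaces and moving boundaries *)

Section Paths.
Variable R : realType.
Local Notation mu := (@lebesgue_measure R).
Local Notation mR := (measurableTypeR R).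
Local Notation mble f := (@measurable_fun _ _ mR mR setT f).
Local Notation intg A f := (mu.-integrable A (EFin \o f)).
Implicit Types (J : set R).

Lemma near_within_self J (t : R) : \forall s \near within J (nbhs t), J s.
Proof. exact: withinT. Qed.

Lemma near_dwithin_self J (t : R) : \forall s \near within J t^', J s.
Proof. exact: withinT. Qed.

Lemma near_dwithin_neq J (t : R) : \forall s \near within J t^', s != t.
Proof.
have : \forall s \near t^', J s -> s != t.
  by near=> s => _; near: s; exact: nbhs_dnbhs_neq.
by [].
Unshelve. all: by end_near. Qed.

Lemma dwithin_sub J (t : R) : within J t^' `=>` within J (nbhs t).
Proof.
by move=> P H; exact: (@cvg_within _ (nbhs t) _ _ _ H).
Qed.

Lemma cvgL2_sub (F F' : set_system R) (fs : R -> R -> R) f : F' `=>` F ->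
  cvgL2 F fs f -> cvgL2 F' fs f.
Proof.
move=> FF' [H1 H2 H3]; split => //; first exact: FF'.
by move=> A /H3; exact: FF'.
Qed.

Lemma cvgU_sub (F F' : set_system R) (fs : R -> R -> R) f : F' `=>` F ->
  cvgU F fs f -> cvgU F' fs f.
Proof.
move=> FF' [H1 H2 H3 H4]; split => //; first exact: FF'.
by move=> e e0; apply: FF'; exact: H4.
Qed.

(** Explicit in [f] and [t], so that convergence in time can be stated. The first derivative is
    classical because continuous H^2 functions are C^1; the second is any weak derivative of it. *)
Definition d1 (f : R -> R -> R) t := derive1 (f t).
Definition d2 (f : R -> R -> R) t := wderiv (derive1 (f t)).

Lemma d1E f t : d1 f t = derive1 (f t).
Proof. by []. Qed.

Lemma path_rep (f : R -> R -> R) t : continuous (f t) -> sobolev 2 (f t) ->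
  [/\ prim (f t) (d1 f t), prim (d1 f t) (d2 f t), L2 (f t), L2 (d1 f t) & L2 (d2 f t)].
Proof.
move=> cf /(sobolev2_cont_rep cf)[G1 [G2 [p1 p2 L0 L1 L2']]].
have E1 : d1 f t = G1.
  apply/funext => x; exact: (proj2 (prim_derive1 p1 (prim_cont p2) x)).
have [ae mm] := wderiv_ae (proj1 L1) (ae_forall (fun x => erefl)) p2.
have ae' : {ae mu, forall x, G2 x = wderiv G1 x} by apply: ae_impl ae.
rewrite /d2 -/(d1 f t) E1; split => //.
- exact: prim_ae p2 mm ae'.
- by case: (L2_ae L2' mm ae').
Qed.

(** Uniform convergence of [d1 f] consumes the top order: through [prim_cvgU] it relies on the L^2
    convergence of the second derivatives. *)
Lemma path_C0 J (f : R -> R -> R) t : (forall s, J s -> continuous (f s)) ->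
  C0_sobolev J 2 f -> J t ->
  [/\ cvgL2 (within J (nbhs t)) f (f t), cvgL2 (within J (nbhs t)) (d1 f) (d1 f t),
      cvgU (within J (nbhs t)) f (f t) & cvgU (within J (nbhs t)) (d1 f) (d1 f t)].
Proof.
move=> cf C0 Jt; have [St cv] := C0 t Jt.
have rep s : J s -> [/\ prim (f s) (d1 f s), prim (d1 f s) (d2 f s), L2 (f s), L2 (d1 f s) & L2 (d2 f s)].
  by move=> Js; apply: path_rep; [exact: cf|case: (C0 s Js)].
have [p1 p2 L0 L1 L2'] := rep t Jt.
have W s : J s -> {ae mu, forall x, wderiv (fun x => f s x - f t x) x = d1 f s x - d1 f t x} /\
    mble (wderiv (fun x => f s x - f t x)).
  move=> /rep[q1 q2 M0 M1 M2]; apply: wderiv_ae; last exact: primB q1 p1.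
    by case: (L2B M0 L0).
  exact: ae_forall.
have nJ := near_within_self J t.
have FF : Filter (within J (nbhs t)) by exact: within_nbhs_filter || exact: _.
have A0 : cvgL2 (within J (nbhs t)) f (f t).
  split => //; first by apply: filterS nJ => s /rep[].
  apply: (@sobolev_cvg _ _ _ 2 0 (fun s x => f s x - f t x)) cv _ => //.
  apply: filterS nJ => s /rep[q1 q2 M0 M1 M2]; split; first exact: L2B.
  by split => /=; [exact: ae_forall|case: (L2B M0 L0)].
have A1 : cvgL2 (within J (nbhs t)) (d1 f) (d1 f t).
  split => //; first by apply: filterS nJ => s /rep[].
  apply: (@sobolev_cvg _ _ _ 2 1 (fun s x => f s x - f t x)) cv _ => //.
  apply: filterS nJ => s Js; have [q1 q2 M0 M1 M2] := rep s Js.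
  by split; [exact: L2B|exact: W].
have A2 : cvgL2 (within J (nbhs t)) (d2 f) (d2 f t).
  split => //; first by apply: filterS nJ => s /rep[].
  apply: (@sobolev_cvg _ _ _ 2 2 (fun s x => f s x - f t x)) cv _ => //.
  apply: filterS nJ => s Js; have [q1 q2 M0 M1 M2] := rep s Js.
  split; first exact: L2B.
  have [ae mm] := W s Js.
  exact: wderiv_ae mm ae (primB q2 p2).
split => //.
- by apply: (prim_cvgU FF _ _ A0 A1) => //; apply: filterS nJ => s /rep[].
- by apply: (prim_cvgU FF _ _ A1 A2) => //; apply: filterS nJ => s /rep[].
Qed.

(** The time derivative [ft t] is an abstract element of H^1. The system identifies it almost
    everywhere with an explicit [K], and the quotients of [d1 f] then converge to the derivative
    [K1]. *)
Lemma path_C1 J (f ft : R -> R -> R) t (K K1 : R -> R) :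
  (forall s, J s -> continuous (f s)) -> C0_sobolev J 2 f ->
  C1_sobolev J 1 f ft -> J t ->
  prim K K1 -> L2 K -> L2 K1 -> {ae mu, forall x, ft t x = K x} ->
  cvgL2 (within J t^') (fun s x => (f s x - f t x) / (s - t)) K /\
  cvgL2 (within J t^') (fun s x => (d1 f s x - d1 f t x) / (s - t)) K1.
Proof.
move=> cf C0 [C0t /(_ t) cv] Jt pK LK LK1 ftK; have {}cv := cv Jt.
have [[Lft _] _] := C0t t Jt; have {}Lft := Lfun_L2 Lft.
have rep s : J s -> [/\ prim (f s) (d1 f s), prim (d1 f s) (d2 f s), L2 (f s), L2 (d1 f s) & L2 (d2 f s)].
  by move=> Js; apply: path_rep; [exact: cf|case: (C0 s Js)].
have [p1 p2 L0 L1 _] := rep t Jt.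
have nJ := near_dwithin_self J t.
have FF : Filter (within J t^') by exact: _.
have LD k l s : L2 k -> L2 l -> L2 (fun x => (k x - l x) / (s - t)).
  by move=> Lk Ll; apply: (L2_ext (L2Z (s - t)^-1 (L2B Lk Ll))) => x; rewrite mulrC.
have aeK s : {ae mu, forall x, (f s x - f t x) / (s - t) - ft t x =
                    (f s x - f t x) / (s - t) - K x}.
  by apply: ae_impl ftK => x ->.
split.
  split => //; first by apply: filterS nJ => s /rep[? ? ? ? ?]; exact: LD.
  apply: (@sobolev_cvg _ _ _ 1 0 (fun s x => (f s x - f t x) / (s - t) - ft t x)) cv _ => //.
  apply: filterS nJ => s /rep[q1 q2 M0 M1 M2]; split; first by apply: L2B => //; exact: LD.
  by split => //=; case: (L2B (LD _ _ s M0 L0) Lft).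
split => //; first by apply: filterS nJ => s /rep[? ? ? ? ?]; exact: LD.
apply: (@sobolev_cvg _ _ _ 1 1 (fun s x => (f s x - f t x) / (s - t) - ft t x)) cv _ => //.
apply: filterS nJ => s /rep[q1 q2 M0 M1 M2]; split; first by apply: L2B => //; exact: LD.
apply: wderiv_ae (aeK s) _; first by case: (L2B (LD _ _ s M0 L0) Lft).
apply: primB => //.
by apply: (prim_ext (primZ (s - t)^-1 (primB q1 p1))) => x; rewrite mulrC.
Qed.

(** Nothing is asked of [d] beyond [d <= G], so the increment of [phi] is compared with the integral
    of [G] near each point and the comparison is globalized by [local_to_global_le0]. *)
Lemma diff_quotient_ineq J (phi d G : R -> R) (a b : R) : a <= b ->
  (forall x, a <= x <= b -> J x) ->
  (forall x, a <= x <= b ->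
     (phi s - phi x) / (s - x) @[s --> within J x^'] --> d x) ->
  (forall x, a <= x <= b -> d x <= G x) ->
  {within `[a, b], continuous G} ->
  phi b - phi a <= \int[mu]_(x in `[a, b]) G x.
Proof.
move=> ab abJ cv dG cG.
have iG : intg `[a, b] G.
  by apply: continuous_compact_integrable => //; exact: segment_compact.
have iGs p q : a <= p -> q <= b -> intg `[p, q] G.
  by move=> ap qb; apply: integrableS iG => //; apply: subset_itv; rewrite bnd_simp.
rewrite -subr_le0; apply: (@le0_eps _ _ (b - a)) => e e0; rewrite -subr_le0.
apply: (@local_to_global_le0 R (fun p q =>
  phi q - phi p - \int[mu]_(x in `[p, q]) G x - e * (q - p)) a b) => //.
  move=> p q r ap pq qr rb; rewrite (Rint_split pq qr (iGs _ _ ap rb)).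
  by rewrite le_eqVlt; apply/orP; left; apply/eqP; ring.
(* Half of [e] pays for the difference quotients of [phi] on both sides of [x], half for the
   oscillation of [G]. *)
move=> x axb; have e2 : 0 < e / 2 by lra.
have /andP[ax xb] := axb.
have [r1 /= r10 H1] : nbhs x (fun s => s != x -> J s -> `|d x - (phi s - phi x) / (s - x)| < e / 2).
  by have /cvgrPdist_lt/(_ _ e2) := cv x axb.
have [r2 /= r20 H2] : nbhs x (fun y => a <= y <= b -> `|G x - G y| < e / 2).
  have /subspace_continuousP/(_ x) := cG.
  rewrite /= in_itv/= => /(_ axb)/cvgrPdist_lt/(_ _ e2).
  move=> H; have {H} : nbhs x (fun y => `[a, b]%classic y -> `|G x - G y| < e / 2).
    exact: H.
  by apply: filterS => y H yab; apply: H; rewrite /= in_itv.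
exists (Num.min r1 r2); first by rewrite lt_min r10.
move=> p q ap px xq qb; rewrite lt_min => /andP[pq1 pq2].
have pq := le_trans px xq.
have key s : p <= s <= q -> s != x -> `|d x - (phi s - phi x) / (s - x)| < e / 2.
  move=> /andP[ps sq] sx; apply: H1 => //.
    by rewrite /ball_/= ltr_norml; apply/andP; split; lra.
  by apply: abJ; apply/andP; split; lra.
have R1 : phi q - phi x <= (d x + e / 2) * (q - x).
  have [->|qx] := eqVneq q x; first by rewrite !subrr mulr0.
  have qx0 : 0 < q - x by rewrite subr_gt0 lt_neqAle eq_sym qx.
  rewrite -ler_pdivrMr//; have := key q _ qx; rewrite pq lexx => /(_ isT).
  by rewrite ltr_norml => /andP[? ?]; lra.
have R2 : phi x - phi p <= (d x + e / 2) * (x - p).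
  have [->|pnx] := eqVneq p x; first by rewrite !subrr mulr0.
  have xp0 : 0 < x - p by rewrite subr_gt0 lt_neqAle pnx.
  rewrite -ler_pdivrMr//; have := key p _ pnx; rewrite pq lexx => /(_ isT).
  have -> : (phi p - phi x) / (p - x) = (phi x - phi p) / (x - p).
    by field; rewrite !subr_eq0 pnx eq_sym pnx.
  by rewrite ltr_norml => /andP[? ?]; lra.
have R3 : (G x - e / 2) * (q - p) <= \int[mu]_(y in `[p, q]) G y.
  rewrite -Rint_cst//; apply: le_Rintegral => //; first exact: intg_cst.
    exact: iGs.
  move=> y; rewrite /= in_itv/= => /andP[py yq].
  have : `|G x - G y| < e / 2.
    apply: H2; last by apply/andP; split; lra.
    by rewrite /ball_/= ltr_norml; apply/andP; split; lra.
  by rewrite ltr_norml => /andP[? ?]; lra.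
have R4 : d x * (q - p) <= G x * (q - p).
  by rewrite ler_wpM2r ?dG// subr_ge0.
lra.
Qed.

Lemma diff_quotient_cst J (phi : R -> R) (a b : R) : a <= b ->
  (forall x, a <= x <= b -> J x) ->
  (forall x, a <= x <= b ->
     (phi s - phi x) / (s - x) @[s --> within J x^'] --> (0 : R)) ->
  phi b = phi a.
Proof.
move=> ab abJ cv.
have I0 : \int[mu]_(x in `[a, b]) (0 : R) = 0 by rewrite Rint_cst// mul0r.
have c0 : {within `[a, b], continuous (cst 0 : R -> R)}.
  by apply: continuous_subspaceT => x; exact: cvg_cst.
have H1 := @diff_quotient_ineq J phi (cst 0) (cst 0) a b ab abJ cv (fun _ _ => lexx _) c0.
have cv' x : a <= x <= b -> ((- phi s) - (- phi x)) / (s - x) @[s --> within J x^'] --> (cst 0 : R -> R) x.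
  move=> /cv H; have FF : Filter (within J x^') by exact: _.
  have := cvgN H => /(_ FF); rewrite oppr0.
  apply: cvg_trans; apply: near_eq_cvg; apply: nearW => s /=.
  by rewrite -mulNr opprB opprK addrC.
have H2 := @diff_quotient_ineq J (fun s => - phi s) (cst 0) (cst 0) a b ab abJ cv' (fun _ _ => lexx _) c0.
move: H1 H2; rewrite /= I0; lra.
Qed.

Lemma prim_Phi (e : R -> R) : mble e -> intg setT e ->
  prim (fun y => \int[mu]_(x in `]-oo, y]) e x) e.
Proof.
move=> me ie; split; first by split => // a b; exact: intgT.
move=> a b ab; have := @Rintegral_itvB R e -oo%O (BRight b) a.
rewrite !bnd_simp => /(_ (intgT _ ie)) H; have {H} -> := H ltac:(by []) ltac:(by []) ab.
by rewrite Rintegral_itv_obnd_cbnd//; exact: intgT.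
Qed.

Lemma prim_mean (f e : R -> R) (c k y0 y : R) : prim f e ->
  (forall x, `|x - y0| <= `|y - y0| -> `|e x - c| <= k) ->
  `|f y - f y0 - c * (y - y0)| <= k * `|y - y0|.
Proof.
move=> pf H.
have B p q : p <= q -> (forall x, p <= x <= q -> `|e x - c| <= k) ->
   `|f q - f p - c * (q - p)| <= k * (q - p).
  move=> pq K; rewrite pf.2// -Rint_cst// -RintegralB//; [|exact: pf.1.2|exact: intg_cst].
  have i1 : intg `[p, q] (fun x => e x - c).
    by apply: intg_sub => //; [exact: pf.1.2|exact: intg_cst].
  apply: (le_trans (le_normr_Rintegral _ i1)) => //.
  rewrite -Rint_cst//; apply: le_Rintegral => //; [exact: intg_norm|exact: intg_cst].
have [yy|yy] := leP y0 y.
  rewrite [`|y - y0|]ger0_norm ?subr_ge0//; apply: B => // x /andP[x1 x2]; apply: H.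
  by rewrite !ger0_norm ?subr_ge0// lerD2r.
rewrite [`|y - y0|]ltr0_norm ?subr_lt0// opprB -normrN.
have -> : - (f y - f y0 - c * (y - y0)) = f y0 - f y - c * (y0 - y) by ring.
apply: B; first exact: ltW.
move=> x /andP[x1 x2]; apply: H.
by rewrite distrC ger0_norm ?subr_ge0// distrC ger0_norm ?subr_ge0 ?(ltW yy)// lerD2l lerN2.
Qed.

Lemma diff_quotient_cvg J (Y : R -> R) (t Y' : R) :
  (Y s - Y t) / (s - t) @[s --> within J t^'] --> Y' ->
  Y s @[s --> within J (nbhs t)] --> Y t.
Proof.
move=> cv; apply/cvgrPdist_lt => e e0.
have FF : Filter (within J t^') by exact: _.
have /cvgrPdist_lt/(_ _ ltr01) n1 := cv.
pose K := `|Y'| + 1; have K0 : 0 < K by rewrite ltr_wpDl.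
have eK : 0 < e / K by rewrite divr_gt0.
have n1' : nbhs t (fun s => s != t -> J s -> `|Y' - (Y s - Y t) / (s - t)| < 1) by [].
suff : nbhs t (fun s => J s -> `|Y t - Y s| < e) by [].
near=> s => Js; have [->|st] := eqVneq s t; first by rewrite subrr normr0.
have st0 : `|s - t| > 0 by rewrite normr_gt0 subr_eq0.
have D : `|Y' - (Y s - Y t) / (s - t)| < 1.
  by move: Js; move: st; near: s.
have D2 : `|(Y s - Y t) / (s - t)| <= K.
  rewrite -(subrK Y' ((Y s - Y t) / (s - t))) (le_trans (ler_normD _ _))//.
  by rewrite addrC lerD2l distrC ltW.
rewrite distrC -(divfK (_ : s - t != 0) (Y s - Y t)) ?subr_eq0// normrM.
apply: (@le_lt_trans _ _ (K * `|s - t|)); first by rewrite ler_wpM2r.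
by rewrite mulrC -ltr_pdivlMr.
Unshelve. all: by end_near. Qed.

(** The increment is split at the old end point [Y t]; the remaining piece is the integral of [E s]
    between [Y t] and [Y s], where [E s] is uniformly close to [E t (Y t)]. *)
Lemma moving_boundary J (E : R -> R -> R) (Y : R -> R) (t Y' L : R) :
  (\forall s \near within J t^', mble (E s) /\ intg setT (E s)) ->
  cvgU (within J (nbhs t)) E (E t) -> continuous (E t) ->
  (Y s - Y t) / (s - t) @[s --> within J t^'] --> Y' ->
  (\int[mu]_(x in `]-oo, Y t]) E s x - \int[mu]_(x in `]-oo, Y t]) E t x) / (s - t)
    @[s --> within J t^'] --> L ->
  (\int[mu]_(x in `]-oo, Y s]) E s x - \int[mu]_(x in `]-oo, Y t]) E t x) / (s - t)
    @[s --> within J t^'] --> L + E t (Y t) * Y'.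
Proof.
move=> nE UE cE cY cL.
have FF : Filter (within J t^') by exact: _.
have YY : Y s @[s --> within J t^'] --> Y t.
  by move=> A /(diff_quotient_cvg cY); exact: dwithin_sub.
have [_ _ _ UE'] := cvgU_sub (@dwithin_sub J t) UE.
have nt := near_dwithin_neq J t.
set c := E t (Y t).
pose err s := (\int[mu]_(x in `]-oo, Y s]) E s x - \int[mu]_(x in `]-oo, Y t]) E s x
   - c * (Y s - Y t)) / (s - t).
have err0 : err s @[s --> within J t^'] --> (0 : R).
  apply/cvgr0Pnorm_le => e e0.
  (* [K] eventually bounds the difference quotient of [Y]. The two errors [e / K / 2] are the
     distance from [E s] to [E t] and the oscillation of [E t] near [Y t]. *)
  pose K := `|Y'| + 1; have K0 : 0 < K by rewrite ltr_wpDl.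
  have k0 : 0 < e / K / 2 by rewrite !divr_gt0.
  have /cvgrPdist_lt/(_ _ k0)[r /= r0 Hr] := cE (Y t).
  have nY := (@cvgrPdist_lt _ _ _ _ FF _ _).1 YY r r0.
  have nq := (@cvgrPdist_lt _ _ _ _ FF _ _).1 cY 1 ltr01.
  near=> s.
  have [ms i_s] : mble (E s) /\ intg setT (E s) by near: s.
  have st : s != t by near: s.
  have U : forall x, `|E s x - E t x| <= e / K / 2 by near: s; exact: UE'.
  have Yr : `|Y t - Y s| < r by near: s.
  have q1 : `|Y' - (Y s - Y t) / (s - t)| < 1 by near: s.
  rewrite /err normrM.
  have M := @prim_mean _ _ c (e / K) (Y t) (Y s) (prim_Phi ms i_s) _.
  apply: (@le_trans _ _ (e / K * `|Y s - Y t| * `|(s - t)^-1|)).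
    rewrite ler_wpM2r//; apply: M => x xY.
    have -> : E s x - c = (E s x - E t x) + (E t x - E t (Y t)) by rewrite /c; ring.
    rewrite (le_trans (ler_normD _ _))// [leRHS](splitr (e / K)) lerD//.
    rewrite distrC; apply/ltW/Hr => /=.
    by rewrite distrC; apply: le_lt_trans xY _; rewrite distrC.
  rewrite -mulrA -normrM.
  have D2 : `|(Y s - Y t) / (s - t)| <= K.
    rewrite -(subrK Y' ((Y s - Y t) / (s - t))) (le_trans (ler_normD _ _))//.
    by rewrite addrC lerD2l distrC ltW.
  apply: (@le_trans _ _ (e / K * K)); first by rewrite ler_wpM2l// ltW// divr_gt0.
  by rewrite divfK// gt_eqF.
have S : (\int[mu]_(x in `]-oo, Y t]) E s x - \int[mu]_(x in `]-oo, Y t]) E t x) / (s - t)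
   + (c * ((Y s - Y t) / (s - t)) + err s) @[s --> within J t^'] --> L + (c * Y' + 0).
  by apply: cvgD => //; apply: cvgD => //; apply: cvgM => //; exact: cvg_cst.
rewrite addr0 in S; apply: cvg_trans S; apply: near_eq_cvg; near=> s.
have st : s - t != 0 by rewrite subr_eq0; near: s.
by rewrite /err; field.
Unshelve. all: by end_near. Qed.

Lemma cvgU_along (F : set_system R) (FF : Filter F) (fs : R -> R -> R) f (X : R -> R) x0 :
  cvgU F fs f -> continuous f -> X s @[s --> F] --> x0 -> fs s (X s) @[s --> F] --> f x0.
Proof.
move=> [_ _ _ U] cf cX; apply/cvgrPdist_le => e e0; have e2 : 0 < e / 2 by lra.
have cfX : f (X s) @[s --> F] --> f x0 by apply: (cvg_comp _ _ cX); exact: cf.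
have n1 := (@cvgrPdist_lt _ _ _ _ FF _ _).1 cfX _ e2.
near=> s.
have H1 : `|f x0 - f (X s)| < e / 2 by near: s.
have H2 : forall x, `|fs s x - f x| <= e / 2 by near: s; exact: U.
have -> : f x0 - fs s (X s) = (f x0 - f (X s)) - (fs s (X s) - f (X s)) by ring.
rewrite (le_trans (ler_normB _ _))// [e]splitr lerD//; exact: ltW.
Unshelve. all: by end_near. Qed.

End Paths.

(** * Essential bounds and derivatives of quadratic integrals *)

Section EssNorm.
Variable R : realType.
Local Notation mu := (@lebesgue_measure R).
Local Notation mR := (measurableTypeR R).

(** An essential supremum holds outside a null set, which cannot contain a box of positive area. *)
Lemma ess_norm_box (t N : R) (F : R * R -> R) (a b c d : R) :
  0 <= a -> a < b -> b <= t -> c < d -> ess_norm `[0, t] F = N%:E ->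
  ~ (forall s y, a <= s <= b -> c <= y <= d -> N < `|F (s, y)|).
Proof.
move=> a0 ab bt cd nF H.
pose B : set (mR * mR) := (`[a, b]%classic : set mR) `*` (`[c, d]%classic : set mR).
have mB : measurable B by exact: measurableX.
have muB : (mu \x mu)%E B = ((b - a) * (d - c))%:E.
  rewrite product_measure1E//= !lebesgue_measure_itv/= !lte_fin ab cd.
  by rewrite -!EFinB -EFinM.
have B0 : (0 < (mu \x mu)%E B)%E.
  by rewrite muB lte_fin mulr_gt0// subr_gt0.
(* The norm of exponent [+oo] is an essential supremum only when the whole space has positive
   measure. *)
have T0 : (0 < (mu \x mu)%E setT)%E.
  apply: (lt_le_trans B0); apply: le_measure; rewrite ?inE//.
move: nF; rewrite /ess_norm unlock T0 => nF.
have [Z [mZ Z0 sub]] := @ess_sup_ge _ _ R (mu \x mu)%E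
  (abse \o ((EFin \o F) \_ (`[0, t]%classic `*` setT))).
have BZ : B `<=` Z.
  move=> [s y] [/= ]; rewrite !in_itv/= => Bs By; apply: sub => /=.
  rewrite nF patchE mem_set; last first.
    split => //=; rewrite in_itv/=; case/andP: Bs => ? ?.
    by apply/andP; split; [exact: (le_trans a0)|exact: (le_trans _ bt)].
  by apply/negP; rewrite -ltNge /= lte_fin; exact: H.
have : ((mu \x mu)%E B <= (mu \x mu)%E Z)%E by apply: le_measure; rewrite ?inE.
by rewrite Z0 leNgt B0.
Qed.

(** The neighbourhood is cut down to times in [[0, t]]; [0 < t] keeps its duration positive even
    when [tau] is an end point. *)
Lemma ess_norm_le (t N : R) (F : R * R -> R) (tau x : R) :
  0 < t -> 0 <= tau <= t -> ess_norm `[0, t] F = N%:E ->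
  ~ (exists2 d, 0 < d & forall s y, 0 <= s <= t -> `|tau - s| < d -> `|x - y| < d ->
      N < `|F (s, y)|).
Proof.
move=> t0 /andP[tau0 taut] nF [d d0 H].
have d2 : 0 < d / 2 by lra.
pose a := Num.max 0 (tau - d / 2); pose b := Num.min t (tau + d / 2).
have a0 : 0 <= a by rewrite le_max lexx.
have a1 : tau - d / 2 <= a by rewrite le_max lexx orbT.
have bt : b <= t by rewrite ge_min lexx.
have b1 : b <= tau + d / 2 by rewrite ge_min lexx orbT.
have ab : a < b.
  rewrite gt_max !lt_min; apply/andP; split; apply/andP; split; lra.
apply: (@ess_norm_box t N F a b (x - d / 2) (x + d / 2)) => //; first by lra.
clearbody a b.
move=> s y /andP[? ?] /andP[? ?]; apply: H.
- by apply/andP; split; lra.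
- by rewrite ltr_norml; apply/andP; split; lra.
- by rewrite ltr_norml; apply/andP; split; lra.
Qed.

(** Joint continuity lets a strict violation of a bound at one point persist on a box, where
    [ess_norm_le] excludes it. *)
Lemma cvgU_joint (J : set R) (f : R -> R -> R) (t x e : R) :
  cvgU (within J (nbhs t)) f (f t) -> continuous (f t) -> 0 < e ->
  exists2 d, 0 < d & forall s y, J s -> `|t - s| < d -> `|x - y| < d ->
     `|f t x - f s y| < e.
Proof.
move=> [_ _ _ U] cf e0; have e2 : 0 < e / 2 by lra.
have [d1 /= d10 H1] : nbhs t (fun s => J s -> forall x, `|f s x - f t x| <= e / 2).
  exact: (U _ e2).
have /cvgrPdist_lt/(_ _ e2)[d2 /= d20 H2] := cf x.
exists (Num.min d1 d2); first by rewrite lt_min d10.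
move=> s y Js; rewrite !lt_min => /andP[td _] /andP[_ xd].
have E1 := H1 s td Js y; have E2 := H2 y xd.
have -> : f t x - f s y = (f t x - f t y) - (f s y - f t y) by ring.
by rewrite (le_lt_trans (ler_normB _ _))// [e]splitr ltr_leD.
Qed.

End EssNorm.

(** * Time derivatives of quadratic integrals *)

Section QuadraticDerivative.
Variable R : realType.
Local Notation mu := (@lebesgue_measure R).
Local Notation mR := (measurableTypeR R).
Local Notation intg A f := (mu.-integrable A (EFin \o f)).
Variables (F : set_system R) (FF : Filter F).

Lemma cvgL2Z (fs : R -> R -> R) f (k : R) :
  cvgL2 F fs f -> cvgL2 F (fun s x => k * fs s x) (fun x => k * f x).
Proof.
move=> C; apply: (cvgL2_mulU FF (fs := fun _ _ => k) (f := fun=> k)) => //.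
by apply: cvgU_cst; [exact: measurable_cst|exists `|k|].
Qed.

(** One product for each of [u], [u_x], [h_x] and [h]. Each pairs two L^2 convergent factors, so the
    integrals converge without any pointwise derivative in time. *)
Lemma cvg_quotient_integral (A : set mR) (E : R -> R -> R) (E0 : R -> R) (q : R -> R)
    (a1 a2 a3 a4 p1 p2 p3 p4 : R -> R -> R) (b1 b2 b3 b4 r1 r2 r3 r4 : R -> R) :
  measurable A ->
  cvgL2 F a1 b1 -> cvgL2 F a2 b2 -> cvgL2 F a3 b3 -> cvgL2 F a4 b4 ->
  cvgL2 F p1 r1 -> cvgL2 F p2 r2 -> cvgL2 F p3 r3 -> cvgL2 F p4 r4 ->
  (\forall s \near F, intg setT (E s)) -> intg setT E0 ->
  (\forall s \near F, forall x, (E s x - E0 x) / q s =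
     a1 s x * p1 s x + a2 s x * p2 s x + a3 s x * p3 s x + a4 s x * p4 s x) ->
  (\int[mu]_(x in A) E s x - \int[mu]_(x in A) E0 x) / q s @[s --> F] -->
  \int[mu]_(x in A) (b1 x * r1 x + b2 x * r2 x + b3 x * r3 x + b4 x * r4 x).
Proof.
move=> mA A1 A2 A3 A4 P1 P2 P3 P4 iE iE0 Eq.
have S := cvgD (cvgD (cvgD (cvgL2_integral FF mA A1 P1) (cvgL2_integral FF mA A2 P2))
  (cvgL2_integral FF mA A3 P3)) (cvgL2_integral FF mA A4 P4).
move: A1 A2 A3 A4 P1 P2 P3 P4 => [n1 B1 _] [n2 B2 _] [n3 B3 _] [n4 B4 _].
move=> [m1 C1 _] [m2 C2 _] [m3 C3 _] [m4 C4 _].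
have sum (f1 f2 f3 f4 g1 g2 g3 g4 : R -> R) : L2 f1 -> L2 f2 -> L2 f3 -> L2 f4 ->
  L2 g1 -> L2 g2 -> L2 g3 -> L2 g4 ->
  \int[mu]_(x in A) (f1 x * g1 x) + \int[mu]_(x in A) (f2 x * g2 x) +
  \int[mu]_(x in A) (f3 x * g3 x) + \int[mu]_(x in A) (f4 x * g4 x) =
  \int[mu]_(x in A) (f1 x * g1 x + f2 x * g2 x + f3 x * g3 x + f4 x * g4 x).
  move=> F1 F2 F3 F4 G1 G2 G3 G4.
  have I1 := intgT mA (L2_mul F1 G1); have I2 := intgT mA (L2_mul F2 G2).
  have I3 := intgT mA (L2_mul F3 G3); have I4 := intgT mA (L2_mul F4 G4).
  rewrite -(RintegralD mA I1 I2) -(RintegralD mA (intg_add mA I1 I2) I3).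
  by rewrite -(RintegralD mA (intg_add mA (intg_add mA I1 I2) I3) I4).
have {}S := S FF FF FF.
rewrite -sum//; apply: cvg_trans S; apply: near_eq_cvg; near=> s.
have L1 : L2 (a1 s) by near: s. have L2' : L2 (a2 s) by near: s.
have L3 : L2 (a3 s) by near: s. have L4 : L2 (a4 s) by near: s.
have M1 : L2 (p1 s) by near: s. have M2 : L2 (p2 s) by near: s.
have M3 : L2 (p3 s) by near: s. have M4 : L2 (p4 s) by near: s.
have is_ : intg setT (E s) by near: s.
have es : forall x, (E s x - E0 x) / q s =
  a1 s x * p1 s x + a2 s x * p2 s x + a3 s x * p3 s x + a4 s x * p4 s x by near: s.
have -> : (\int[mu]_(x in A) E s x - \int[mu]_(x in A) E0 x) / q s =
  \int[mu]_(x in A) ((E s x - E0 x) / q s).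
  rewrite RintegralZr//; last by apply: intg_sub => //; exact: intgT.
  by rewrite RintegralB//; exact: intgT.
have -> : \int[mu]_(x in A) ((E s x - E0 x) / q s) = \int[mu]_(x in A)
  (a1 s x * p1 s x + a2 s x * p2 s x + a3 s x * p3 s x + a4 s x * p4 s x).
  by apply: eq_Rintegral => x _; rewrite es.
by rewrite -sum.
Unshelve. all: by end_near. Qed.
End QuadraticDerivative.

Section EnergyAlgebra.
Variable R : realType.
Implicit Types (g be al hbar h u p q : R).

(* In each product on the right, the first factor converges in L^2 and the
   second one is the difference quotient of a single unknown. *)
Lemma energy_quotient g be al hbar h u p q (h' u' p' q' d : R) : d != 0 ->
  (1 / 2 * h * u ^+ 2 + 1 / 6 * al * h ^+ 3 * q ^+ 2
   + 1 / 2 * g * (h - hbar) ^+ 2 + 1 / 4 * be * g * h ^+ 2 * p ^+ 2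
   - (1 / 2 * h' * u' ^+ 2 + 1 / 6 * al * h' ^+ 3 * q' ^+ 2
   + 1 / 2 * g * (h' - hbar) ^+ 2 + 1 / 4 * be * g * h' ^+ 2 * p' ^+ 2)) / d =
  h * (1 / 2 * (u + u')) * ((u - u') / d) +
  1 / 6 * al * (h * (h * h)) * (q + q') * ((q - q') / d) +
  1 / 4 * be * g * (h * h) * (p + p') * ((p - p') / d) +
  (1 / 2 * u' * u' + 1 / 6 * al * ((h * h + (h * h' + h' * h')) * q') * q' +
   1 / 2 * g * (h - hbar + (h' - hbar)) +
   1 / 4 * be * g * ((h + h') * p') * p') * ((h - hbar - (h' - hbar)) / d).
Proof. by move=> d0; field. Qed.

(** The right-hand side is that of [energy_quotient] with both times merged, so the limit found term
    by term is [nrjt]. *)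
Lemma energy_derivative g be al hbar h u p q (h' p' u' q' : R) :
  (h * u) * u' + (1 / 3 * al * h ^+ 3 * q) * q'
  + (1 / 2 * be * g * h ^+ 2 * p) * p'
  + (1 / 2 * u ^+ 2 + 1 / 2 * al * h ^+ 2 * q ^+ 2 + g * (h - hbar)
     + 1 / 2 * be * g * h * p ^+ 2) * h' =
  h * (1 / 2 * (u + u)) * u' + 1 / 6 * al * (h * (h * h)) * (q + q) * q' +
  1 / 4 * be * g * (h * h) * (p + p) * p' +
  (1 / 2 * u * u + 1 / 6 * al * ((h * h + (h * h + h * h)) * q) * q +
   1 / 2 * g * (h - hbar + (h - hbar)) + 1 / 4 * be * g * ((h + h) * p) * p) * h'.
Proof. by field. Qed.

End EnergyAlgebra.

(** * Energy of a solution *)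

Section Solution.
Variable R : realType.
Local Notation mu := (@lebesgue_measure R).
Local Notation mR := (measurableTypeR R).
Local Notation mble f := (@measurable_fun _ _ mR mR setT f).
Local Notation intg A f := (mu.-integrable A (EFin \o f)).
Variables (g be hbar T : R) (hi ui : R -> R) (h u : R -> R -> R).
Hypotheses (be0 : 0 < be) (T0 : 0 < T).
Hypothesis sol : msgn_solution g be hbar hi ui T h u.
Local Notation al := (msgn_alpha be).
Local Notation J := (`[0, T]%classic : set R).
Local Notation H := (fun t x => h t x - hbar).

Lemma derive1_subc (f : R -> R) (c : R) : derive1 (fun x => f x - c) = derive1 f.
Proof.
apply/funext => x; rewrite /derive1.
suff -> : (fun k => k^-1 *: (f (k + x) - c - (f x - c))) =
  (fun k => k^-1 *: (f (k + x) - f x)) by [].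
by apply/funext => k; congr (_ *: _); ring.
Qed.

Let d1H : d1 H = d1 h.
Proof. by apply/funext => t; rewrite /d1 derive1_subc. Qed.

Let d2H : d2 H = d2 h.
Proof. by apply/funext => t; rewrite /d2 derive1_subc. Qed.

(** Only [h - hbar] is a path in H^2, but [h] has the same derivatives; the predicate selects the
    occurrences to be replaced. *)
Let d1HP (P : (R -> R -> R) -> Prop) : P (d1 H) -> P (d1 h).
Proof. by rewrite d1H. Qed.

Let d2HP (P : (R -> R -> R) -> Prop) : P (d2 H) -> P (d2 h).
Proof. by rewrite d2H. Qed.

Let cH s : J s -> continuous (H s).
Proof.
case: sol => c _ _ _ _ /c[ch _] x; apply: cvgB; [exact: ch|exact: cvg_cst].
Qed.

Let cu s : J s -> continuous (u s). Proof. by case: sol => c _ _ _ _ /c[]. Qed.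
Let C0H : C0_sobolev J 2 H. Proof. by case: sol => _ []. Qed.
Let C0u : C0_sobolev J 2 u. Proof. by case: sol => _ []. Qed.

Opaque d1 d2.

Lemma sol_h t : J t -> [/\ prim (h t) (d1 h t), prim (d1 h t) (d2 h t),
  L2 (H t), L2 (d1 h t) & L2 (d2 h t)].
Proof.
move=> Jt; have [p1 p2 L0 L1 L2'] := path_rep (cH Jt) (proj1 (C0H Jt)).
have {}p1 := d1HP (P := fun k => prim (H t) (k t)) p1.
have {}p2 := d1HP (P := fun k => prim (k t) (d2 H t)) p2.
have {}p2 := d2HP (P := fun k => prim (d1 h t) (k t)) p2.
have {}L1 := d1HP (P := fun k => L2 (k t)) L1.
have {}L2' := d2HP (P := fun k => L2 (k t)) L2'.
have p0 : prim (h t) (d1 h t).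
  apply: (prim_ext (primD p1 (prim_cst hbar))) => x /=; first by ring.
  exact: addr0.
exact: And5 p0 p2 L0 L1 L2'.
Qed.

Lemma sol_u t : J t -> [/\ prim (u t) (d1 u t), prim (d1 u t) (d2 u t),
  L2 (u t), L2 (d1 u t) & L2 (d2 u t)].
Proof. by move=> Jt; exact: path_rep (cu Jt) (proj1 (C0u Jt)). Qed.

Lemma alE : al = 1 + 3 / 2 * be. Proof. by []. Qed.

(** Every [wderiv] of the system is traded for an explicit expression in [d1], [d2] and the
    derivatives of a representative [v] of the nonlocal term. *)
Lemma sol_evolution : exists ht ut : R -> R -> R,
  [/\ C1_sobolev J 1 H ht, C1_sobolev J 1 u ut &
  forall t, J t -> exists v vx vxx : R -> R,
   [/\ [/\ prim v vx, prim vx vxx, L2 v, L2 vx & L2 vxx],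
      {ae mu, forall x, ellip al (h t) (d1 h t) v vx vxx x =
         sourcex_ g be al (h t) (d1 h t) (d1 u t) (d2 h t) (d2 u t) x},
      {ae mu, forall x, ht t x = ht_ (h t) (u t) (d1 h t) (d1 u t) x} &
      {ae mu, forall x, ut t x = ut_ g al (u t) (d1 h t) (d1 u t) v x}]].
Proof.
case: (sol) => _ _ _ _ [ht [ut [C1h C1u eqs]]].
exists ht, ut; apply: And3 C1h C1u _ => t Jt.
have [e1 [v0 [Sv Lv0] e2]] := eqs t Jt.
have [ph phx LH Lhx Lhxx] := sol_h Jt; have [pu pux Lu Lux Luxx] := sol_u Jt.
have mh : mble (h t) by exact: meas_cont (prim_cont ph).
have mu' : mble (u t) by exact: meas_cont (prim_cont pu).
have [v [vx [vxx [pv pvx Lv Lvx [Lvxx vE]]]]] := sobolev2_rep Sv.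
have mv0 : mble v0 by case: Sv => /Lfun_L2[].
have [whu _] := wderiv_ae (mbleM mh mu') (ae_forall (fun x => erefl)) (primM ph pu).
have [wh mwh] := wderiv_ae mh (ae_forall (fun x => erefl)) ph.
have [wu mwu] := wderiv_ae mu' (ae_forall (fun x => erefl)) pu.
have [wv mwv] := wderiv_ae mv0 vE pv.
have [wf mwf] : {ae mu, forall x, wderiv (fun y => h t y ^+ 3 * wderiv v0 y) x =
     3 * h t x ^+ 2 * d1 h t x * vx x + h t x ^+ 3 * vxx x} /\
     mble (wderiv (fun y => h t y ^+ 3 * wderiv v0 y)).
  apply: wderiv_ae; last exact: primM (primX 2 ph) pvx.
    exact: mbleM (mbleX 3 mh) mwv.
  by apply: ae_impl wv => x ->.
have [ws mws] : {ae mu, forall x, wderiv (msgn_source g be (h t) (u t)) x =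
    sourcex_ g be al (h t) (d1 h t) (d1 u t) (d2 h t) (d2 u t) x} /\
    mble (wderiv (msgn_source g be (h t) (u t))).
  apply: wderiv_ae; last exact: (prim_source _ be0 alE ph phx pux).
    rewrite /msgn_source.
    exact: mbleD (mbleB (mbleM (mbleZ (2 / 3 * al) (mbleX 3 mh)) (mbleX 2 mwu))
      (mbleM (mbleZ (1 / 4 * be * g) (mbleX 2 mh)) (mbleX 2 mwh)))
      (mbleZ (g / (2 * al)) (mbleX 2 mh)).
  by apply: ae_impl (ae_conj wh wu) => x [E1 E2]; rewrite /msgn_source E1 E2.
exists v, vx, vxx; apply: And4 (And5 pv pvx Lv Lvx Lvxx) _ _ _.
- apply: ae_impl (ae_conj Lv0 (ae_conj vE (ae_conj wf ws))) => x [E1 [E2 [E3 E4]]].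
  by move: E1; rewrite E4 /Lop E3 E2 => <-.
- apply: ae_impl (ae_conj e1 whu) => x [E1 E2].
  by move: E1; rewrite E2 /ht_; lra.
- apply: ae_impl (ae_conj e2 (ae_conj wh (ae_conj wu vE))) => x [E1 [E2 [E3 E4]]].
  by move: E1; rewrite E2 E3 E4 /ut_ /kappa; lra.
Qed.

Definition En t := nrj g be al hbar (h t) (u t) (d1 h t) (d1 u t).

Lemma sol_cvg t : J t ->
  [/\ cvgU (within J (nbhs t)) h (h t), cvgU (within J (nbhs t)) (d1 h) (d1 h t),
      cvgU (within J (nbhs t)) u (u t) & cvgU (within J (nbhs t)) (d1 u) (d1 u t)] /\
  [/\ cvgL2 (within J (nbhs t)) H (H t), cvgL2 (within J (nbhs t)) (d1 h) (d1 h t),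
      cvgL2 (within J (nbhs t)) u (u t) & cvgL2 (within J (nbhs t)) (d1 u) (d1 u t)].
Proof.
move=> Jt; have [A1 A2 A3 A4] := path_C0 cH C0H Jt.
have {}A2 := d1HP (P := fun k => cvgL2 (within J (nbhs t)) k (k t)) A2.
have {}A4 := d1HP (P := fun k => cvgU (within J (nbhs t)) k (k t)) A4.
have [B1 B2 B3 B4] := path_C0 cu C0u Jt.
have FF : Filter (within J (nbhs t)) by exact: _.
suff A3' : cvgU (within J (nbhs t)) h (h t).
  exact: conj (And4 A3' A4 B3 B4) (And4 A1 A2 B1 B2).
have C : cvgU (within J (nbhs t)) (fun _ _ => hbar) (fun=> hbar).
  by apply: cvgU_cst; [exact: measurable_cst|exists `|hbar|].
have := cvgUD FF A3 C.
have -> : (fun s x => h s x - hbar + hbar) = h by apply/funext => s; apply/funext => x; ring.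
by have -> : (fun x => h t x - hbar + hbar) = h t by apply/funext => x; ring.
Qed.

Lemma En_deriv t (ht ut : R -> R -> R) v vx (A : set mR) : J t -> measurable A ->
  C1_sobolev J 1 H ht -> C1_sobolev J 1 u ut ->
  prim v vx -> L2 v -> L2 vx ->
  {ae mu, forall x, ht t x = ht_ (h t) (u t) (d1 h t) (d1 u t) x} ->
  {ae mu, forall x, ut t x = ut_ g al (u t) (d1 h t) (d1 u t) v x} ->
  (\int[mu]_(x in A) En s x - \int[mu]_(x in A) En t x) / (s - t)
    @[s --> within J t^'] -->
  \int[mu]_(x in A) nrjt g be al hbar (h t) (u t) (d1 h t) (d1 u t)
     (d2 h t) (d2 u t) v vx x.
Proof.
move=> Jt mA C1h C1u pv Lv Lvx htE utE.
have [ph phx LH Lhx Lhxx] := sol_h Jt; have [pu pux Lu Lux Luxx] := sol_u Jt.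
have Pht := prim_ht ph phx pu pux.
have Put := prim_ut g al phx pu pux pv.
have Lht := L2_ht ph pu LH Lhx Lu Lux.
have Lhtx := L2_htx ph phx pu LH Lhx Lhxx Lu Lux Luxx.
have Lut := L2_ut g al pu Lhx Lu Lux Lv.
have Lutx := L2_utx g al pu pux Lhxx Lu Lux Luxx Lvx.
have [Dh Dhx] := path_C1 cH C0H C1h Jt Pht Lht Lhtx htE.
have [Du Dux] := path_C1 cu C0u C1u Jt Put Lut Lutx utE.
have {}Dhx := d1HP (P := fun k => cvgL2 (within J t^') (fun s x => (k s x - k t x) / (s - t)) _) Dhx.
have FF : Filter (within J t^') by exact: _.
have sub := @dwithin_sub R J t.
have [[Uh Uhx Uu Uux] [CH Chx Cu Cux]] := sol_cvg Jt.
move/(cvgU_sub sub): Uh => Uh; move/(cvgU_sub sub): Uhx => Uhx.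
move/(cvgU_sub sub): Uu => Uu; move/(cvgU_sub sub): Uux => Uux.
move/(cvgL2_sub sub): CH => CH; move/(cvgL2_sub sub): Chx => Chx.
move/(cvgL2_sub sub): Cu => Cu; move/(cvgL2_sub sub): Cux => Cux.
(* Factors frozen at time [t] enter the products as constant families. *)
have bU f (fs : R -> R -> R) : cvgU (within J t^') fs f -> cvgU (within J t^') (fun=> f) f.
  by move=> [_ mf bf _]; exact: cvgU_cst.
have kU (k : R) : cvgU (within J t^') (fun _ _ => k) (fun=> k).
  by apply: cvgU_cst; [exact: measurable_cst|exists `|k|].
have sum fs f : cvgL2 (within J t^') fs f -> L2 f ->
  cvgL2 (within J t^') (fun s x => fs s x + f x) (fun x => f x + f x).
  by move=> C L; exact: (cvgL2D FF C (cvgL2_cst FF L)).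
(* [Ca], [Cb], [Cc] and [Cd] give the limits of the factors that [energy_quotient] puts in front of
   the quotients of [u], [u_x], [h_x] and [h]. *)
have Ca := cvgL2_mulU FF Uh (cvgL2Z FF (1 / 2) (sum _ _ Cu Lu)).
have Cb := cvgL2_mulU FF (cvgUM FF (kU (1 / 6 * al)) (cvgUM FF Uh (cvgUM FF Uh Uh))) (sum _ _ Cux Lux).
have Cc := cvgL2_mulU FF (cvgUM FF (kU (1 / 4 * be * g)) (cvgUM FF Uh Uh)) (sum _ _ Chx Lhx).
have Cd1 := cvgL2_mulU FF (cvgUM FF (kU (1 / 2)) (bU _ _ Uu)) (cvgL2_cst FF Lu).
have Cd2 := cvgL2_mulU FF (cvgUM FF (kU (1 / 6 * al)) (cvgUM FF (cvgUD FF (cvgUM FF Uh Uh)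
   (cvgUD FF (cvgUM FF Uh (bU _ _ Uh)) (cvgUM FF (bU _ _ Uh) (bU _ _ Uh)))) (bU _ _ Uux))) (cvgL2_cst FF Lux).
have Cd3 := cvgL2Z FF (1 / 2 * g) (sum _ _ CH LH).
have Cd4 := cvgL2_mulU FF (cvgUM FF (kU (1 / 4 * be * g)) (cvgUM FF (cvgUD FF Uh (bU _ _ Uh)) (bU _ _ Uhx))) (cvgL2_cst FF Lhx).
have Cd := cvgL2D FF (cvgL2D FF (cvgL2D FF Cd1 Cd2) Cd3) Cd4.
have nJ := near_dwithin_self J t; have nt := near_dwithin_neq J t.
have nE : \forall s \near within J t^', intg setT (En s).
  apply: filterS nJ => s Js.
  have [qh qhx MH Mhx Mhxx] := sol_h Js; have [qu qux Mu Mux Muxx] := sol_u Js.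
  exact: intg_nrj qh MH Mhx Mu Mux.
have iEt : intg setT (En t) := intg_nrj g be al ph LH Lhx Lu Lux.
have E : \forall s \near within J t^', forall x, (En s x - En t x) / (s - t) =
  h s x * (1 / 2 * (u s x + u t x)) * ((u s x - u t x) / (s - t)) +
  1 / 6 * al * (h s x * (h s x * h s x)) * (d1 u s x + d1 u t x) *
    ((d1 u s x - d1 u t x) / (s - t)) +
  1 / 4 * be * g * (h s x * h s x) * (d1 h s x + d1 h t x) *
    ((d1 h s x - d1 h t x) / (s - t)) +
  (1 / 2 * u t x * u t x +
   1 / 6 * al * ((h s x * h s x + (h s x * h t x + h t x * h t x)) * d1 u t x) * d1 u t x +
   1 / 2 * g * (h s x - hbar + (h t x - hbar)) +
   1 / 4 * be * g * ((h s x + h t x) * d1 h t x) * d1 h t x) *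
   ((h s x - hbar - (h t x - hbar)) / (s - t)).
  apply: filterS nt => s st x; apply: energy_quotient.
  by rewrite subr_eq0.
have C := cvg_quotient_integral FF mA Ca Cb Cc Cd Du Dux Dhx Dh nE iEt E.
have -> : \int[mu]_(x in A) nrjt g be al hbar (h t) (u t) (d1 h t) (d1 u t)
     (d2 h t) (d2 u t) v vx x = \int[mu]_(x in A) (
  h t x * (1 / 2 * (u t x + u t x)) * ut_ g al (u t) (d1 h t) (d1 u t) v x +
  1 / 6 * al * (h t x * (h t x * h t x)) * (d1 u t x + d1 u t x) *
    utx_ g al (u t) (d1 u t) (d2 h t) (d2 u t) vx x +
  1 / 4 * be * g * (h t x * h t x) * (d1 h t x + d1 h t x) *
    htx_ (h t) (u t) (d1 h t) (d1 u t) (d2 h t) (d2 u t) x +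
  (1 / 2 * u t x * u t x +
   1 / 6 * al * ((h t x * h t x + (h t x * h t x + h t x * h t x)) * d1 u t x) * d1 u t x +
   1 / 2 * g * (h t x - hbar + (h t x - hbar)) +
   1 / 4 * be * g * ((h t x + h t x) * d1 h t x) * d1 h t x) *
   ht_ (h t) (u t) (d1 h t) (d1 u t) x).
  apply: eq_Rintegral => x _; exact: energy_derivative.
exact: C.
Qed.

(** Half-lines serve the moving boundaries, the whole line serves conservation. [v] is returned so
    that the flux and the pressure bound refer to the same nonlocal term. *)
Lemma sol_energy_law t : J t -> exists v vx vxx : R -> R,
  [/\ [/\ prim v vx, prim vx vxx, L2 v, L2 vx & L2 vxx],
      {ae mu, forall x, ellip al (h t) (d1 h t) v vx vxx x =
         sourcex_ g be al (h t) (d1 h t) (d1 u t) (d2 h t) (d2 u t) x},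
    (forall y, (\int[mu]_(x in `]-oo, y]) En s x - \int[mu]_(x in `]-oo, y]) En t x) / (s - t)
      @[s --> within J t^'] --> - flux g be al hbar (h t) (u t) (d1 h t) (d1 u t) vx y) &
    (\int[mu]_x En s x - \int[mu]_x En t x) / (s - t) @[s --> within J t^'] --> (0 : R)].
Proof.
move=> Jt; have [ht [ut [C1h C1u H]]] := sol_evolution.
have [v [vx [vxx [[pv pvx Lv Lvx Lvxx] el htE utE]]]] := H t Jt.
have [ph phx LH Lhx Lhxx] := sol_h Jt; have [pu pux Lu Lux Luxx] := sol_u Jt.
have el' := el; exists v, vx, vxx; apply: And4 (And5 pv pvx Lv Lvx Lvxx) el' _ _.
  move=> y.
  rewrite -(Rint_nrjt_Nyc be0 alE ph phx pu pux pvx LH Lhx Lhxx Lu Lux Luxx Lv Lvx Lvxx el y).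
  exact: (En_deriv Jt (measurable_itv _) C1h C1u pv Lv Lvx htE utE).
rewrite -[X in _ --> X](Rint_nrjt_T be0 alE ph phx pu pux pvx LH Lhx Lhxx Lu Lux Luxx Lv Lvx Lvxx el).
exact: (En_deriv Jt measurableT C1h C1u pv Lv Lvx htE utE).
Qed.

Lemma energy_conserved t : J t -> \int[mu]_x En t x = \int[mu]_x En 0 x.
Proof.
rewrite /= in_itv/= => /andP[t0 tT].
have JJ x : 0 <= x <= t -> J x.
  by rewrite /= in_itv/= => /andP[x0 xt]; rewrite x0 (le_trans xt tT).
apply: (diff_quotient_cst (phi := fun t => \int[mu]_x En t x) t0 JJ) => x /JJ Jx.
by have [v [vx [vxx [_ _ _ ?]]]] := sol_energy_law Jx.
Qed.

Let J0 : J 0. Proof. by rewrite /= in_itv/= lexx ltW. Qed.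

Lemma energy_init Etot : energy g be hbar hi ui = Etot%:E -> \int[mu]_x En 0 x = Etot.
Proof.
have [ph _ LH Lhx _] := sol_h J0; have [pu _ Lu Lux _] := sol_u J0.
case: sol => _ _ _ [/funext hE /funext uE] _.
have mh : mble (h 0) by exact: meas_cont (prim_cont ph).
have mu' : mble (u 0) by exact: meas_cont (prim_cont pu).
have [wh mwh] := wderiv_ae mh (ae_forall (fun x => erefl)) ph.
have [wu mwu] := wderiv_ae mu' (ae_forall (fun x => erefl)) pu.
rewrite /energy -hE -uE => EE.
have iE := intg_nrj g be al ph LH Lhx Lu Lux.
rewrite -[Etot]/(fine Etot%:E) -EE /Rintegral; congr (fine _).
apply: (ae_eq_integral _ _ measurableT).
- by case/integrableP: iE.
- apply/measurable_EFinP.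
  exact: mbleD (mbleD (mbleD (mbleM (mbleZ (1 / 2) mh) (mbleX 2 mu'))
    (mbleM (mbleZ (1 / 6 * al) (mbleX 3 mh)) (mbleX 2 mwu)))
    (mbleZ (1 / 2 * g) (mbleX 2 (proj1 LH))))
    (mbleM (mbleZ (1 / 4 * be * g) (mbleX 2 mh)) (mbleX 2 mwh)).
- by apply: ae_impl (ae_conj wh wu) => x [E1 E2] _; rewrite /En /nrj E1 E2.
Qed.
End Solution.

(** * Energy between the characteristics *)

Section Characteristics.
Variable R : realType.
Local Notation mu := (@lebesgue_measure R).
Local Notation mR := (measurableTypeR R).
Local Notation mble f := (@measurable_fun _ _ mR mR setT f).
Local Notation intg A f := (mu.-integrable A (EFin \o f)).

Lemma contD (f k : R -> R) : continuous f -> continuous k -> continuous (fun x => f x + k x).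
Proof. by move=> cf ck x; apply: cvgD; [exact: cf|exact: ck]. Qed.

Lemma contM (f k : R -> R) : continuous f -> continuous k -> continuous (fun x => f x * k x).
Proof. by move=> cf ck x; apply: cvgM; [exact: cf|exact: ck]. Qed.

Lemma cont_cst (c : R) : continuous (fun _ : R => c).
Proof. by move=> x; exact: cvg_cst. Qed.

Lemma contX (f : R -> R) n : continuous f -> continuous (fun x => f x ^+ n).
Proof.
move=> cf; elim: n => [|n IH]; first exact: cont_cst.
by under eq_fun do rewrite exprS; exact: contM.
Qed.

Lemma cvgUX (F : set_system R) (FF : Filter F) (fs : R -> R -> R) f n :
  cvgU F fs f -> cvgU F (fun s x => fs s x ^+ n) (fun x => f x ^+ n).
Proof.
move=> U; elim: n => [|n IH].
  by apply: cvgU_cst; [exact: measurable_cst|exists `|1|].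
under [X in cvgU F X]eq_fun do under eq_fun do rewrite exprS.
by under [X in cvgU F _ X]eq_fun do rewrite exprS; exact: cvgUM.
Qed.

Let quotientB (a b c d k : R) : ((a - b) - (c - d)) / k = (a - c) / k - (b - d) / k.
Proof. by ring. Qed.

(** The final arithmetic of [F'], with every analytic quantity abstracted to a variable. *)
Let outflow_le (c a q p l m el em fl fm : R) : c * q - a <= l * el - fl ->
  c * p - a <= fm - m * em -> (- fm + em * m) - (- fl + el * l) <= 2 * a - c * (q + p).
Proof. by lra. Qed.

Variables (g be hbar N Etot T t : R) (hi ui : R -> R) (h u : R -> R -> R).
Hypotheses (g0 : 0 < g) (be0 : 0 < be) (hbar0 : 0 < hbar) (t0 : 0 < t) (tT : t <= T).
Hypothesis sol : msgn_solution g be hbar hi ui T h u.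
Hypothesis Nnorm : Linfty_norm t h u = N%:E.
Hypothesis Eenergy : energy g be hbar hi ui = Etot%:E.
Local Notation al := (msgn_alpha be).
Local Notation J := (`[0, T]%classic : set R).
Local Notation e := (En g be hbar h u).

Let Jt s : 0 <= s <= t -> J s.
Proof. by rewrite /= in_itv/= => /andP[-> /le_trans]; apply. Qed.

Lemma sol_pos s x : J s -> 0 < h s x.
Proof.
case: sol => _ _ H _ _ Js; rewrite -lte_fin; apply: (lt_le_trans H).
by apply: ereal_inf_lbound; exists (s, x).
Qed.

Let joint_h s x d : 0 <= s <= t -> 0 < d -> exists2 r, 0 < r & forall s' y : R, 0 <= s' <= t ->
  `|s - s'| < r -> `|x - y| < r -> `|h s x - h s' y| < d.
Proof.
move=> st d0; have Js := Jt st.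
have [[Uh _ _ _] _] := sol_cvg sol Js; have [ph _ _ _ _] := sol_h sol Js.
have [r r0 H] := cvgU_joint x Uh (prim_cont ph) d0.
by exists r => // s' y /Jt; exact: H.
Qed.

Let joint_u s x d : 0 <= s <= t -> 0 < d -> exists2 r, 0 < r & forall s' y : R, 0 <= s' <= t ->
  `|s - s'| < r -> `|x - y| < r -> `|u s x - u s' y| < d.
Proof.
move=> st d0; have Js := Jt st.
have [[_ _ Uu _] _] := sol_cvg sol Js; have [pu _ _ _ _] := sol_u sol Js.
have [r r0 H] := cvgU_joint x Uu (prim_cont pu) d0.
by exists r => // s' y /Jt; exact: H.
Qed.

(** Each bound, if it failed at a point, would fail on a neighbourhood by joint continuity, against
    the essential norm. *)
Lemma sup_bounds s x : 0 <= s <= t -> [/\ `|h s x| <= N, `|u s x| <= N & (h s x)^-1 <= N].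
Proof.
move=> st; have K := ess_norm_le (tau := s) (x := x) t0 st Nnorm.
have hN : `|h s x| <= N.
  rewrite leNgt; apply/negP => hN; apply: K.
  have dd : 0 < `|h s x| - N by rewrite subr_gt0.
  have [r r0 H] := joint_h x st dd.
  exists r => // s' y s't sr xr; have := H s' y s't sr xr.
  move=> D; apply: (@lt_le_trans _ _ `|h s' y|).
    by have := lerB_dist (h s x) (h s' y); lra.
  by apply: le_trans (ler_norm _); rewrite !le_max lexx.
split => //.
  rewrite leNgt; apply/negP => uN; apply: K.
  have dd : 0 < `|u s x| - N by rewrite subr_gt0.
  have [r r0 H] := joint_u x st dd.
  exists r => // s' y s't sr xr; have := H s' y s't sr xr.
  move=> D; apply: (@lt_le_trans _ _ `|u s' y|).
    by have := lerB_dist (u s x) (u s' y); lra.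
  by apply: le_trans (ler_norm _); rewrite !le_max lexx orbT.
have hp := sol_pos x (Jt st).
have N0 : 0 < N by apply: lt_le_trans hN; rewrite normr_gt0 gt_eqF.
rewrite leNgt; apply/negP => hiN; apply: K.
have hN1 : h s x < N^-1 by rewrite -[ltLHS]invrK ltf_pV2 ?posrE ?invr_gt0.
have dd : 0 < N^-1 - h s x by rewrite subr_gt0.
  have [r r0 H] := joint_h x st dd.
exists r => // s' y s't sr xr; have := H s' y s't sr xr => D.
have hp' := sol_pos y (Jt s't).
apply: (@lt_le_trans _ _ `|(h s' y)^-1|).
  rewrite gtr0_norm ?invr_gt0// -[ltLHS]invrK ltf_pV2 ?posrE ?invr_gt0//.
  by move: D; rewrite ltr_norml => /andP[? ?]; lra.
by apply: le_trans (ler_norm _); rewrite !le_max lexx !orbT.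
Qed.

(** Both [h] and its inverse are at most [N] at a point, and their product is 1. *)
Lemma sup_norm_ge1 : 1 <= N.
Proof.
have st : 0 <= (0 : R) <= t by rewrite lexx ltW.
have [h1 _ h2] := sup_bounds 0 st; have hp := sol_pos 0 (Jt st).
rewrite gtr0_norm// in h1; rewrite leNgt; apply/negP => N1.
have : h 0 0 * (h 0 0)^-1 <= N * N by rewrite ler_pM// ?invr_ge0 ltW.
rewrite divff ?gt_eqF//; have N0 : 0 < N by exact: lt_le_trans hp h1.
by rewrite leNgt => /negP; apply; rewrite -[ltRHS]mulr1 ltr_pM// ltW.
Qed.

Let N1 := sup_norm_ge1.

Let hN s x : 0 <= s <= t -> N^-1 <= h s x <= N.
Proof.
move=> st; have [h1 _ h2] := sup_bounds x st; have hp := sol_pos x (Jt st).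
rewrite (le_trans (ler_norm _) h1) andbT -[leRHS]invrK lef_pV2 ?posrE ?invr_gt0//.
exact: lt_le_trans ltr01 N1.
Qed.

Lemma En_cvgU s : J s -> cvgU (within J (nbhs s)) e (e s).
Proof.
move=> Js; have [[Uh Uhx Uu Uux] [CH _ _ _]] := sol_cvg sol Js.
have FF : Filter (within J (nbhs s)) by exact: _.
have kU (k : R) : cvgU (within J (nbhs s)) (fun _ _ => k) (fun=> k).
  by apply: cvgU_cst; [exact: measurable_cst|exists `|k|].
have X1 := cvgUM FF (cvgUM FF (kU (1 / 2)) Uh) (cvgUX FF 2 Uu).
have X2 := cvgUM FF (cvgUM FF (kU (1 / 6 * al)) (cvgUX FF 3 Uh)) (cvgUX FF 2 Uux).
have X3 := cvgUM FF (kU (1 / 2 * g)) (cvgUX FF 2 (cvgUD FF Uh (kU (- hbar)))).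
have X4 := cvgUM FF (cvgUM FF (kU (1 / 4 * be * g)) (cvgUX FF 2 Uh)) (cvgUX FF 2 Uhx).
exact: (cvgUD FF (cvgUD FF (cvgUD FF X1 X2) X3) X4).
Qed.

Lemma En_cont s : J s -> continuous (e s).
Proof.
move=> Js; have [ph phx _ _ _] := sol_h sol Js; have [pu pux _ _ _] := sol_u sol Js.
have ch := prim_cont ph; have chx := prim_cont phx.
have cu := prim_cont pu; have cux := prim_cont pux.
have c1 := contM (contM (@cont_cst (1 / 2)) ch) (contX (n := 2) cu).
have c2 := contM (contM (@cont_cst (1 / 6 * al)) (contX (n := 3) ch)) (contX (n := 2) cux).
have c3 := contM (@cont_cst (1 / 2 * g)) (contX (n := 2) (contD ch (@cont_cst (- hbar)))).
have c4 := contM (contM (@cont_cst (1 / 4 * be * g)) (contX (n := 2) ch)) (contX (n := 2) chx).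
exact: (contD (contD (contD c1 c2) c3) c4).
Qed.

Lemma En_intg s : J s -> mble (e s) /\ intg setT (e s).
Proof.
move=> Js; have [ph _ LH Lhx _] := sol_h sol Js; have [pu _ Lu Lux _] := sol_u sol Js.
by split; [exact: meas_cont (En_cont Js)|exact: intg_nrj ph LH Lhx Lu Lux].
Qed.

Variables X Y : R -> R.
Hypothesis XY : X t = Y t.
Hypothesis dX : forall s, J s ->
  (X r - X s) / (r - s) @[r --> within J s^'] --> lambda_speed g be h u s (X s).
Hypothesis dY : forall s, J s ->
  (Y r - Y s) / (r - s) @[r --> within J s^'] --> mu_speed g be h u s (Y s).

Let kap := (al - 1) / al * g.
(** [diss_coef] and [flux_coef] are [c0] and [A1] of [flux_along], with the pressure bounded in
    terms of [Etot]. *)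
Definition diss_coef := al / 6 * N^-1 ^+ 3 * Num.sqrt (kap * N^-1).
Definition flux_coef := N * (press_bound g al hbar N Etot + kap / 2 * (N ^+ 2 + hbar ^+ 2)).

Let along s (Z : R -> R) (f : R -> R -> R) : J s -> cvgU (within J (nbhs s)) f (f s) ->
  continuous (f s) -> Z r @[r --> within J (nbhs s)] --> Z s ->
  f r (Z r) @[r --> within J (nbhs s)] --> f s (Z s).
Proof. by move=> Js U cf cZ; exact: (cvgU_along _ U cf cZ). Qed.

Let XYc s : J s -> X r @[r --> within J (nbhs s)] --> X s /\
  Y r @[r --> within J (nbhs s)] --> Y s.
Proof. by move=> Js; split; [exact: diff_quotient_cvg (dX Js)|exact: diff_quotient_cvg (dY Js)]. Qed.

Let grad_cvg s (Z : R -> R) : J s -> Z r @[r --> within J (nbhs s)] --> Z s ->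
  d1 u r (Z r) @[r --> within J (nbhs s)] --> d1 u s (Z s) /\
  Num.sqrt kap * (Num.sqrt (h r (Z r)))^-1 * d1 h r (Z r) @[r --> within J (nbhs s)] -->
  Num.sqrt kap * (Num.sqrt (h s (Z s)))^-1 * d1 h s (Z s).
Proof.
move=> Js cZ; have [[Uh Uhx Uu Uux] _] := sol_cvg sol Js.
have [ph phx _ _ _] := sol_h sol Js; have [pu pux _ _ _] := sol_u sol Js.
split; first exact: along Js Uux (prim_cont pux) cZ.
apply: cvgM; last exact: along Js Uhx (prim_cont phx) cZ.
apply: cvgM; first exact: cvg_cst.
apply: cvgV; first by rewrite gt_eqF// sqrtr_gt0 sol_pos.
apply: (cvg_comp _ _ (along Js Uh (prim_cont ph) cZ)); exact: sqrt_continuous.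
Qed.

Let Q s := riemannQ g be h u s (X s).
Let P s := riemannP g be h u s (Y s).

Let QE s : Q s = d1 u s (X s) - Num.sqrt kap * (Num.sqrt (h s (X s)))^-1 * d1 h s (X s).
Proof. by rewrite !d1E. Qed.

Let PE s : P s = d1 u s (Y s) + Num.sqrt kap * (Num.sqrt (h s (Y s)))^-1 * d1 h s (Y s).
Proof. by rewrite !d1E. Qed.

(** Uniform convergence in time of [h], [d1 h] and [d1 u], evaluated along continuous curves. It
    makes the right-hand side of the differential inequality continuous and the final integrals
    finite. *)
Lemma riemann_cont : {within `[0, t], continuous Q} /\ {within `[0, t], continuous P}.
Proof.
have sub (s : R) (A : set R) : within J (nbhs s) A -> within (`[0, t]%classic : set R) (nbhs s) A.
  rewrite /within/=; apply: filterS => r H; rewrite in_itv/= => rt.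
  exact: H (Jt rt).
have -> : Q = fun s => d1 u s (X s) - Num.sqrt kap * (Num.sqrt (h s (X s)))^-1 * d1 h s (X s).
  by apply/funext => s; exact: QE.
have -> : P = fun s => d1 u s (Y s) + Num.sqrt kap * (Num.sqrt (h s (Y s)))^-1 * d1 h s (Y s).
  by apply/funext => s; exact: PE.
split; apply/subspace_continuousP => s; rewrite /= in_itv/= => /Jt Js A /=.
- move=> nA; apply: sub; move: A nA.
  have [cu' ch'] := grad_cvg Js (proj1 (XYc Js)).
  exact: (cvgB cu' ch').
- move=> nA; apply: sub; move: A nA.
  have [cu' ch'] := grad_cvg Js (proj2 (XYc Js)).
  exact: (cvgD cu' ch').
Qed.

Let Phi s y := \int[mu]_(x in `]-oo, y]) e s x.

Lemma boundary_derivative s : 0 <= s <= t -> exists2 D,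
   ((Phi r (Y r) - Phi r (X r)) - (Phi s (Y s) - Phi s (X s))) / (r - s)
     @[r --> within J s^'] --> D &
   D <= 2 * flux_coef - diss_coef * (Q s ^+ 2 + P s ^+ 2).
Proof.
move=> st; have Js := Jt st.
have T0 : 0 < T by exact: lt_le_trans t0 tT.
have E0 : \int[mu]_x e 0 x = Etot := energy_init T0 sol Eenergy.
have [v [vx [vxx [[pv pvx Lv Lvx Lvxx] el fl _]]]] := sol_energy_law be0 sol Js.
have [ph phx LH Lhx Lhxx] := sol_h sol Js; have [pu pux Lu Lux Luxx] := sol_u sol Js.
have nE : \forall r \near within J s^', mble (e r) /\ intg setT (e r).
  by apply: filterS (near_dwithin_self J s) => r; exact: En_intg.
have mX := moving_boundary nE (En_cvgU Js) (En_cont Js) (dX Js) (fl (X s)).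
have mY := moving_boundary nE (En_cvgU Js) (En_cont Js) (dY Js) (fl (Y s)).
pose f := flux g be al hbar (h s) (u s) (d1 h s) (d1 u s) vx.
exists ((- f (Y s) + e s (Y s) * mu_speed g be h u s (Y s)) -
        (- f (X s) + e s (X s) * lambda_speed g be h u s (X s))).
  have -> : (fun r => ((Phi r (Y r) - Phi r (X r)) - (Phi s (Y s) - Phi s (X s))) / (r - s)) =
    (fun r => (Phi r (Y r) - Phi s (Y s)) / (r - s) - (Phi r (X r) - Phi s (X s)) / (r - s)).
    by apply/funext => r; exact: quotientB.
  exact: (cvgB mY mX).
(* Conservation turns [Etot] into the energy at time [s], the quantity in which [press_le] is
   stated. *)
have prb x : `|press g be al hbar (h s) (d1 h s) (d1 u s) vx x| <= press_bound g al hbar N Etot.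
  rewrite -E0 -(energy_conserved be0 sol Js).
  by apply: (press_le g0 be0 (alE be) ph phx pux pv pvx LH Lhx Lhxx Lu Lux Luxx Lv Lvx el N1 _ hbar0) => y; exact: hN.
have [_ uX _] := sup_bounds (X s) st; have [_ uY _] := sup_bounds (Y s) st.
have [BX _] := @flux_along R g be al hbar N _ (h s (X s)) (u s (X s)) (d1 h s (X s))
  (d1 u s (X s)) (vx (X s)) _ g0 be0 (alE be) N1 (hN (X s) st) uX (prb (X s)) erefl.
have [_ BY] := @flux_along R g be al hbar N _ (h s (Y s)) (u s (Y s)) (d1 h s (Y s))
  (d1 u s (Y s)) (vx (Y s)) _ g0 be0 (alE be) N1 (hN (Y s) st) uY (prb (Y s)) erefl.
have {}BX : diss_coef * Q s ^+ 2 - flux_coef <= lambda_speed g be h u s (X s) * e s (X s) - f (X s).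
  by rewrite QE; exact: BX.
have {}BY : diss_coef * P s ^+ 2 - flux_coef <= f (Y s) - mu_speed g be h u s (Y s) * e s (Y s).
  by rewrite PE; exact: BY.
exact: outflow_le BX BY.
Qed.

Lemma energy_balance :
  diss_coef * (\int[mu]_(s in `[0, t]) (Q s ^+ 2 + P s ^+ 2)) <= 2 * flux_coef * t + Etot.
Proof.
have T0 : 0 < T by exact: lt_le_trans t0 tT.
have E0 : \int[mu]_x e 0 x = Etot := energy_init T0 sol Eenergy.
have [cQ cP] := riemann_cont.
have cS : {within `[0, t], continuous (fun s => Q s ^+ 2 + P s ^+ 2)}.
  by move=> s; apply: cvgD; apply: cvgM; [exact: cQ|exact: cQ|exact: cP|exact: cP].
pose G s := 2 * flux_coef - diss_coef * (Q s ^+ 2 + P s ^+ 2).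
have cG : {within `[0, t], continuous G}.
  by move=> s; apply: cvgB; [exact: cvg_cst|apply: cvgM; [exact: cvg_cst|exact: cS]].
have iS : intg `[0, t] (fun s => Q s ^+ 2 + P s ^+ 2).
  by apply: continuous_compact_integrable => //; exact: segment_compact.
have /choice[D HD] : forall s : R, exists d : R, 0 <= s <= t ->
   (((Phi r (Y r) - Phi r (X r)) - (Phi s (Y s) - Phi s (X s))) / (r - s)
     @[r --> within J s^'] --> d) /\ d <= G s.
  (* Outside [[0, t]] the implication is void and 0 is a default value. *)
  move=> s; have [st|nst] := pselect (0 <= s <= t); last by exists 0.
  by have [d H1 H2] := boundary_derivative st; exists d.
have := @diff_quotient_ineq R J (fun s => Phi s (Y s) - Phi s (X s)) D G 0 t (ltW t0)
  Jt (fun s st => proj1 (HD s st)) (fun s st => proj2 (HD s st)) cG.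
rewrite XY subrr sub0r.
have J0 : J 0 by rewrite /= in_itv/= lexx ltW.
have [me ie] := En_intg J0.
have z0 : 0 <= (0 : R) <= t by rewrite lexx ltW.
have e0 x : 0 <= e 0 x.
  exact: (nrj_ge0 hbar (u 0) (d1 h 0) (d1 u 0) g0 be0 (alE be) N1 (fun y => hN y z0)).
have P1 : 0 <= Phi 0 (X 0) by apply: Rintegral_ge0 => x _; exact: e0.
have P2 : Phi 0 (Y 0) <= Etot.
  rewrite -E0 /Phi /Rintegral; apply: fine_le.
  - by apply: integrable_fin_num => //; exact: intgT.
  - exact: integrable_fin_num.
  apply: ge0_subset_integral => //; first exact/measurable_EFinP.
  by move=> x _; rewrite lee_fin.
have -> : \int[mu]_(x in `[0, t]) G x =
    2 * flux_coef * t - diss_coef * \int[mu]_(s in `[0, t]) (Q s ^+ 2 + P s ^+ 2).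
  rewrite RintegralB//; [|exact: intg_cst|exact: intg_scale].
  by rewrite Rint_cst ?(ltW t0)// subr0 RintegralZl.
move: (\int[mu]_(s in `[0, t]) _) P1 P2 => I P1 P2; lra.
Qed.

End Characteristics.

(** * The constants of the estimate *)

Lemma diss_coef_gt0 (R : realType) (g be N : R) : 0 < g -> 0 < be -> 1 <= N -> 0 < diss_coef g be N.
Proof.
move=> g0 be0 N1; have N0 : 0 < N by lra.
have al1 : 0 < msgn_alpha be - 1.
  by rewrite /msgn_alpha addrAC subrr add0r mulr_gt0// divr_gt0.
have al0 : 0 < msgn_alpha be by lra.
rewrite /diss_coef mulr_gt0//.
  by rewrite mulr_gt0 ?divr_gt0 ?exprn_gt0 ?invr_gt0.
by rewrite sqrtr_gt0 !mulr_gt0 ?divr_gt0 ?invr_gt0.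
Qed.

Theorem lemma5 (R : realType) (g beta hbar N Etot : R) :
  0 < g -> 0 < beta -> 0 < hbar ->
  exists A B : R, [/\ 0 < A, 0 < B &
    forall (h0 u0 : R -> R) (h u : R -> R -> R) (Tmax : \bar R) (t : R),
      sobolev 2 (fun x => h0 x - hbar) -> sobolev 2 u0 ->
      (0 < ereal_inf (range (EFin \o h0)))%E ->
      is_Tmax g beta hbar h0 u0 Tmax ->
      (forall T : R, 0 < T -> (T%:E < Tmax)%E ->
        msgn_solution g beta hbar h0 u0 T h u) ->
      0 <= t -> (t%:E < Tmax)%E ->
      Linfty_norm t h u = N%:E ->
      energy g beta hbar h0 u0 = Etot%:E ->
      forall (x1 x2 : R) (X Y : R -> R),
        let J := [set s : R | 0 <= s /\ (s%:E < Tmax)%E] in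
        characteristic J (lambda_speed g beta h u) x1 X ->
        characteristic J (mu_speed g beta h u) x2 Y ->
        x1 < x2 -> X t = Y t ->
        (\int[@lebesgue_measure R]_(tau in `[0%R, t])
            (riemannQ g beta h u tau (X tau) ^+ 2)%:E
         + \int[@lebesgue_measure R]_(tau in `[0%R, t])
            (riemannP g beta h u tau (Y tau) ^+ 2)%:E
         <= (A * t + B)%:E)%E].
Proof.
move=> g0 be0 hbar0.
pose c := diss_coef g beta N.
pose a := flux_coef g beta hbar N Etot.
(* [N] and [Etot] are still arbitrary reals here, and [0 < c] is known only once a solution with
   [t > 0] yields [1 <= N]; absolute values plus 1 are positive regardless. *)
exists (`|2 * a / c| + 1), (`|Etot / c| + 1); split; [by rewrite ltr_wpDl|by rewrite ltr_wpDl|].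
move=> h0 u0 h u Tmax t _ _ _ _ sol t0 tT nN nE x1 x2 X Y J [X0 dX] [Y0 dY] _ XY.
(* At [t = 0] the norm only sees a null set and says nothing about [N], but both integrals
   vanish. *)
move: t0; rewrite le_eqVlt => /predU1P[<-|t0].
  by rewrite set_itv1 !integral_set1 adde0 mulr0 add0r lee_fin addr_ge0.
(* A closed interval beyond [t] on which the solution is available: up to the midpoint of [t] and
   [Tmax], or to [t + 1] when [Tmax] is infinite. *)
have [T [tT' TT]] : exists T, t < T /\ (T%:E < Tmax)%E.
  case: Tmax tT {sol J dX dY} => [r| |] //; last by exists (t + 1); rewrite ltrDl ltr01 ltry.
  rewrite lte_fin => tr; exists ((t + r) / 2); rewrite lte_fin; lra.
have T0 : 0 < T by exact: lt_trans t0 tT'.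
have S := sol T T0 TT.
have sub (s : R) (A : set R) : within J s^' A -> within (`[0, T]%classic : set R) s^' A.
  rewrite /within/=; apply: filterS => r H; rewrite in_itv/= => /andP[r0 rT].
  by apply: H; split => //; apply: le_lt_trans TT; rewrite lee_fin.
have inJ s : (`[0, T]%classic : set R) s -> J s.
  rewrite /= in_itv/= => /andP[s0 sT]; split => //.
  by apply: le_lt_trans TT; rewrite lee_fin.
have dX' s : (`[0, T]%classic : set R) s ->
  (X r - X s) / (r - s) @[r --> within (`[0, T]%classic : set R) s^'] --> lambda_speed g beta h u s (X s).
  by move=> /inJ Js A /(dX s Js); exact: sub.
have dY' s : (`[0, T]%classic : set R) s ->
  (Y r - Y s) / (r - s) @[r --> within (`[0, T]%classic : set R) s^'] --> mu_speed g beta h u s (Y s).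
  by move=> /inJ Js A /(dY s Js); exact: sub.
have c0 : 0 < c by apply: diss_coef_gt0 => //; exact: (sup_norm_ge1 t0 (ltW tT') S nN).
have [cQ cP] := riemann_cont (ltW tT') S dX' dY'.
have bal := energy_balance g0 be0 hbar0 t0 (ltW tT') S nN nE XY dX' dY'.
pose Q s := riemannQ g beta h u s (X s); pose P s := riemannP g beta h u s (Y s).
rewrite -/Q -/P in cQ cP.
change (is_true (c * Rintegral (@lebesgue_measure R) `[0, t] (fun s => Q s ^+ 2 + P s ^+ 2) <=
  2 * a * t + Etot)) in bal.
have i2 (f : R -> R) : {within `[0, t], continuous f} ->
    (@lebesgue_measure R).-integrable `[0, t] (EFin \o (fun s => f s ^+ 2)).
  move=> cf; apply: continuous_compact_integrable; first exact: segment_compact.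
  by move=> s; apply: cvgM; exact: cf.
have iQ := i2 _ cQ; have iP := i2 _ cP.
rewrite -(fineK (integrable_fin_num _ iQ))// -(fineK (integrable_fin_num _ iP))//.
rewrite -EFinD lee_fin.
move: bal; rewrite RintegralD// => bal.
rewrite (@le_trans _ _ (2 * a / c * t + Etot / c))//.
  by rewrite mulrAC -mulrDl ler_pdivlMr// mulrC.
have t' := ltW t0; have := ler_norm (2 * a / c); have := ler_norm (Etot / c).
move: (2 * a / c) (Etot / c) => x y; nra.
Qed.
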